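(* Let $(V,\bar g)$ be an $(n+1)$-dimensional ($n\ge3$) static spherically symmetric spacetime with metric $\bar g=-f^2(r)dt^2+\frac{1}{f^2(r)}dr^2+r^2g_{S^{n-1}}$, where $f:I\subset[0,\infty)\to(0,\infty)$ satisfies $\frac{f^2-1}{r^2}-\frac{ff'}{r}\le0$. Let $\Sigma$ be a spacelike codimension 2 submanifold lying in a standard null cone of $(V,\bar g)$. Suppose the mean curvature vector $H$ of $\Sigma$ has constant norm. Then $\Sigma$ is a sphere of symmetry.
   Context: $g_{S^{n-1}}$ is the round metric of constant sectional curvature $1$ on $S^{n-1}$. ''Constant norm'' means that $\bar g(H,H)$ is constant on $\Sigma$. $(V,\bar g)$ is a Lorentz space form when $f^2=1-\kappa r^2$ for a constant $\kappa$ (Minkowski for $\kappa=0$, anti-de Sitter for $\kappa<0$, de Sitter for $\kappa>0$, in their static patches). A sphere of symmetry is a sphere $\{t=t_0,\ r=r_0\}$ or, when $(V,\bar g)$ is a Lorentz space form, its image under a Lorentz transformation, i.e. an isometry of the space form induced by a linear isometry: a Lorentz transformation of $\mathbb R^{n,1}$ for Minkowski space, and a linear isometry of the ambient flat space $\mathbb R^{n,2}$, resp. $\mathbb R^{n+1,1}$, for anti-de Sitter, resp. de Sitter, viewed as a quadric; these may be composed with time translations. A standard null cone is a null hypersurface emanating from a sphere of symmetry. With $r^*=\int\frac{dr}{f^2}$, $v=t+r^*$, $w=t-r^*$ one has $\bar g=-f^2\,dv\,dw+r^2g_{S^{n-1}}$, and the outgoing standard null cones are $\{w=w_0\}$. A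 spacelike codimension 2 submanifold lying in a standard null cone is always understood to be a smooth graph over the sphere of symmetry; e.g. in $\{w=w_0\}$, $\Sigma=F(S^{n-1})$ with $F(x)=(v(x),w_0,x)$ for a smooth function $v$ on $S^{n-1}$.
   Formalization: Lorentz images of spheres are allowed, in hypothesis and conclusion, whenever f²=1−κr² on a subinterval of radii containing those of Σ, not only when all of V is a space form; otherwise a boosted sphere in a flat region of a V not globally a space form is a counterexample. *)

(* Defs.v *)
From HB Require Import structures.
From mathcomp Require Import all_boot all_order all_algebra.
From mathcomp Require Import all_classical all_reals all_analysis.

Set Implicit Arguments.
Unset Strict Implicit.
Unset Printing Implicit Defensive.

Import Order.TTheory GRing.Theory Num.Theory.
Import numFieldNormedType.Exports.

Local Open Scope classical_set_scope.
Local Open Scope ring_scope.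

(* The library norm on 'rV[R]_n is the sup norm, hence [eucl]. *)
Definition eucl (R : realType) (n : nat) (x : 'rV[R]_n) : R :=
  Num.sqrt (\sum_i x 0 i ^+ 2).

Definition sphere (R : realType) (n : nat) : set 'rV[R]_n :=
  [set x | eucl x = 1].

(* A map on the sphere is given by a map on 'rV[R]_n of which only the values
   on [sphere] matter. It is differentiated through its extension to
   R^n \ {0} that is homogeneous of degree 0. *)
Definition hext (R : realType) (n : nat) (T : Type) (F : 'rV[R]_n -> T)
    (x : 'rV[R]_n) : T := F ((eucl x)^-1 *: x).

Definition iter_derive (R : realType) (V W : normedModType R) (vs : seq V)
    (f : V -> W) : V -> W :=
  foldr (fun v (h : V -> W) => 'D_v h) f vs.

Definition smooth_on (R : realType) (V W : normedModType R) (U : set V)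
    (f : V -> W) : Prop :=
  forall (vs : seq V) (x : V), U x ->
    {for x, continuous (iter_derive vs f)} /\
    (forall v : V, derivable (iter_derive vs f) x v).

Definition smooth_sphere (R : realType) (n : nat) (W : normedModType R)
    (F : 'rV[R]_n -> W) : Prop :=
  smooth_on [set x : 'rV[R]_n | x != 0] (hext F).

Definition nondegenerate_interval (R : realType) (I : set R) : Prop :=
  is_interval I /\ exists a b : R, [/\ I a, I b & a < b].

(** Mean curvature vector of a map from the unit sphere of R^n into R^N
    endowed with a semi-Riemannian metric [g]. *)

Definition inner (R : realType) (N : nat) (g : 'rV[R]_N -> 'M[R]_N)
    (p u v : 'rV[R]_N) : R := (u *m g p *m v^T) 0 0.

Definition dmetric (R : realType) (N : nat) (g : 'rV[R]_N -> 'M[R]_N)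
    (p : 'rV[R]_N) (a b c : 'I_N) : R :=
  'D_(delta_mx 0 a) (fun q => g q b c : R) p.

Definition christoffel (R : realType) (N : nat) (g : 'rV[R]_N -> 'M[R]_N)
    (p : 'rV[R]_N) (a b c : 'I_N) : R :=
  2^-1 * \sum_(d < N) (invmx (g p)) a d *
    (dmetric g p b d c + dmetric g p c d b - dmetric g p d b c).

Definition dmap (R : realType) (n N : nat) (F : 'rV[R]_n -> 'rV[R]_N)
    (x u : 'rV[R]_n) : 'rV[R]_N := 'D_u (hext F) x.

(* For u and v orthogonal to x this is (nabla dF)(u, v), the Hessian of F with
   respect to the round metric on the source and [g] on the target: no
   Christoffel symbols of the source appear because the radial derivative of
   [hext F] vanishes. *)
Definition hess_map (R : realType) (n N : nat) (g : 'rV[R]_N -> 'M[R]_N)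
    (F : 'rV[R]_n -> 'rV[R]_N) (x u v : 'rV[R]_n) : 'rV[R]_N :=
  'D_u ('D_v (hext F)) x +
  \row_(a < N) \sum_(b < N) \sum_(c < N)
    christoffel g (F x) a b c * dmap F x u 0 b * dmap F x v 0 c.

(* A basis (by rows) of the tangent space of the sphere at x. *)
Definition frame (R : realType) (n : nat) (x : 'rV[R]_n) :
    'M[R]_(\rank (kermx x^T), n) := row_base (kermx x^T).

Definition induced (R : realType) (n N : nat) (g : 'rV[R]_N -> 'M[R]_N)
    (F : 'rV[R]_n -> 'rV[R]_N) (x : 'rV[R]_n) :
    'M[R]_(\rank (kermx x^T)) :=
  \matrix_(i, j)
    inner g (F x) (dmap F x (row i (frame x))) (dmap F x (row j (frame x))).

Definition normal_part (R : realType) (n N : nat) (g : 'rV[R]_N -> 'M[R]_N)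
    (F : 'rV[R]_n -> 'rV[R]_N) (x : 'rV[R]_n) (w : 'rV[R]_N) : 'rV[R]_N :=
  w - \sum_i \sum_j
        ((invmx (induced g F x)) i j *
         inner g (F x) w (dmap F x (row j (frame x)))) *:
        dmap F x (row i (frame x)).

Definition mean_curvature (R : realType) (n N : nat)
    (g : 'rV[R]_N -> 'M[R]_N) (F : 'rV[R]_n -> 'rV[R]_N) (x : 'rV[R]_n) :
    'rV[R]_N :=
  \sum_i \sum_j (invmx (induced g F x)) i j *:
    normal_part g F x
      (hess_map g F x (row i (frame x)) (row j (frame x))).

Definition spacelike (R : realType) (n N : nat) (g : 'rV[R]_N -> 'M[R]_N)
    (F : 'rV[R]_n -> 'rV[R]_N) : Prop :=
  forall x u : 'rV[R]_n, sphere x -> u *m x^T = 0 -> u != 0 ->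
    0 < inner g (F x) (dmap F x u) (dmap F x u).

Definition constant_norm_mean_curvature (R : realType) (n N : nat)
    (g : 'rV[R]_N -> 'M[R]_N) (F : 'rV[R]_n -> 'rV[R]_N) : Prop :=
  exists c : R, forall x : 'rV[R]_n, sphere x ->
    inner g (F x) (mean_curvature g F x) (mean_curvature g F x) = c.

(** The static spherically symmetric spacetime, in the coordinates
    (t, y) in R x R^n with r = |y|. *)

Definition tcoord (R : realType) (n : nat) (p : 'rV[R]_(1 + n)) : R :=
  lsubmx p 0 0.
Definition ycoord (R : realType) (n : nat) (p : 'rV[R]_(1 + n)) : 'rV[R]_n :=
  rsubmx p.
Definition radius (R : realType) (n : nat) (p : 'rV[R]_(1 + n)) : R :=
  eucl (ycoord p).

Definition event (R : realType) (n : nat) (t : R) (y : 'rV[R]_n) :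
    'rV[R]_(1 + n) := row_mx t%:M y.

Definition spacetime (R : realType) (n : nat) (I : set R) :
    set 'rV[R]_(1 + n) := [set p | I (radius p)].

(* Since |dy|^2 = dr^2 + r^2 g_S and r dr = y.dy, the metric
   - f^2 dt^2 + f^-2 dr^2 + r^2 g_S equals
   - f^2 dt^2 + |dy|^2 + (f^-2 - 1) r^-2 (y.dy)^2.
   At y = 0 (relevant only if 0 is in I, f 0 = 1) the last term vanishes. *)
Definition static_metric (R : realType) (n : nat) (f : R -> R)
    (p : 'rV[R]_(1 + n)) : 'M[R]_(1 + n) :=
  let r := radius p in
  block_mx (- f r ^+ 2)%:M 0
           0 (1%:M + ((f r ^- 2 - 1) / r ^+ 2) *: ((ycoord p)^T *m ycoord p)).

Definition slice (R : realType) (n : nat) (t0 r0 : R) : set 'rV[R]_(1 + n) :=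
  [set p | tcoord p = t0 /\ radius p = r0].

(** Lorentz space forms. *)

(* [sf_form] is the flat metric of the ambient space, [sf_emb] the embedding
   of the static patch, [sf_trans] the translations allowed besides linear
   isometries. *)
Record space_form (R : realType) (n : nat) := SpaceForm {
  sf_dim : nat;
  sf_form : 'M[R]_sf_dim;
  sf_emb : 'rV[R]_(1 + n) -> 'rV[R]_sf_dim;
  sf_trans : set 'rV[R]_sf_dim }.

Definition flin (R : realType) (kappa r : R) : R :=
  Num.sqrt (1 - kappa * r ^+ 2).

Definition minkowski (R : realType) (n : nat) : space_form R n :=
  @SpaceForm R n (1 + n)
    (block_mx (-1)%:M 0 0 1%:M) id
    (range (fun s : R => event s 0)).

(* kappa < 0: the quadric <X, X> = 1 / kappa in R^{n,2}. *)
Definition anti_de_sitter (R : realType) (n : nat) (kappa : R) :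
    space_form R n :=
  let k := Num.sqrt (- kappa) in
  @SpaceForm R n (1 + (1 + n))
    (block_mx (-1)%:M 0 0 (block_mx (-1)%:M 0 0 1%:M))
    (fun p =>
       event (flin kappa (radius p) / k * cos (k * tcoord p))
         (event (flin kappa (radius p) / k * sin (k * tcoord p)) (ycoord p)))
    [set 0].

(* kappa > 0: the quadric <X, X> = 1 / kappa in R^{n+1,1}; the quotients are
   sinh (k t) and cosh (k t). *)
Definition de_sitter (R : realType) (n : nat) (kappa : R) : space_form R n :=
  let k := Num.sqrt kappa in
  @SpaceForm R n (1 + (1 + n))
    (block_mx (-1)%:M 0 0 1%:M)
    (fun p =>
       event (flin kappa (radius p) / k *
              ((expR (k * tcoord p) - expR (- (k * tcoord p))) / 2))
         (event (flin kappa (radius p) / k *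
                 ((expR (k * tcoord p) + expR (- (k * tcoord p))) / 2))
                (ycoord p)))
    [set 0].

Definition model (R : realType) (n : nat) (kappa : R) : space_form R n :=
  if kappa == 0 then @minkowski R n
  else if kappa < 0 then anti_de_sitter n kappa else de_sitter n kappa.

(* The group generated by the linear isometries and the allowed translations.
   Time translations of the (anti-)de Sitter patch are linear isometries. *)
Inductive lorentz (R : realType) (d : nat) (B : 'M[R]_d) (T : set 'rV[R]_d) :
    ('rV[R]_d -> 'rV[R]_d) -> Prop :=
| lorentz_linear (L : 'M[R]_d) : L *m B *m L^T = B ->
    lorentz B T (fun X => X *m L)
| lorentz_translation (a : 'rV[R]_d) : T a -> lorentz B T (fun X => X + a)
| lorentz_comp (phi psi : 'rV[R]_d -> 'rV[R]_d) :
    lorentz B T phi -> lorentz B T psi -> lorentz B T (phi \o psi).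

Definition lorentz_transformation (R : realType) (n : nat)
    (M : space_form R n) : ('rV[R]_(sf_dim M) -> 'rV[R]_(sf_dim M)) -> Prop :=
  lorentz (@sf_form R n M) (@sf_trans R n M).

(* The part r in J of the spacetime is a Lorentz space form containing S. The
   spacetime itself is a Lorentz space form when J = I is possible; J is not
   fixed to I because f may satisfy f^2 = 1 - kappa r^2 on a subinterval only,
   and the Lorentz transformations act on the corresponding region. *)
Definition in_space_form_region (R : realType) (n : nat) (f : R -> R)
    (I : set R) (S : set 'rV[R]_(1 + n)) (kappa : R) : Prop :=
  exists J : set R,
    [/\ nondegenerate_interval J, J `<=` I,
        forall r, J r -> f r ^+ 2 = 1 - kappa * r ^+ 2 &
        S `<=` spacetime J].

Definition patch_radius (R : realType) (kappa r0 : R) : Prop :=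
  0 < r0 /\ 0 < 1 - kappa * r0 ^+ 2.

Definition sphere_of_symmetry (R : realType) (n : nat) (f : R -> R)
    (I : set R) (S : set 'rV[R]_(1 + n)) : Prop :=
  (exists t0 r0 : R, [/\ I r0, 0 < r0 & S = slice t0 r0]) \/
  (exists kappa t0 r0 : R,
     let M := model n kappa in
     exists phi : 'rV[R]_(sf_dim M) -> 'rV[R]_(sf_dim M),
     [/\ in_space_form_region f I S kappa, patch_radius kappa r0,
         @lorentz_transformation R n M phi &
         @sf_emb R n M @` S = phi @` (@sf_emb R n M @` slice t0 r0)]).

(** Graphs in standard null cones; [outgoing] selects w = t - r* = const or
    v = t + r* = const. *)

Definition cone_sign (R : realType) (outgoing : bool) : R :=
  if outgoing then 1 else -1.

Definition graph_in_static_cone (R : realType) (n : nat) (f : R -> R)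
    (I : set R) (F : 'rV[R]_n -> 'rV[R]_(1 + n)) : Prop :=
  exists (outgoing : bool) (rstar : R -> R) (w0 : R) (v : 'rV[R]_n -> R)
         (rho : 'rV[R]_n -> R),
    let s := cone_sign R outgoing in
    [/\ forall r : R, I r -> is_derive r (1 : R) rstar (f r ^- 2),
        smooth_sphere v &
        forall x : 'rV[R]_n, sphere x ->
          [/\ 0 < rho x, I (rho x), ycoord (F x) = rho x *: x,
              tcoord (F x) - s * rstar (rho x) = w0 &
              tcoord (F x) + s * rstar (rho x) = v x]].

(* The null normals of the sphere t = t0, r = r0 of the model at r0 x are
   L = f^-2 d_t + d_r (outgoing) and f^-2 d_t - d_r (incoming). The null
   geodesics of the model are straight lines of the ambient space, so the null
   hypersurface emanating from the sphere consists of the points P + lambda L;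
   r = r0 +- lambda stays positive before the vertex. The function [lambda]
   defines a graph over the sphere, which [phi] moves into the spacetime. *)
Definition graph_in_moved_cone (R : realType) (n : nat) (f : R -> R)
    (I : set R) (F : 'rV[R]_n -> 'rV[R]_(1 + n)) : Prop :=
  exists kappa t0 r0 : R,
  let M := model n kappa in
  exists (phi : 'rV[R]_(sf_dim M) -> 'rV[R]_(sf_dim M)) (outgoing : bool)
         (lambda : 'rV[R]_n -> R),
    let s := cone_sign R outgoing in
    let P (x : 'rV[R]_n) := @sf_emb R n M (event t0 (r0 *: x)) in
    let L (x : 'rV[R]_n) :=
      'D_(event (flin kappa r0 ^- 2) (s *: x)) (@sf_emb R n M)
        (event t0 (r0 *: x)) in
    [/\ in_space_form_region f I (F @` @sphere R n) kappa,
        patch_radius kappa r0,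
        @lorentz_transformation R n M phi,
        smooth_sphere lambda &
        forall x : 'rV[R]_n, sphere x ->
          0 < r0 + s * lambda x /\
          @sf_emb R n M (F x) = phi (P x + lambda x *: L x)].

Definition in_standard_null_cone (R : realType) (n : nat) (f : R -> R)
    (I : set R) (F : 'rV[R]_n -> 'rV[R]_(1 + n)) : Prop :=
  graph_in_static_cone f I F \/ graph_in_moved_cone f I F.

(* Main.v *)
Require Import Defs.
From mathcomp Require Import all_boot all_order all_algebra.
From mathcomp Require Import all_classical all_reals all_analysis.
From mathcomp Require Import ring lra.
Set Implicit Arguments.
Unset Strict Implicit.
Unset Printing Implicit Defensive.

Import Order.TTheory GRing.Theory Num.Theory.
Import numFieldNormedType.Exports.
Local Open Scope classical_set_scope.
Local Open Scope ring_scope.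

(** Write the radius of Sigma over the point x of the sphere as 1 / W x and
    extend W to be homogeneous of degree 1. On a null cone the squared norm of
    the mean curvature involves only W: with m = n - 1 it gives
      (2 / m) W lap W - |DW|^2 = Q W   on the sphere,
    where Q w = c - (f(1/w)^2 - 1) w^2 on a cone of the static spacetime and Q
    is constant on a moved cone; the hypothesis on f says Q' >= 0. Let
    Psi' = Q w / (2 w^2). Then k = |x| |DW|^2 / (2 W) - Psi (W / |x|) satisfies
      W lap k - (m - 2) Dk.DW = |A|^2 + (m - 1) / (2 W) Q' (|DW|^2 - W^2) >= 0,
    A being the trace-free part of the tangential Hessian, so k is constant by
    the strong maximum principle. Hence A = 0, that is W = a |x| + b.x, and
    Q' = 0 on the range of W unless b = 0. If b = 0 then Sigma is a slice.
    Otherwise f^2 = 1 - kappa r^2 on the range of the radius, and in the ambient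
    flat space Sigma is the section of a null cone by the hyperplane
    1 / r = a + b.x; a product of reflections (Witt) carries it to a sphere
    t = const, r = const. *)

(** * Directional derivatives and functions of class C^k *)

(** On the sphere the left side of the equation for [W] is the scalar curvature of the induced
    metric W^-2 g_S divided by m (m - 1), so for constant Q the rigidity statement is Obata's
    theorem. Obata integrates over the sphere; here k turns the argument into a pointwise one. The
    primitive Psi is what makes the equation collapse the gradient of k to |x| A(DW) / W, and m - 2
    is the coefficient for which D^2 W(DW, DW) drops out of the second order identity. The extension
    of degree 1 is chosen because its flat Hessian annihilates x and is the Hessian of W plus W g_S
    along the sphere: covariant calculus becomes a calculus of commuting partial derivatives, and
    the curvature of the sphere is hidden in Euler's relations. Rigidity gives information on f only
    over the range J of the radius, so the isometry to a round sphere is found for the space form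
    that agrees with the spacetime over J. It remains to see that the cones of the spacetime over J
    are cones of this space form, and that the resulting radius belongs to the static patch. *)

Section DirectionalDerivatives.
Context {R : realType} {V : normedModType R}.
Implicit Types (f g : V -> R) (U : set V).

(** Reduces directional derivatives to one real variable, where the chain rule and the mean value
    theorem are available. *)
Lemma is_derive_line {W : normedModType R} (f : V -> W) (x v : V) (t : R) d :
  is_derive (t *: v + x) v f d <-> is_derive t (1 : R) (fun h => f (h *: v + x)) d.
Proof.
pose q1 := fun h : R => h^-1 *: ((f \o shift (t *: v + x)) (h *: v) - f (t *: v + x)).
pose q2 := fun h : R => h^-1 *: (((fun h => f (h *: v + x)) \o shift t) (h *: (1 : R)) -
      f (t *: v + x)).
have E : q1 = q2.
  apply/funext => h; rewrite /q1 /q2 /=.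
  by rewrite [h *: 1]mulr1 scalerDl addrA.
split=> -[h1 h2]; split.
- by change (cvg (q2 @ 0^')); rewrite -E.
- by change (lim (q2 @ 0^') = d); rewrite -E.
- by change (cvg (q1 @ 0^')); rewrite E.
- by change (lim (q1 @ 0^') = d); rewrite E.
Qed.

Lemma is_derive_line0 {W : normedModType R} (f : V -> W) (x v : V) d :
  is_derive x v f d <-> is_derive (0 : R) (1 : R) (fun h => f (h *: v + x)) d.
Proof. by rewrite -is_derive_line scale0r add0r. Qed.

Lemma is_derive_comp1 f (g : R -> R) (x v : V) df dg :
  is_derive x v f df -> is_derive (f x) (1:R) g dg ->
  is_derive x v (g \o f) (dg * df).
Proof.
rewrite !is_derive_line0 => hf hg.
apply: (@is_derive1_comp _ g (fun h => f (h *: v + x)) 0).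
by rewrite scale0r add0r.
Qed.

Lemma is_deriveZr f (x v : V) (a : R) df :
  is_derive x v f df -> is_derive x (a *: v) f (a * df).
Proof.
rewrite !is_derive_line0 => hf; rewrite mulrC.
have -> : (fun h => f (h *: (a *: v) + x)) =
  (fun h => f (h *: v + x)) \o (fun h => h * a).
  by apply/funext => h /=; rewrite scalerA.
apply: is_derive1_comp; first by rewrite mul0r.
have -> : (fun h : R => h * a) = a *: id by apply/funext => h /=; rewrite mulrC.
by apply: is_derive_eq; rewrite [_ *: _]mulr1.
Qed.

Lemma mvt_dir f (x v : V) :
  (forall t : R, 0 <= t <= 1 -> derivable f (t *: v + x) v) ->
  exists2 t : R, 0 <= t <= 1 & f (v + x) - f x = 'D_v f (t *: v + x).
Proof.
move=> df.
have dl (t : R) : 0 <= t <= 1 ->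
    is_derive t (1 : R) (fun h => f (h *: v + x)) ('D_v f (t *: v + x)).
  by move=> /df /derivableP /is_derive_line.
have [|||c] := @MVT R (fun h => f (h *: v + x)) (fun t => 'D_v f (t *: v + x)) 0 1.
- exact: ltr01.
- by move=> t; rewrite in_itv /= => /andP[t0 t1]; apply: dl; rewrite !ltW.
- apply: derivable_within_continuous => t; rewrite in_itv /= => /dl[dt _]; exact: dt.

rewrite in_itv /= => /andP[c0 c1]; rewrite scale1r scale0r add0r subr0 mulr1 => E.
by exists c => //; rewrite !ltW.
Qed.

(** The increment along [u + v] is split at [h *: u + x]. The mean value theorem turns the second
    piece into ['D_v f] at a point tending to [x], where continuity of ['D_v f] applies. This gives
    linearity in the direction without a total derivative. *)
Lemma is_deriveDr f (x u v : V) du :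
  is_derive x u f du -> (\forall y \near x, derivable f y v) ->
  {for x, continuous ('D_v f)} ->
  is_derive x (u + v) f (du + 'D_v f x).
Proof.
move=> hu hv cv.
suff H : h^-1 *: (f (h *: (u + v) + x) - f x) @[h --> 0^'] --> du + 'D_v f x.
  split; first by apply/cvg_ex; exists (du + 'D_v f x).
  exact: cvg_lim H.
have -> : (fun h : R => h^-1 *: (f (h *: (u + v) + x) - f x)) =
  (fun h : R => h^-1 *: (f (h *: u + x) - f x) +
     h^-1 *: (f (h *: v + (h *: u + x)) - f (h *: u + x))).
  apply/funext => h; rewrite -scalerDr; congr (_ *: _).
  have -> : h *: v + (h *: u + x) = h *: (u + v) + x.
    by rewrite scalerDr addrA [h *: v + _]addrC.
  by ring.
apply: cvgD.
  by case: hu => dfu <-; exact: dfu.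
apply/cvgrPdist_lt => e e0.
have /nbhs_ballP[d /= d0 hd] : \forall y \near x, derivable f y v /\
    `|'D_v f x - 'D_v f y| < e.
  apply: filterI => //; move/cvgrPdist_lt: cv => /(_ _ e0) H; exact: H.
have M0 : 0 < `|u| + `|v| + 1 by rewrite ltr_wpDl // addr_ge0.
near=> h.
have h0 : h != 0 by near: h; exact: nbhs_dnbhs_neq.
have hb t : 0 <= t <= 1 -> ball x d (t *: (h *: v) + (h *: u + x)).
  move=> /andP[t0 t1]; rewrite -ball_normE /= addrA opprD addrCA subrr addr0 normrN.
  apply: le_lt_trans (ler_normD _ _) _; rewrite !normrZ (ger0_norm t0).
  have : `|h| * (`|u| + `|v| + 1) < d.
    rewrite -ltr_pdivlMr //; near: h.
    have dM : 0 < d / (`|u| + `|v| + 1) by rewrite divr_gt0.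
    apply: dnbhs0_lt => //.
  have : t * (`|h| * `|v|) <= `|h| * `|v| by rewrite ler_piMl // mulr_ge0.
  have := normr_ge0 h; lra.
have [|t t01 ->] := @mvt_dir f (h *: u + x) (h *: v).
  move=> t t01; have [/derivableP D _] := hd _ (hb _ t01).
  by case: (is_deriveZr h D).
have [/derivableP D Hlt] := hd _ (hb _ t01).
by rewrite (@derive_val _ _ _ _ _ _ _ (is_deriveZr h D)) [_ *: _]mulKf.
Unshelve. all: by end_near. Qed.

End DirectionalDerivatives.

Lemma is_derive_open {R : realType} {V W : normedModType R} (U : set V)
    (f g : V -> W) x v d :
  open U -> U x -> (forall y, U y -> f y = g y) ->
  is_derive x v f d -> is_derive x v g d.
Proof.
move=> oU Ux fg; apply: near_eq_is_derive.
by apply: filterS (open_nbhs_nbhs (conj oU Ux)) => y /fg.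
Qed.

Lemma derive_open {R : realType} {V W : normedModType R} (U : set V)
    (f g : V -> W) x v :
  open U -> U x -> (forall y, U y -> f y = g y) -> 'D_v f x = 'D_v g x.
Proof.
move=> oU Ux fg; apply: near_eq_derive.
by apply: filterS (open_nbhs_nbhs (conj oU Ux)) => y /fg.
Qed.

Section ContinuouslyDifferentiable.
Context {R : realType} {V : normedModType R} (U : set V) (oU : open U).
Implicit Types (f g : V -> R).

(** Phrased with directional derivatives, like [smooth_on], which therefore yields it at every
    order; linearity in the direction follows from [is_deriveDr] as soon as the order is
    positive. *)
Fixpoint Ck (k : nat) (f : V -> R) : Prop :=
  (forall x, U x -> {for x, continuous f}) /\
  if k is k'.+1 then
    (forall x v, U x -> derivable f x v) /\ (forall v, Ck k' ('D_v f))
  else True.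

Lemma Ck_continuous k f x : Ck k f -> U x -> {for x, continuous f}.
Proof. by case: k => [|k] [h _]; exact: h. Qed.

Lemma Ck_is_derive k f x v : Ck k.+1 f -> U x -> is_derive x v f ('D_v f x).
Proof. by move=> [_ [h _]] Ux; apply/derivableP/h. Qed.

Lemma Ck_derive k f v : Ck k.+1 f -> Ck k ('D_v f).
Proof. by move=> [_ [_ h]]; exact: h. Qed.

Lemma CkW k f : Ck k.+1 f -> Ck k f.
Proof.
elim: k f => [|k IH] f [h1 [h2 h3]]; first by split.
by split=> //; split=> // v; exact: IH.
Qed.

Lemma Ck_le k l f : (k <= l)%N -> Ck l f -> Ck k f.
Proof.
move=> /subnK <-; elim: (l - k)%N => // i IH; rewrite addSn => /CkW; exact: IH.
Qed.

Lemma Ck_eq k f g : (forall x, U x -> f x = g x) -> Ck k f -> Ck k g.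
Proof.
have near_eq (f1 g1 : V -> R) : (forall x, U x -> f1 x = g1 x) ->
    forall x, U x -> \near x, f1 x = g1 x.
  by move=> fg x Ux; apply: filterS (open_nbhs_nbhs (conj oU Ux)) => y /fg.
have cont (f1 g1 : V -> R) : (forall x, U x -> f1 x = g1 x) ->
    (forall x, U x -> {for x, continuous f1}) ->
    forall x, U x -> {for x, continuous g1}.
  move=> fg h x Ux; rewrite /prop_for /continuous_at -fg //.
  by apply: cvg_trans (h x Ux); apply: near_eq_cvg; exact: near_eq.
elim: k f g => [|k IH] f g fg [h1]; first by move=> _; split=> //; exact: cont h1.
move=> [h2 h3]; split; first exact: cont h1.
split=> [x v Ux|v].
  by apply: near_eq_derivable (h2 _ v Ux); exact: near_eq.
by apply: IH (h3 v) => x Ux; exact: derive_open Ux fg.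
Qed.

(* The derivative formula turns closure under an operation at order k+1 into
   closure at order k. *)
Lemma Ck_step k f (df : V -> V -> R) :
  (forall x, U x -> {for x, continuous f}) ->
  (forall x v, U x -> is_derive x v f (df v x)) ->
  (forall v, Ck k (df v)) -> Ck k.+1 f.
Proof.
move=> h1 h2 h3; split=> //; split=> [x v Ux|v]; first by case: (h2 x v Ux).
by apply: Ck_eq (h3 v) => x Ux; rewrite (@derive_val _ _ _ _ _ _ _ (h2 x v Ux)).
Qed.

Lemma Ck_cst k (c : R) : Ck k (fun=> c).
Proof.
elim: k c => [|k IH] c; first by split=> // x _; exact: cst_continuous.
by apply: (@Ck_step _ _ (fun _ => fun=> 0)) => // x _; exact: cst_continuous.
Qed.

Lemma CkD k f g : Ck k f -> Ck k g -> Ck k (fun x => f x + g x).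
Proof.
elim: k f g => [|k IH] f g hf hg.
  split=> // x Ux; apply: continuousD; [exact: Ck_continuous hf Ux|].
  exact: Ck_continuous hg Ux.
apply: (@Ck_step _ _ (fun v x => 'D_v f x + 'D_v g x)) => [x Ux|x v Ux|v].
- by apply: continuousD; [exact: Ck_continuous hf Ux|exact: Ck_continuous hg Ux].
- by apply: is_deriveD; [exact: Ck_is_derive hf Ux|exact: Ck_is_derive hg Ux].
- by apply: IH; apply: Ck_derive.
Qed.

Lemma is_derive_mul f g x v (df dg : R) :
  is_derive x v f df -> is_derive x v g dg ->
  is_derive x v (fun y => f y * g y) (f x * dg + g x * df).
Proof. exact: is_deriveM. Qed.

Lemma CkM k f g : Ck k f -> Ck k g -> Ck k (fun x => f x * g x).
Proof.
elim: k f g => [|k IH] f g hf hg.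
  split=> // x Ux; apply: continuousM; [exact: Ck_continuous hf Ux|].
  exact: Ck_continuous hg Ux.
apply: (@Ck_step _ _ (fun v x => f x * 'D_v g x + g x * 'D_v f x)) => [x Ux|x v Ux|v].
- by apply: continuousM; [exact: Ck_continuous hf Ux|exact: Ck_continuous hg Ux].
- by apply: is_derive_mul; [exact: Ck_is_derive hf Ux|exact: Ck_is_derive hg Ux].
- by apply: CkD; apply: IH; do ?[exact: CkW]; exact: Ck_derive.
Qed.

Lemma CkZ k (c : R) f : Ck k f -> Ck k (fun x => c * f x).
Proof. by apply: CkM; exact: Ck_cst. Qed.

Lemma CkN k f : Ck k f -> Ck k (fun x => - f x).
Proof. by move=> /(CkZ (-1)); apply: Ck_eq => x _; rewrite mulN1r. Qed.

Lemma CkB k f g : Ck k f -> Ck k g -> Ck k (fun x => f x - g x).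
Proof. by move=> hf /CkN; exact: CkD. Qed.

Lemma CkX k i f : Ck k f -> Ck k (fun x => f x ^+ i).
Proof.
move=> hf; elim: i => [|i IH]; first by apply: Ck_eq (Ck_cst k 1) => x _; rewrite expr0.
by apply: Ck_eq (CkM hf IH) => x _; rewrite exprS.
Qed.

Lemma Ck_sum k (J : Type) (r : seq J) (P : pred J) (h : J -> V -> R) :
  (forall j, P j -> Ck k (h j)) -> Ck k (fun x => \sum_(j <- r | P j) h j x).
Proof.
move=> H; elim: r => [|j r IH].
  by apply: Ck_eq (Ck_cst k 0) => x _; rewrite big_nil.
case Pj : (P j); last by apply: Ck_eq IH => x _; rewrite big_cons Pj.
by apply: Ck_eq (CkD (H _ Pj) IH) => x _; rewrite big_cons Pj.
Qed.

Lemma is_derive_inv f x v (df : R) : f x != 0 -> is_derive x v f df ->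
  is_derive x v (fun y => (f y)^-1) (- ((f x)^-1 * (f x)^-1 * df)).
Proof.
move=> f0 [d1 <-]; split; first exact: derivableV.
by rewrite deriveV // scaleNr -invfM expr2.
Qed.

Lemma CkV k f : (forall x, U x -> f x != 0) -> Ck k f -> Ck k (fun x => (f x)^-1).
Proof.
move=> f0; elim: k => [|k IH] hf.
  by split=> // x Ux; apply: cvgV; [exact: f0|exact: Ck_continuous hf Ux].
apply: (@Ck_step _ _ (fun v x => - ((f x)^-1 * (f x)^-1 * 'D_v f x))) => [x Ux|x v Ux|v].
- by apply: cvgV; [exact: f0|exact: Ck_continuous hf Ux].
- by apply: is_derive_inv; [exact: f0|exact: Ck_is_derive hf Ux].
- by apply: CkN; apply: CkM; last exact: Ck_derive; apply: CkM; apply: IH; exact: CkW.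
Qed.

Lemma Ck_sqrt k f : (forall x, U x -> 0 < f x) -> Ck k f ->
  Ck k (fun x => Num.sqrt (f x)).
Proof.
move=> f0; elim: k => [|k IH] hf.
  split=> // x Ux; apply: continuous_comp; first exact: Ck_continuous hf Ux.
  exact: sqrt_continuous.
apply: (@Ck_step _ _ (fun v x => (2 * Num.sqrt (f x))^-1 * 'D_v f x)) => [x Ux|x v Ux|v].
- apply: continuous_comp; first exact: Ck_continuous hf Ux.
  exact: sqrt_continuous.
- apply: (is_derive_comp1 (Ck_is_derive v hf Ux)).
  by apply: is_derive1_sqrt; exact: f0.
- apply: CkM; last exact: Ck_derive; apply: CkV; last by apply: CkZ; apply: IH; exact: CkW.
  by move=> x Ux; rewrite mulf_neq0 // sqrtr_eq0 -ltNge f0.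
Qed.

Lemma deriveDr k f x u v : Ck k.+1 f -> U x -> 'D_(u + v) f x = 'D_u f x + 'D_v f x.
Proof.
move=> hf Ux; apply: (@derive_val _ _ _ _ _ _ _); apply: is_deriveDr.
- exact: Ck_is_derive hf Ux.
- apply: filterS (open_nbhs_nbhs (conj oU Ux)) => y Uy.
  by case: (Ck_is_derive v hf Uy).
- exact: Ck_continuous (Ck_derive v hf) Ux.
Qed.

Lemma deriveZr k f x (a : R) v : Ck k.+1 f -> U x -> 'D_(a *: v) f x = a * 'D_v f x.
Proof.
move=> hf Ux; apply: (@derive_val _ _ _ _ _ _ _); apply: is_deriveZr.
exact: Ck_is_derive hf Ux.
Qed.

Lemma derive_sumr k (J : Type) (r : seq J) (P : pred J) (vs : J -> V) f x :
  Ck k.+1 f -> U x ->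
  'D_(\sum_(j <- r | P j) vs j) f x = \sum_(j <- r | P j) 'D_(vs j) f x.
Proof.
move=> hf Ux; elim: r => [|j r IH]; first by rewrite !big_nil derive0.
by rewrite !big_cons; case: (P j) => //; rewrite (deriveDr _ _ hf Ux) IH.
Qed.

(** Two mean value theorems: along [a] for the difference of [f] under the shift by [b], then along
    [b] for ['D_a f]. The left side is symmetric in [a] and [b], which [schwarz] exploits. *)
Lemma double_difference f x a b : Ck 2 f ->
  (forall t s : R, 0 <= t <= 1 -> 0 <= s <= 1 -> U (s *: b + (t *: a + x))) ->
  exists t s : R, [/\ 0 <= t <= 1, 0 <= s <= 1 &
    f (b + (a + x)) - f (a + x) - (f (b + x) - f x) =
    'D_b ('D_a f) (s *: b + (t *: a + x))].
Proof.
move=> hf HU.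
have I0 : 0 <= (0 : R) <= 1 by rewrite lexx ler01.
have I1 : 0 <= (1 : R) <= 1 by rewrite lexx ler01.
have dg (t : R) : 0 <= t <= 1 -> is_derive (t *: a + x) a (fun y => f (b + y) - f y)
   ('D_a f (b + (t *: a + x)) - 'D_a f (t *: a + x)).
  move=> t01; apply: is_deriveB; last first.
    apply: Ck_is_derive hf _.
    by have := HU t 0 t01 I0; rewrite scale0r add0r.
  have : is_derive (b + (t *: a + x)) a f ('D_a f (b + (t *: a + x))).
    apply: Ck_is_derive hf _.
    by have := HU t 1 t01 I1; rewrite scale1r.
  move/is_derive_line0 => H; apply/is_derive_line0; move: H.
  suff -> : (fun h => f (h *: a + (b + (t *: a + x)))) =
    (fun h => f (b + (h *: a + (t *: a + x)))) by [].
  by apply/funext => h; rewrite addrCA.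
have [|t t01] := @mvt_dir _ _ (fun y => f (b + y) - f y) x a.
  by move=> t /dg[].
rewrite (@derive_val _ _ _ _ _ _ _ (dg t t01)) => E.
have [|s s01 E2] := @mvt_dir _ _ ('D_a f) (t *: a + x) b.
  by move=> s s01; case: (Ck_is_derive b (Ck_derive a hf) (HU t s t01 s01)).
exists t, s; split=> //; rewrite -E2 -E; ring.
Qed.

Lemma schwarz k f x u v : Ck k.+2 f -> U x -> 'D_u ('D_v f) x = 'D_v ('D_u f) x.
Proof.
move=> /(Ck_le (isT : (2 <= k.+2)%N)) hf Ux.
apply/eqP; rewrite -subr_eq0 -normr_le0; apply/ler_addgt0Pl => e e0; rewrite addr0.
have e20 : 0 < e / 2 by rewrite divr_gt0.
have c1 := Ck_continuous (Ck_derive u (Ck_derive v hf)) Ux.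
have c2 := Ck_continuous (Ck_derive v (Ck_derive u hf)) Ux.
move/cvgrPdist_lt: c1 => /(_ _ e20) /nbhs_ballP[d1 /= d10 hd1].
move/cvgrPdist_lt: c2 => /(_ _ e20) /nbhs_ballP[d2 /= d20 hd2].
have /nbhs_ballP[d3 /= d30 hd3] := open_nbhs_nbhs (conj oU Ux).
pose d := Num.min d1 (Num.min d2 d3).
have d0 : 0 < d by rewrite !lt_min d10 d20.
have hd y : ball x d y -> [/\ U y,
    `|'D_u ('D_v f) x - 'D_u ('D_v f) y| < e / 2 &
    `|'D_v ('D_u f) x - 'D_v ('D_u f) y| < e / 2].
  move=> By; split.
  - by apply: hd3; apply: le_ball By; rewrite /d !ge_min lexx !orbT.
  - by apply: hd1; apply: le_ball By; rewrite /d !ge_min lexx.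
  - by apply: hd2; apply: le_ball By; rewrite /d !ge_min lexx !orbT.
have M0 : 0 < `|u| + `|v| + 1 by rewrite ltr_wpDl // addr_ge0.
have [h h0 hM] : exists2 h : R, 0 < h & h * (`|u| + `|v| + 1) < d.
  exists (d / 2 / (`|u| + `|v| + 1)); first by rewrite !divr_gt0.
  by rewrite divfK ?gt_eqF // ltr_pdivrMr // ltr_pMr // ltr1n.
(* Both bounds hold for the pairs [(v, u)] and [(u, v)], so one estimate serves the two orders of
   differentiation. *)
have key a b : (`|a| <= `|u| + `|v|) -> (`|b| <= `|u| + `|v| - `|a|) ->
   exists2 y, ball x d y & f (h *: b + (h *: a + x)) - f (h *: a + x)
     - (f (h *: b + x) - f x) = h ^+ 2 * 'D_b ('D_a f) y.
  move=> ha hb.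
  have HB (t s : R) : 0 <= t <= 1 -> 0 <= s <= 1 ->
      ball x d (s *: (h *: b) + (t *: (h *: a) + x)).
    move=> /andP[t0 t1] /andP[s0 s1].
    rewrite -ball_normE /= addrA opprD addrCA subrr addr0 normrN.
    apply: le_lt_trans (ler_normD _ _) _.
    rewrite !normrZ (ger0_norm t0) (ger0_norm s0) (gtr0_norm h0).
    have : t * (h * `|a|) <= h * `|a| by rewrite ler_piMl // mulr_ge0 // ltW.
    have : s * (h * `|b|) <= h * `|b| by rewrite ler_piMl // mulr_ge0 // ltW.
    have : h * (`|b| + `|a|) <= h * (`|u| + `|v|) by rewrite ler_pM2l //; lra.
    lra.
  have [t s t01 s01|t [s [t01 s01 ->]]] := @double_difference f x (h *: a) (h *: b) hf.
    by have [] := hd _ (HB t s t01 s01).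
  exists (s *: (h *: b) + (t *: (h *: a) + x)); first exact: HB.
  have [Uy _ _] := hd _ (HB t s t01 s01).
  rewrite (deriveZr h b (Ck_derive (h *: a) hf) Uy).
  rewrite (@derive_open _ _ _ _ ('D_(h *: a) f) (fun z => h * 'D_a f z) _ b oU Uy); last first.
    by move=> z Uz; exact: deriveZr hf Uz.
  rewrite (@derive_val _ _ _ _ _ _ _ (is_deriveM (is_derive_cst h _ b) (Ck_is_derive b (Ck_derive a hf) Uy))).
  by rewrite scaler0 addr0 mulrA -expr2.
have [|| y1 /hd[_ b1 _] E1] := key v u; [by rewrite lerDr|lra|].
have [|| y2 /hd[_ _ b2] E2] := key u v; [by rewrite lerDl|lra|].
(* The two mixed derivatives, at nearby points, are the same second difference divided by
   [h ^+ 2]. *)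
have E : 'D_u ('D_v f) y1 = 'D_v ('D_u f) y2.
  apply: (@mulfI _ (h ^+ 2)); first by rewrite expf_neq0 // gt_eqF.
  apply: etrans (esym E1) (etrans _ E2); rewrite [h *: u + (h *: v + x)]addrCA.
  move: (f (h *: v + (h *: u + x))) (f (h *: u + x)) (f (h *: v + x)) (f x).
  by move=> p q r s; rewrite !opprB addrACA [RHS]addrACA; congr (_ + _); rewrite addrC.
rewrite E in b1; rewrite distrC in b2.
rewrite [e]splitr -(subrKA ('D_v ('D_u f) y2)).
apply: (le_trans (ler_normD _ _)).
apply: ltW.
apply: ltrD.
  exact: b1.
exact: b2.
Qed.

End ContinuouslyDifferentiable.
Arguments Ck {R V} U k f.

Section DerivativeRules.
Context {R : realType} {V : normedModType R}.
Implicit Types (f g : V -> R).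

Lemma is_derive_const (c : R) (x v : V) : is_derive x v (fun=> c) 0.
Proof. exact: is_derive_cst. Qed.

Lemma is_derive_add f g x v (df dg : R) :
  is_derive x v f df -> is_derive x v g dg ->
  is_derive x v (fun y => f y + g y) (df + dg).
Proof. exact: is_deriveD. Qed.

Lemma is_derive_opp f x v (df : R) :
  is_derive x v f df -> is_derive x v (fun y => - f y) (- df).
Proof. exact: is_deriveN. Qed.

Lemma is_derive_pow f n x v (df : R) :
  is_derive x v f df -> is_derive x v (fun y => f y ^+ n) (n%:R * f x ^+ n.-1 * df).
Proof.
move=> df1; have -> : (fun y => f y ^+ n) = f ^+ n by apply/funext => y; rewrite exprfctE.
exact: is_deriveX.
Qed.

Lemma is_derive_bigsum (J : Type) (r : seq J) (P : pred J) (h : J -> V -> R)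
    (dh : J -> R) x v :
  (forall j, P j -> is_derive x v (h j) (dh j)) ->
  is_derive x v (fun y => \sum_(j <- r | P j) h j y) (\sum_(j <- r | P j) dh j).
Proof.
move=> H; elim: r => [|j r IH].
  rewrite big_nil; have -> : (fun y => \sum_(j <- [::] | P j) h j y) = fun=> 0.
    by apply/funext => y; rewrite big_nil.
  exact: is_derive_const.
rewrite big_cons; case Pj : (P j).
  have -> : (fun y => \sum_(i <- j :: r | P i) h i y) =
     fun y => h j y + \sum_(i <- r | P i) h i y.
    by apply/funext => y; rewrite big_cons Pj.
  by apply: is_derive_add => //; exact: H.
have -> : (fun y => \sum_(i <- j :: r | P i) h i y) =
     fun y => \sum_(i <- r | P i) h i y.
  by apply/funext => y; rewrite big_cons Pj.
exact: IH.
Qed.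

(** If the second derivative were positive, ['D_v f] would be positive just after [x] on the line,
    and by the mean value theorem [f] would exceed its maximum. *)
Lemma second_derivative_at_max (U : set V) f x v : open U -> Ck U 2 f -> U x ->
  (forall y, U y -> f y <= f x) -> 'D_v f x = 0 /\ 'D_v ('D_v f) x <= 0.
Proof.
move=> oU hf Ux fmax.
have [d /= d0 hd] : \forall h \near (0 : R), U (h *: v + x).
  have : {for (0 : R), continuous (fun h : R => h *: v + x)}.
    by apply: cvgD; [apply: cvgZr_tmp; exact: cvg_id|exact: cvg_cst].
  move/(_ U); apply; rewrite scale0r add0r; exact: open_nbhs_nbhs.
have Uh (h : R) : `|h| < d -> U (h *: v + x).
  by move=> hd1; apply: hd; rewrite /= sub0r normrN.
have D1 h : `|h| < d -> is_derive h (1 : R) (fun h => f (h *: v + x)) ('D_v f (h *: v + x)).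
  by move=> /Uh Uy; apply: (is_derive_line f x v h _).1; exact: Ck_is_derive hf Uy.
have fmaxh h : `|h| < d -> f (h *: v + x) <= f x by move=> hh; apply: fmax; apply: Uh.
have Dv0 : 'D_v f x = 0.
  have e0 : `|(0 : R)| < d by rewrite normr0.
  have [_ E0] := D1 0 e0; rewrite scale0r add0r in E0; rewrite -E0.
  have d20 : 0 < d / 2 by rewrite divr_gt0.
  apply: (@derive_val _ _ _ _ _ _ _ (@derive1_at_max _ _ (- (d / 2)) (d / 2) 0 _ _ _ _)) => //.
  - by lra.
  - move=> t; rewrite in_itv /= => /andP[t1 t2].
    by case: (D1 t _) => //; rewrite ltr_norml; apply/andP; split; lra.
  - by rewrite in_itv /=; apply/andP; split; lra.
  - move=> t; rewrite in_itv /= => /andP[t1 t2].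
    rewrite scale0r add0r; apply: fmaxh; rewrite ltr_norml; apply/andP; split; lra.
split=> //; rewrite leNgt; apply/negP => L0.
have [dd E] : is_derive x v ('D_v f) ('D_v ('D_v f) x) by exact: Ck_is_derive (Ck_derive v hf) Ux.
have [e /= e0 he] : \forall h \near 0^', 0 < h^-1 * ('D_v f (h *: v + x) - 'D_v f x).
  by apply: (cvgr_gt _ dd); rewrite -/(derive _ _ _).
pose c := Num.min d e / 2.
have c0 : 0 < c by rewrite divr_gt0 // lt_min d0.
have [cd ce] : c < d /\ c < e.
  have : c < Num.min d e by rewrite /c ltr_pdivrMr // ltr_pMr ?ltr1n // lt_min d0.
  by rewrite lt_min => /andP.
have [|y hy|y] := @MVT R (fun h => f (h *: v + x)) (fun h => 'D_v f (h *: v + x)) 0 c c0.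
- move=> y; rewrite in_itv /= => /andP[y0 yc]; apply: D1.
  by rewrite gtr0_norm // (lt_trans yc).
- apply: derivable_within_continuous => t; rewrite in_itv /= => /andP[t0 tc].
  by case: (D1 t _) => //; rewrite ger0_norm // (le_lt_trans tc).
rewrite in_itv /= => /andP[y0 yc]; rewrite scale0r add0r subr0 => E1.
have : 0 < y^-1 * ('D_v f (y *: v + x) - 'D_v f x).
  apply: he => /=; first by rewrite sub0r normrN gtr0_norm // (lt_trans yc).
  by rewrite gt_eqF.
rewrite Dv0 subr0 pmulr_rgt0 ?invr_gt0 // => P.
have := fmaxh c; rewrite gtr0_norm // => /(_ cd).
by rewrite -subr_le0 E1 leNgt mulr_gt0.
Qed.

End DerivativeRules.

(** * Euclidean space *)

Section EuclideanSpace.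
Context {R : realType} {n : nat}.
Implicit Types (x y z u v : 'rV[R]_n) (f g : 'rV[R]_n -> R).

Definition dot x y : R := \sum_i x 0 i * y 0 i.

Lemma dotC x y : dot x y = dot y x.
Proof. by apply: eq_bigr => i _; rewrite mulrC. Qed.

Lemma dotDl x y z : dot (x + y) z = dot x z + dot y z.
Proof. by rewrite -big_split; apply: eq_bigr => i _; rewrite mxE mulrDl. Qed.

Lemma dotZl a x y : dot (a *: x) y = a * dot x y.
Proof. by rewrite mulr_sumr; apply: eq_bigr => i _; rewrite mxE mulrA. Qed.

Lemma dotDr x y z : dot x (y + z) = dot x y + dot x z.
Proof. by rewrite ![dot x _]dotC dotDl. Qed.

Lemma dotZr a x y : dot x (a *: y) = a * dot x y.
Proof. by rewrite ![dot x _]dotC dotZl. Qed.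

Lemma dot0l x : dot 0 x = 0.
Proof. by rewrite -(scale0r 0) dotZl mul0r. Qed.

Lemma dot0r x : dot x 0 = 0. Proof. by rewrite dotC dot0l. Qed.

Lemma dotNl x y : dot (- x) y = - dot x y.
Proof. by rewrite -scaleN1r dotZl mulN1r. Qed.

Lemma dotNr x y : dot x (- y) = - dot x y.
Proof. by rewrite dotC dotNl dotC. Qed.

Lemma dotBl x y z : dot (x - y) z = dot x z - dot y z.
Proof. by rewrite dotDl dotNl. Qed.

Lemma dotBr x y z : dot x (y - z) = dot x y - dot x z.
Proof. by rewrite dotDr dotNr. Qed.

Lemma dot_mx x y : (x *m y^T) 0 0 = dot x y.
Proof. by rewrite mxE; apply: eq_bigr => i _; rewrite mxE. Qed.

Lemma dot_delta x i : dot x (delta_mx 0 i) = x 0 i.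
Proof.
rewrite /dot (bigD1 i) //= mxE !eqxx mulr1 big1 ?addr0 // => j ji.
by rewrite mxE eqxx (negbTE ji) mulr0.
Qed.

Lemma dotxx_ge0 x : 0 <= dot x x.
Proof. by apply: sumr_ge0 => i _; rewrite -expr2 sqr_ge0. Qed.

Lemma dotxx_eq0 x : (dot x x == 0) = (x == 0).
Proof.
apply/eqP/eqP => [H|->]; last exact: dot0l.
apply/rowP => i; rewrite mxE; apply/eqP; rewrite -sqrf_eq0 expr2.
move/eqP: H; rewrite psumr_eq0; last by move=> j _; rewrite -expr2 sqr_ge0.
by move/allP => /(_ i); rewrite mem_index_enum => /(_ isT).
Qed.

Lemma dotxx_gt0 x : x != 0 -> 0 < dot x x.
Proof. by move=> x0; rewrite lt_neqAle dotxx_ge0 andbT eq_sym dotxx_eq0. Qed.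

Lemma cauchy_schwarz x y : dot x y ^+ 2 <= dot x x * dot y y.
Proof.
have [->|y0] := eqVneq y 0; first by rewrite !dot0r expr0n mulr0.
have yy := dotxx_gt0 y0.
have := dotxx_ge0 (dot y y *: x - dot x y *: y).
rewrite dotBl !dotBr !dotZl !dotZr [dot y x]dotC => H.
rewrite -subr_ge0 -(pmulr_rge0 _ yy); apply: le_trans H _.
by rewrite le_eqVlt; apply/orP; left; apply/eqP; ring.
Qed.

Lemma euclE x : eucl x = Num.sqrt (dot x x).
Proof. by congr Num.sqrt; apply: eq_bigr => i _; rewrite expr2. Qed.

Lemma eucl_sqr x : eucl x ^+ 2 = dot x x.
Proof. by rewrite euclE sqr_sqrtr // dotxx_ge0. Qed.

Lemma eucl_gt0 x : x != 0 -> 0 < eucl x.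
Proof. by move=> x0; rewrite euclE sqrtr_gt0 dotxx_gt0. Qed.

Lemma eucl_neq0 x : x != 0 -> eucl x != 0.
Proof. by move=> /eucl_gt0/gt_eqF ->. Qed.

Lemma euclZ a x : eucl (a *: x) = `|a| * eucl x.
Proof. by rewrite !euclE dotZl dotZr mulrA -expr2 sqrtrM ?sqr_ge0 // sqrtr_sqr. Qed.

Lemma sphereE x : sphere x <-> dot x x = 1.
Proof.
rewrite /sphere /= euclE; split=> [h|->]; last exact: sqrtr1.
by rewrite -eucl_sqr euclE h expr1n.
Qed.

Lemma sphere_neq0 x : sphere x -> x != 0.
Proof. by move/sphereE => h; rewrite -dotxx_eq0 h oner_eq0. Qed.

Lemma sphere_normalize x : x != 0 -> sphere ((eucl x)^-1 *: x).
Proof.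
move=> x0; rewrite /sphere /= euclZ normfV gtr0_norm ?eucl_gt0 //.
by rewrite mulVf // eucl_neq0.
Qed.

Definition punctured : set 'rV[R]_n := [set x | x != 0].
Local Notation O := punctured.

Lemma open_punctured : open O.
Proof.
have -> : O = ~` [set 0] by apply/seteqP; split => x /= /eqP.
by rewrite openC; apply: accessible_closed_set1; apply: hausdorff_accessible; exact: norm_hausdorff.
Qed.

Lemma punctured_sphere x : sphere x -> O x.
Proof. exact: sphere_neq0. Qed.

Lemma is_derive_coord i x v : is_derive x v (fun y => y 0 i) (v 0 i).
Proof.
have d : derivable (id : 'rV[R]_n -> 'rV[R]_n) x v by exact: derivable_id.
split; first by move/derivable_mxP: d => /(_ 0 i).
by have := derive_mx d; rewrite derive_id => /rowP /(_ i); rewrite !mxE.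
Qed.

Lemma is_derive_dotl y x v : is_derive x v (dot^~ y) (dot v y).
Proof.
apply: is_derive_bigsum => i _.
have := is_derive_mul (is_derive_coord i x v) (is_derive_const (y 0 i) x v).
by rewrite mulr0 add0r mulrC.
Qed.

Lemma Ck_coord (U : set 'rV[R]_n) k i : open U -> Ck U k (fun y : 'rV[R]_n => y 0 i).
Proof.
move=> oU; case: k => [|k]; first by split=> // x _; exact: coord_continuous.
apply: (@Ck_step _ _ _ oU _ _ (fun v _ => v 0 i)) => [x _|x v _|v].
- exact: coord_continuous.
- exact: is_derive_coord.
- exact: Ck_cst.
Qed.

Lemma Ck_dotl (U : set 'rV[R]_n) k y : open U -> Ck U k (dot^~ y).
Proof.
move=> oU; apply: Ck_sum => // i _; apply: CkM => //; first exact: Ck_coord.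
exact: Ck_cst.
Qed.

Lemma Ck_eucl k : Ck O k (@eucl R n).
Proof.
apply: Ck_sqrt; first exact: open_punctured.
  by move=> x x0; have := dotxx_gt0 x0; rewrite -eucl_sqr /eucl sqr_sqrtr // sumr_ge0 // => i _; exact: sqr_ge0.
apply: Ck_sum => [|i _]; first exact: open_punctured.
by apply: CkX; [exact: open_punctured|exact: Ck_coord open_punctured].
Qed.

Lemma is_derive_eucl x v : O x -> is_derive x v (@eucl R n) (dot x v / eucl x).
Proof.
move=> x0.
have d1 : is_derive x v (fun y => \sum_i y 0 i ^+ 2) (\sum_i (2 * x 0 i * v 0 i)).
  apply: is_derive_bigsum => i _; have := is_derive_pow 2 (is_derive_coord i x v).
  by rewrite expr1.
have p : 0 < \sum_i x 0 i ^+ 2.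
  by have := dotxx_gt0 x0; rewrite /dot; under eq_bigr do rewrite -expr2.
have := is_derive_comp1 d1 (is_derive1_sqrt p).
rewrite -/(eucl x) => /is_derive_eq; apply.
have -> : \sum_i (2 * x 0 i * v 0 i) = 2 * dot x v.
  by rewrite mulr_sumr; apply: eq_bigr => i _; rewrite mulrA.
by have := eucl_neq0 x0 => ?; field.
Qed.

Lemma derive_coordE k (U : set 'rV[R]_n) f x v : open U -> Ck U k.+1 f -> U x ->
  'D_v f x = \sum_i v 0 i * 'D_(delta_mx 0 i) f x.
Proof.
move=> oU hf Ux; rewrite [v in LHS]row_sum_delta (derive_sumr oU _ _ _ hf Ux) //.
by apply: eq_bigr => i _; rewrite (deriveZr _ _ hf Ux).
Qed.

(* Homogeneity, with the factor of one fixed dilation left arbitrary. *)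
Lemma derive_dilation f x v (a c : R) : a != 0 -> O x ->
  (forall y, O y -> f (a *: y) = c * f y) -> derivable f x v ->
  'D_v f (a *: x) = c / a * 'D_v f x.
Proof.
move=> a0 Ox fa /derivableP dfx.
have oO := open_punctured.
have Oa y : O y -> O (a *: y) by move=> y0; rewrite /punctured /= scaler_eq0 negb_or a0.
rewrite (@derive_open _ _ _ O f (fun y => c * f (a^-1 *: y)) _ v oO (Oa _ Ox)); last first.
  move=> y y0; rewrite -fa ?scalerA ?mulfV // ?scale1r //.
  by rewrite /punctured /= scaler_eq0 negb_or invr_eq0 a0.
apply: derive_val.
suff H : is_derive (a *: x) v (fun y => f (a^-1 *: y)) (a^-1 * 'D_v f x).
  have := is_derive_mul (is_derive_const c (a *: x) v) H.
  by rewrite mulr0 addr0 mulrA.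
apply: (is_derive_line0 _ _ _ _).2.
have -> : (fun h => f (a^-1 *: (h *: v + a *: x))) = (fun h => f (h *: (a^-1 *: v) + x)).
  by apply/funext => h; rewrite scalerDr !scalerA mulVf // scale1r [h * _]mulrC.
by apply: (is_derive_line0 _ _ _ _).1; exact: is_deriveZr.
Qed.

Lemma sphere_compact : compact (@sphere R n).
Proof.
apply: bounded_closed_compact.
  exists 1; split=> // M M1 x /sphereE hx; apply: le_trans (ltW M1).
  rewrite /Num.Def.normr /= mx_normrE; apply: bigmax_le => // -[i j] _ /=.
  rewrite ord1 -(@expr_le1 _ 2) // real_normK ?num_real // -hx /dot (bigD1 j) //=.
  by rewrite -expr2 lerDl sumr_ge0 // => k _; rewrite -expr2 sqr_ge0.
have -> : @sphere R n = (fun x => dot x x) @^-1` [set 1].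
  by apply/seteqP; split => x /sphereE.
apply: closed_comp; last first.
  by apply: accessible_closed_set1; apply: hausdorff_accessible; exact: norm_hausdorff.
move=> x _; apply: (@Ck_continuous _ _ setT 0) => //.
apply: Ck_sum => [|i _]; first exact: openT.
by apply: CkM; [exact: openT|exact: Ck_coord openT|exact: Ck_coord openT].
Qed.

(** A segment avoids the origin when its nonzero endpoints have nonnegative inner product. For
    [n >= 2] every point is thus joined to [e i1], passing through [e i0] or its opposite. *)
Lemma punctured_gradient0_cst f : (2 <= n)%N -> Ck O 1 f ->
  (forall x i, O x -> 'D_(delta_mx 0 i) f x = 0) -> exists c, forall x, O x -> f x = c.
Proof.
move=> n2 hf df0.
have seg x y : O x -> O y -> 0 <= dot x y -> f x = f y.
  move=> x0 y0 xy.
  have Ox (t : R) : 0 <= t <= 1 -> O (t *: (y - x) + x).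
    move=> /andP[t0 t1]; apply/eqP => E.
    have := congr1 (dot x) E; rewrite dot0r dotDr dotZr dotBr => E1.
    have xx := dotxx_gt0 x0.
    have E2 : (1 - t) * dot x x + t * dot x y = 0 by rewrite -E1; ring.
    have A1 : 0 <= (1 - t) * dot x x by rewrite mulr_ge0 ?subr_ge0 // ltW.
    have A2 : 0 <= t * dot x y by rewrite mulr_ge0.
    have /eqP : (1 - t) * dot x x = 0 by lra.
    rewrite mulf_eq0 (gt_eqF xx) orbF subr_eq0 => /eqP t1'.
    by move: E y0; rewrite -t1' scale1r subrK /punctured /= => -> /eqP.
  have [t t01|t t01] := @mvt_dir _ _ f x (y - x).
    by case: (Ck_is_derive (y - x) hf (Ox t t01)).
  rewrite subrK (derive_coordE _ open_punctured hf (Ox t t01)) big1 => [|i _].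
    by move/eqP; rewrite subr_eq0 => /eqP.
  by rewrite df0 ?mulr0 //; exact: Ox.
pose i0 : 'I_n := Ordinal (leq_trans (isT : (0 < 2)%N) n2).
pose i1 : 'I_n := Ordinal (leq_trans (isT : (1 < 2)%N) n2).
pose e i : 'rV[R]_n := delta_mx 0 i.
have e0 i : O (e i).
  by rewrite /punctured /= -dotxx_eq0 dot_delta mxE !eqxx oner_eq0.
have ne0 i : O (- e i) by rewrite /punctured /= oppr_eq0; exact: e0.
have e01 : dot (e i0) (e i1) = 0 by rewrite dot_delta mxE.
exists (f (e i1)) => x x0.
have [h|h] := leP 0 (dot x (e i0)).
  by rewrite (seg x (e i0)) // (seg (e i0) (e i1)) // e01.
rewrite (seg x (- e i0)) // ?dotNr ?oppr_ge0 ?ltW //.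
by rewrite (seg (- e i0) (e i1)) // dotNl e01 oppr0.
Qed.

End EuclideanSpace.

(** * The strong maximum principle on the sphere *)

Lemma Ck_expR {R : realType} {V : normedModType R} (U : set V) k (f : V -> R) :
  open U -> Ck U k f -> Ck U k (fun x => expR (f x)).
Proof.
move=> oU; elim: k => [|k IH] hf.
  split=> // x Ux; apply: continuous_comp; first exact: Ck_continuous hf Ux.
  exact: continuous_expR.
apply: (@Ck_step _ _ _ oU _ _ (fun v x => expR (f x) * 'D_v f x)) => [x Ux|x v Ux|v].
- apply: continuous_comp; first exact: Ck_continuous hf Ux.
  exact: continuous_expR.
- exact: (is_derive_comp1 (Ck_is_derive v hf Ux) (is_derive_expR _)).
- by apply: CkM => //; [apply: IH; exact: CkW|exact: Ck_derive].
Qed.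

Section StrongMaximumPrinciple.
Context {R : realType} {n : nat}.
Implicit Types (x y p v : 'rV[R]_n).
Local Notation O := (@punctured R n).
Local Notation e i := (delta_mx 0 i : 'rV[R]_n).
Let oO := @open_punctured R n.

(** For a unit vector [p] this is the height s over the equator orthogonal to [p], extended with
    degree 0: a first spherical harmonic, with Laplacian - m s and squared gradient 1 - s^2 on the
    sphere. *)
Definition latitude p y : R := dot y p * (eucl y)^-1.

Lemma Ck_latitude p k : Ck O k (latitude p).
Proof.
apply: CkM => //; first exact: Ck_dotl.
by apply: CkV => //; [exact: eucl_neq0|exact: Ck_eucl].
Qed.

Lemma derive_latitude p y v : O y ->
  'D_v (latitude p) y = dot v p * (eucl y)^-1 - dot y p * (dot y v * (eucl y)^-1 ^+ 3).
Proof.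
move=> y0; have e0 := eucl_neq0 y0; apply: derive_val.
have := is_derive_mul (is_derive_dotl p y v) (is_derive_inv e0 (is_derive_eucl v y0)).
by move=> /is_derive_eq; apply; rewrite !exprS expr0; ring.
Qed.

Lemma derive2_latitude p y v : sphere y ->
  'D_v ('D_v (latitude p)) y =
  - dot v p * dot y v *+ 2 - dot y p * dot v v + 3 * dot y p * dot y v ^+ 2.
Proof.
move=> sy; have y0 := punctured_sphere sy; have e0 := eucl_neq0 y0.
rewrite (derive_open v oO y0 (fun z => @derive_latitude p z v)).
apply: derive_val.
have dV := is_derive_inv e0 (is_derive_eucl v y0).
have := is_derive_add (is_derive_mul (is_derive_const (dot v p) y v) dV)
  (is_derive_opp (is_derive_mul (is_derive_dotl p y v)
     (is_derive_mul (is_derive_dotl v y v) (is_derive_pow 3 dV)))).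
move=> /is_derive_eq; apply; rewrite (sy : eucl y = 1) /= !invr1 !expr1n; ring.
Qed.

(* exp(alpha s), s the height above the pole -p, is a strict subsolution on
   the sphere minus any cap around p: at -p the first order term of the
   Laplacian has the right sign. *)
Lemma barrier_pos (m s al de M bb bq : R) : 1 <= m -> 0 < de -> 0 <= bb <= M ->
  -1 <= s <= 1 - de -> M + 1 <= al -> 4 * (m + 1) <= al * de ->
  0 <= al ^+ 2 * (1 - s ^+ 2) + 2 * al * bq + bb ->
  0 < al * (1 - s ^+ 2) - m * s + bq.
Proof.
move=> m1 de0 /andP[b0 bM] /andP[s1 s2] alM alde H.
have al0 : 0 < al by lra.
rewrite -(pmulr_rgt0 _ (mulr_gt0 (ltr0n _ 2) al0)).
have s20 : 0 <= 1 - s ^+ 2.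
  have -> : 1 - s ^+ 2 = (1 - s) * (1 + s) by ring.
  by apply: mulr_ge0; lra.
(* The last hypothesis, a square, bounds the drift [2 * al * bq] from below; half of the main term
   absorbs it. *)
suff : M < al ^+ 2 * (1 - s ^+ 2) - 2 * al * (m * s).
  have -> : 2 * al * (al * (1 - s ^+ 2) - m * s + bq) =
    (al ^+ 2 * (1 - s ^+ 2) + 2 * al * bq + bb) +
    (al ^+ 2 * (1 - s ^+ 2) - 2 * al * (m * s) - bb) by ring.
  move=> H1; lra.
have -> : al ^+ 2 * (1 - s ^+ 2) - 2 * al * (m * s) =
   al * (al * (1 - s ^+ 2) - 2 * (m * s)) by ring.
suff H1 : 1 <= al * (1 - s ^+ 2) - 2 * (m * s).
  apply: (@lt_le_trans _ _ al); first lra.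
  by rewrite ler_peMr // ltW.
(* Near [- p] the term [- m * s] is positive enough by itself. Elsewhere [1 + s] is at least 1/2 and
   [1 - s] at least [de], so [al * (1 - s ^+ 2)] dominates. *)
have [hs|hs] := leP s (- 2^-1).
  have A1 : 0 <= al * (1 - s ^+ 2) by rewrite mulr_ge0 // ltW.
  have : 1 <= - (2 * (m * s)); last lra.
  have : 0 <= m * (- 2^-1 - s) by rewrite mulr_ge0 //; lra.
  lra.
have A1 : al * (de * 2^-1) <= al * (1 - s ^+ 2).
  rewrite ler_pM2l //; have -> : 1 - s ^+ 2 = (1 - s) * (1 + s) by ring.
  by apply: ler_pM; lra.
have A2 : m * s <= m.
  by rewrite ler_piMr //; lra.
lra.
Qed.

(** If [K p] is below the maximum, [K] stays below it by [et] on a cap around [p]. After adding a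
    small multiple of the barrier the maximum still lies outside the cap, where the operator is
    positive on the sum: a contradiction. One barrier covers the whole complement of the cap, so no
    chain of balls is needed. For functions of degree 0 the Euclidean Laplacian is the Laplacian of
    the sphere. *)
Lemma strong_maximum_principle (K : 'rV[R]_n -> R) (b : 'rV[R]_n -> 'rV[R]_n) (M : R) :
  (2 <= n)%N -> Ck O 2 K -> (forall a x, 0 < a -> O x -> K (a *: x) = K x) ->
  (forall x, sphere x -> dot (b x) (b x) <= M) ->
  (forall x, sphere x ->
    0 <= \sum_i 'D_(e i) ('D_(e i) K) x + \sum_i b x 0 i * 'D_(e i) K x) ->
  exists c, forall x, O x -> K x = c.
Proof.
have fin (p1 p2 p3 : R) : p1 + p2 <= 0 -> 0 <= p1 - p3 -> 0 < p2 + p3 -> False by lra.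
move=> n2 hK homK bM LK.
have normK x : O x -> K x = K ((eucl x)^-1 *: x).
  by move=> x0; rewrite homK // invr_gt0 eucl_gt0.
have sph0 : @sphere R n !=set0.
  pose i0 : 'I_n := Ordinal (leq_trans (isT : (0 < 2)%N) n2).
  by exists (e i0); apply/sphereE; rewrite dot_delta mxE !eqxx.
have evt G : Ck O 2 G -> (forall a x, 0 < a -> O x -> G (a *: x) = G x) ->
    exists2 x, sphere x & forall y, O y -> G y <= G x.
  move=> hG homG.
  have [|x xS xmax] := EVT_max_rV sph0 sphere_compact (f := G).
    apply: continuous_in_subspaceT => x /set_mem /punctured_sphere.
    exact: Ck_continuous hG.
  exists x; first exact: set_mem.
  move=> y y0; rewrite -(homG (eucl y)^-1) ?invr_gt0 ?eucl_gt0 //.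
  by apply: xmax; apply/mem_set; exact: sphere_normalize.
have [x0 sx0 maxK] := evt K hK homK.
exists (K x0) => p0 Op0; rewrite normK //.
set p := _ *: p0; have sp : sphere p by exact: sphere_normalize.
clearbody p.
apply/eqP; rewrite eq_le maxK /=; last exact: punctured_sphere.
rewrite leNgt; apply/negP => Kp.
pose et := (K x0 - K p) / 2.
have et0 : 0 < et by rewrite divr_gt0 // subr_gt0.
have [de /andP[de0 de1] cap] : exists2 de, 0 < de <= 1 &
    forall x, sphere x -> 1 - de < dot x p -> K x <= K x0 - et.
  have := Ck_continuous hK (punctured_sphere sp).
  move/cvgrPdist_lt => /(_ _ et0) /nbhs_ballP[r /= r0 hr].
  (* On the sphere |p - x|^2 = 2 - 2 x.p, so this cap lies in the Euclidean ball of radius [r],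
     hence in the ball of the sup norm. *)
  exists (Num.min 1 (r ^+ 2 / 4)).
    by rewrite lt_min ltr01 divr_gt0 ?exprn_gt0 //= ge_min lexx.
  move=> x /sphereE sx; rewrite ltrBlDr => hx.
  have hx2 : 1 < dot x p + r ^+ 2 / 4.
    by apply: (lt_le_trans hx); rewrite lerD2l ge_min lexx orbT.
  have /hr : ball p r x.
    rewrite -ball_normE /= /Num.Def.normr /= mx_normrE; apply: bigmax_lt => // -[i j] _ /=.
    rewrite ord1 -(@ltr_pXn2r _ 2) ?nnegrE ?normr_ge0 ?ltW // real_normK ?num_real //.
    have : dot (p - x) (p - x) < r ^+ 2.
      move/sphereE: sp => sp; rewrite dotBl !dotBr sp sx [dot p x]dotC.
      have : 0 < r ^+ 2 by rewrite exprn_gt0.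
      lra.
    apply: le_lt_trans; rewrite /dot (bigD1 j) //= -expr2 lerDl.
    by apply: sumr_ge0 => k _; rewrite -expr2 sqr_ge0.
  by rewrite /= distrC => /ltr_normlW; rewrite /et; lra.
clearbody et.
pose m : R := n.-1%:R.
have m1 : 1 <= m by rewrite /m ler1n; case: (n) n2 => [|[]].
have nm : n%:R = m + 1 by rewrite /m natr1 prednK // (leq_trans _ n2).
have M0 : 0 <= M := le_trans (dotxx_ge0 _) (bM x0 sx0).
(* Meets both lower bounds on [al] in [barrier_pos]. *)
pose al := M + 1 + 4 * (m + 1) / de.
have al0 : 0 < al.
  have : 0 <= 4 * (m + 1) / de by rewrite divr_ge0 ?ltW //; lra.
  rewrite /al; lra.
have al1 : M + 1 <= al by rewrite /al lerDl divr_ge0 ?ltW //; lra.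
have al2 : 4 * (m + 1) <= al * de.
  have -> : al * de = (M + 1) * de + 4 * (m + 1) by rewrite /al; field; rewrite gt_eqF.
  by rewrite lerDr mulr_ge0 ?ltW //; lra.
clearbody al m.
pose ph y := expR (al * latitude p y).
(* The barrier is at most [expR al] on the sphere, so the perturbation is at most [et / 2]: too
   small to bring the maximum into the cap. *)
pose ep := et / 2 / expR al.
have ep0 : 0 < ep by exact: divr_gt0 (divr_gt0 et0 (ltr0n _ 2)) (expR_gt0 _).
have epE : ep * expR al = et / 2 by rewrite /ep divfK // gt_eqF // expR_gt0.
clearbody ep.
pose G y := K y + ep * ph y.
have hph : Ck O 2 ph by apply: Ck_expR oO _; apply: (CkZ oO); exact: Ck_latitude.
have hG : Ck O 2 G by exact: (CkD oO hK (CkZ oO ep hph)).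
have homG a x : 0 < a -> O x -> G (a *: x) = G x.
  move=> a0 Ox; rewrite /G homK //; congr (_ + ep * expR (al * _)).
  rewrite /latitude dotZl euclZ gtr0_norm //.
  have e1 := eucl_neq0 Ox; have a1 : a != 0 by rewrite gt_eqF.
  by field; rewrite ?a1 ?e1.
have [x1 sx1 maxG] := evt G hG homG.
have Ox1 := punctured_sphere sx1.
have lat1 : latitude p x1 = dot x1 p by rewrite /latitude (sx1 : eucl x1 = 1) invr1 mulr1.
have [s1 s2] : -1 <= dot x1 p /\ dot x1 p <= 1.
  have := cauchy_schwarz x1 p.
  move/sphereE: (sx1) => ->; move/sphereE: (sp) => ->; rewrite mulr1.
  by rewrite -real_normK ?num_real // expr_le1 ?normr_ge0 // ler_norml => /andP[].
have [hcap|hcap] := ltP (1 - de) (dot x1 p).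
  have := maxG _ (punctured_sphere sx0).
  have := cap _ sx1 hcap.
  have : 0 < ep * ph x0 by rewrite mulr_gt0 // ?expR_gt0.
  have : ep * ph x1 <= et / 2.
    rewrite -epE /ph lat1 ler_pM2l // ler_expR.
    by rewrite -[leRHS]mulr1 ler_pM2l.
  rewrite /G; lra.
have lapG i : 'D_(e i) G x1 = 0 /\ 'D_(e i) ('D_(e i) G) x1 <= 0.
  exact: second_derivative_at_max oO hG Ox1 maxG.
have dph v y : O y -> is_derive y v ph (al * ph y * 'D_v (latitude p) y).
  move=> Oy; have dl := Ck_is_derive v (Ck_latitude p 1) Oy.
  have -> : al * ph y * 'D_v (latitude p) y =
      expR (al * latitude p y) * (al * 'D_v (latitude p) y + latitude p y * 0).
    by rewrite mulr0 addr0 mulrA [al * ph y]mulrC.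
  exact: (is_derive_comp1 (is_derive_mul (is_derive_const al y v) dl) (is_derive_expR _)).
have dphE v y : O y -> 'D_v ph y = al * ph y * 'D_v (latitude p) y.
  by move=> /(dph v) [].
have dG v y : O y -> 'D_v G y = 'D_v K y + ep * 'D_v ph y.
  move=> Oy; apply: derive_val.
  have := is_derive_add (Ck_is_derive v hK Oy)
    (is_derive_mul (is_derive_const ep y v) (Ck_is_derive v hph Oy)).
  by rewrite mulr0 addr0.
have ph0 : 0 < ph x1 by exact: expR_gt0.
clearbody G ph.
have d2ph v : 'D_v ('D_v ph) x1 =
   al * ph x1 * (al * ('D_v (latitude p) x1) ^+ 2 + 'D_v ('D_v (latitude p)) x1).
  rewrite (derive_open v oO Ox1 (dphE v)); apply: derive_val.
  have dl2 := Ck_is_derive v (Ck_derive v (Ck_latitude p 2)) Ox1.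
  have := is_derive_mul (is_derive_mul (is_derive_const al x1 v) (dph v _ Ox1)) dl2.
  move=> /is_derive_eq; apply; rewrite mulr0 addr0.
  move: ('D_v ('D_v (latitude p)) x1) => d2; move: ('D_v (latitude p) x1) => d1.
  by move: (ph x1) => r; ring.
have d2G v : 'D_v ('D_v G) x1 = 'D_v ('D_v K) x1 + ep * 'D_v ('D_v ph) x1.
  rewrite (derive_open v oO Ox1 (dG v)); apply: derive_val.
  have := is_derive_add (Ck_is_derive v (Ck_derive v hK) Ox1)
    (is_derive_mul (is_derive_const ep x1 v) (Ck_is_derive v (Ck_derive v hph) Ox1)).
  by rewrite mulr0 addr0.
move: (sx1) (sp) => /sphereE sx1' /sphereE sp'.
have dlat i : 'D_(e i) (latitude p) x1 = p 0 i - dot x1 p * x1 0 i.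
  rewrite derive_latitude // (sx1 : eucl x1 = 1) invr1 expr1n !mulr1 dot_delta.
  by rewrite [dot _ p]dotC dot_delta.
have d2lat i : 'D_(e i) ('D_(e i) (latitude p)) x1 =
   - 2 * (x1 0 i * p 0 i) - dot x1 p + 3 * dot x1 p * (x1 0 i * x1 0 i).
  by rewrite derive2_latitude // [dot (e i) p]dotC !dot_delta mxE !eqxx /=; ring.
have sum1 : \sum_i 'D_(e i) ('D_(e i) ph) x1 + \sum_i b x1 0 i * 'D_(e i) ph x1 =
    al * ph x1 * (al * (1 - dot x1 p ^+ 2) - m * dot x1 p + dot (b x1) (p - dot x1 p *: x1)).
  under eq_bigr do rewrite d2ph dlat d2lat.
  under [X in _ + X]eq_bigr do rewrite dphE // dlat.
  rewrite -big_split /=.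
  pose S := dot x1 p; rewrite -/S.
  transitivity (al * ph x1 * (\sum_i (al * (p 0 i * p 0 i) - (2 * al * S + 2) * (x1 0 i * p 0 i)
    + (al * S ^+ 2 + 3 * S) * (x1 0 i * x1 0 i) - S
    + (b x1 0 i * p 0 i) - S * (b x1 0 i * x1 0 i)))).
    by rewrite mulr_sumr; apply: eq_bigr => i _; ring.
  congr (_ * _); rewrite !big_split /= !sumrN -!mulr_sumr.
  rewrite sumr_const card_ord -[S *+ n]mulr_natr nm -!/(dot _ _) dotBr dotZr sp' sx1' -/S; ring.
have : 0 < al * (1 - dot x1 p ^+ 2) - m * dot x1 p + dot (b x1) (p - dot x1 p *: x1).
  apply: (@barrier_pos _ _ _ de M (dot (b x1) (b x1))) => //.
  - by rewrite dotxx_ge0 bM.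
  - by rewrite s1.
  - have := dotxx_ge0 (al *: (p - dot x1 p *: x1) + b x1).
    have : dot (p - dot x1 p *: x1) (p - dot x1 p *: x1) = 1 - dot x1 p ^+ 2.
      rewrite dotBl !dotBr !dotZl !dotZr sp' sx1' [dot p x1]dotC; ring.
    move: (p - dot x1 p *: x1) => q qq.
    rewrite dotDl !dotDr !dotZl !dotZr [dot q (b x1)]dotC qq => /le_trans; apply.
    by rewrite le_eqVlt; apply/orP; left; apply/eqP; ring.
set Z := (X in 0 < X) => Z0.
have H3 : 0 < ep * (al * ph x1 * Z) by rewrite !mulr_gt0.
rewrite -sum1 mulrDr in H3.
have H1 : \sum_i 'D_(e i) ('D_(e i) G) x1 <= 0 by apply: sumr_le0 => i _; case: (lapG i).
have E1 : \sum_i 'D_(e i) ('D_(e i) G) x1 =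
    \sum_i 'D_(e i) ('D_(e i) K) x1 + ep * \sum_i 'D_(e i) ('D_(e i) ph) x1.
  by rewrite mulr_sumr -big_split; apply: eq_bigr => i _; exact: d2G.
(* The gradient of [G] vanishes at its maximum, which trades the drift of [K] for that of the
   barrier. *)
have E2 : \sum_i b x1 0 i * 'D_(e i) K x1 = - (ep * \sum_i b x1 0 i * 'D_(e i) ph x1).
  rewrite mulr_sumr -sumrN; apply: eq_bigr => i _.
  have [+ _] := lapG i; rewrite dG // => /eqP; rewrite addr_eq0 => /eqP ->.
  by rewrite mulrN mulrCA.
have H2 := LK x1 sx1; rewrite E1 in H1; rewrite E2 in H2.
exact: fin H1 H2 H3.
Qed.

End StrongMaximumPrinciple.

(** * The rigidity theorem for the homogeneous extension *)

Section Laplacian.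
Context {R : realType} {n : nat}.
Implicit Types (W : 'rV[R]_n -> R) (x : 'rV[R]_n).

(** The flat Laplacian. For [W] of degree 1 it is, on the sphere, the spherical Laplacian plus (n -
    1) W, and [gradsq W] is the squared spherical gradient plus W^2. *)
Definition laplacian W x : R := \sum_i 'D_(delta_mx 0 i) ('D_(delta_mx 0 i) W) x.
Definition gradsq W x : R := \sum_i ('D_(delta_mx 0 i) W x) ^+ 2.

End Laplacian.

Section Homogeneous.
Context {R : realType} {n : nat}.
Implicit Types (f W : 'rV[R]_n -> R) (x v : 'rV[R]_n).
Local Notation O := (@punctured R n).
Local Notation e i := (delta_mx 0 i : 'rV[R]_n).
Let oO := @open_punctured R n.

Lemma punctured_dilation (a : R) x : 0 < a -> O x -> O (a *: x).
Proof. by move=> a0 x0; rewrite /punctured /= scaler_eq0 negb_or gt_eqF. Qed.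

(** Differentiates f ((1 + h) x) = g (1 + h) f x at h = 0. Taking for [g] the identity, a constant
    or the inverse gives Euler's relation in degree 1, 0 or -1. *)
Lemma euler_derive f (g : R -> R) g1 x : O x -> (forall a, 0 < a -> f (a *: x) = g a * f x) ->
  is_derive (1 : R) (1 : R) g g1 -> is_derive x x f (g1 * f x).
Proof.
move=> Ox fg dg; apply: (is_derive_line0 _ _ _ _).2.
have H : is_derive (0 : R) (1 : R) (fun h => g (h + 1) * f x) (g1 * f x).
  have d1 : is_derive (0 : R) (1 : R) (fun h : R => h + 1) 1.
    have := is_derive_add (is_derive_id (0 : R) (1 : R)) (is_derive_const (1 : R) (0 : R) (1 : R)).
    by rewrite addr0.
  have d2 : is_derive (0 : R) (1 : R) (fun h => g (h + 1)) g1.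
    rewrite -[g1]mulr1; apply: (@is_derive1_comp _ g (fun h : R => h + 1)).
    by rewrite add0r.
  have := is_derive_mul d2 (is_derive_const (f x) (0 : R) (1 : R)).
  by rewrite mulr0 add0r mulrC.
apply: (near_eq_is_derive _ H).
exists 1; first exact: ltr01.
move=> h /=; rewrite sub0r normrN => h1.
by rewrite -fg ?scalerDl ?scale1r //; move: h1; rewrite ltr_norml => /andP[]; lra.
Qed.

Lemma sum_derive_coord f x v : Ck O 1 f -> O x ->
  \sum_i v 0 i * 'D_(e i) f x = 'D_v f x.
Proof. by move=> hf Ox; rewrite (derive_coordE v oO hf Ox). Qed.

Variable W : 'rV[R]_n -> R.
Hypothesis hW : Ck O 3 W.
Hypothesis homW : forall a x, 0 < a -> O x -> W (a *: x) = a * W x.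

Lemma homogeneous_derive a x v : 0 < a -> O x -> 'D_v W (a *: x) = 'D_v W x.
Proof.
move=> a0 Ox; rewrite (@derive_dilation _ _ W x v a a) ?gt_eqF //.
- by rewrite divff ?mul1r // gt_eqF.
- by move=> y; exact: homW.
- by case: (Ck_is_derive v hW Ox).
Qed.

Lemma homogeneous_derive2 a x u v : 0 < a -> O x ->
  'D_u ('D_v W) (a *: x) = a^-1 * 'D_u ('D_v W) x.
Proof.
move=> a0 Ox; rewrite (@derive_dilation _ _ ('D_v W) x u a 1) ?gt_eqF //.
- by rewrite mul1r.
- by move=> y Oy; rewrite mul1r homogeneous_derive.
- by case: (Ck_is_derive u (Ck_derive v hW) Ox).
Qed.

Lemma laplacian_dilation a x : 0 < a -> O x -> laplacian W (a *: x) = a^-1 * laplacian W x.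
Proof.
move=> a0 Ox; rewrite mulr_sumr; apply: eq_bigr => i _.
exact: homogeneous_derive2.
Qed.

Lemma gradsq_dilation a x : 0 < a -> O x -> gradsq W (a *: x) = gradsq W x.
Proof.
by move=> a0 Ox; apply: eq_bigr => i _; rewrite homogeneous_derive.
Qed.

Lemma euler1 x : O x -> \sum_i x 0 i * 'D_(e i) W x = W x.
Proof.
move=> Ox; rewrite (sum_derive_coord _ (Ck_le (isT : (1 <= 3)%N) hW) Ox).
rewrite -[RHS]mul1r; apply: derive_val.
by apply: (@euler_derive W id) => // a a0; rewrite homW.
Qed.

Lemma euler2 x v : O x -> \sum_i x 0 i * 'D_(e i) ('D_v W) x = 0.
Proof.
move=> Ox; rewrite (sum_derive_coord _ (Ck_le (isT : (1 <= 2)%N) (Ck_derive v hW)) Ox).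
rewrite -[RHS](mul0r ('D_v W x)); apply: derive_val.
apply: (@euler_derive _ (fun=> 1)) => // a a0.
by rewrite mul1r homogeneous_derive.
Qed.

Lemma Ck_laplacian : Ck O 1 (laplacian W).
Proof. by apply: (Ck_sum oO) => i _; apply: Ck_derive; exact: Ck_derive. Qed.

Lemma Ck_gradsq : Ck O 2 (gradsq W).
Proof. by apply: (Ck_sum oO) => i _; apply: (CkX oO); exact: Ck_derive. Qed.

Lemma euler3 x : O x -> \sum_i x 0 i * 'D_(e i) (laplacian W) x = - laplacian W x.
Proof.
move=> Ox; rewrite (sum_derive_coord _ Ck_laplacian Ox).
rewrite -[RHS]mulN1r; apply: derive_val.
apply: (@euler_derive _ (fun a => a^-1)) => //; first by move=> a a0; exact: laplacian_dilation.
have := is_derive_inv (oner_neq0 R) (is_derive_id (1 : R) (1 : R)).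
by rewrite invr1 !mul1r.
Qed.

Lemma derive2_sym x i j : O x -> 'D_(e i) ('D_(e j) W) x = 'D_(e j) ('D_(e i) W) x.
Proof. by move=> Ox; exact: (schwarz oO _ _ hW Ox). Qed.

(** Schwarz is used twice, under the outer derivative for [W] and then for ['D_(e i) W]. It plays
    the role of Bochner's commutation formula, without curvature term because the space is flat. *)
Lemma derive_laplacian x j : O x ->
  'D_(e j) (laplacian W) x = \sum_i 'D_(e i) ('D_(e i) ('D_(e j) W)) x.
Proof.
move=> Ox; apply: derive_val.
have -> : \sum_i 'D_(e i) ('D_(e i) ('D_(e j) W)) x =
   \sum_i 'D_(e j) ('D_(e i) ('D_(e i) W)) x.
  apply: eq_bigr => i _.
  apply: etrans (schwarz oO (e i) (e j) (Ck_derive (e i) hW) Ox).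
  by apply: (derive_open _ oO Ox) => y; exact: derive2_sym.
apply: is_derive_bigsum => i _.
exact: (Ck_is_derive (e j) (Ck_derive (e i) (Ck_derive (e i) hW)) Ox).
Qed.

Lemma is_derive_gradsq x v : O x -> is_derive x v (gradsq W)
  (2 * \sum_j 'D_v ('D_(e j) W) x * 'D_(e j) W x).
Proof.
move=> Ox; rewrite mulr_sumr; apply: is_derive_bigsum => j _.
have := is_derive_pow 2 (Ck_is_derive v (Ck_derive (e j) hW) Ox).
by rewrite expr1 -mulrA [X in _ * X]mulrC.
Qed.

End Homogeneous.

Section Rigidity.
Context {R : realType} {n : nat}.
Implicit Types (x v : 'rV[R]_n).
Local Notation O := (@punctured R n).
Local Notation e i := (delta_mx 0 i : 'rV[R]_n).
Let oO := @open_punctured R n.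
Let m : R := n.-1%:R.
Variables (W : 'rV[R]_n -> R) (Q dQ Psi : R -> R).
Hypothesis n3 : (3 <= n)%N.
Hypothesis hW : Ck O 3 W.
Hypothesis W0 : forall x, O x -> 0 < W x.
Hypothesis homW : forall a x, 0 < a -> O x -> W (a *: x) = a * W x.
Let wd x := W x * (eucl x)^-1.
Hypothesis hQ : forall x, O x -> is_derive (wd x) (1 : R) Q (dQ (wd x)).
Hypothesis dQ0 : forall x, O x -> 0 <= dQ (wd x).
Hypothesis hPsi : forall x, O x ->
  is_derive (wd x) (1 : R) Psi (Q (wd x) / (2 * wd x ^+ 2)).
Hypothesis eqn : forall x, sphere x ->
  2 / m * W x * laplacian W x - gradsq W x = Q (W x).

Let m0 : m != 0.
Proof. by rewrite /m pnatr_eq0; case: (n) n3 => [|[]]. Qed.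

Let m2 : 2 <= m.
Proof. by rewrite /m ler_nat; case: (n) n3 => [|[|[]]]. Qed.

Let nm : n%:R = m + 1.
Proof. by rewrite /m natr1 prednK // (leq_trans _ n3). Qed.

(** Every term of the equation has degree 0 once its argument is [wd x]. On an open set the equation
    can be differentiated in all directions. *)
Lemma eqn_punctured x : O x -> 2 / m * W x * laplacian W x - gradsq W x = Q (wd x).
Proof.
move=> Ox; have s0 := eucl_gt0 Ox; have s1 : 0 < (eucl x)^-1 by rewrite invr_gt0.
have := eqn (sphere_normalize Ox).
rewrite homW // laplacian_dilation // gradsq_dilation // invrK.
rewrite /wd [(eucl x)^-1 * W x]mulrC => <-; congr (_ - _).
by field; rewrite ?m0 ?gt_eqF.
Qed.

(** The component along [v] of A(DW), where A = D^2 W - (lap W / m) (I - x x^T / |x|^2); the product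
    of the last matrix with DW is simplified by Euler's relation. *)
Let Y v x : R := \sum_j 'D_v ('D_(e j) W) x * 'D_(e j) W x
  - m^-1 * laplacian W x * ('D_v W x - W x * dot x v * (eucl x)^-1 ^+ 2).

Let k x : R := 2^-1 * (eucl x * gradsq W x * (W x)^-1) - Psi (wd x).

Let dk v x : R := eucl x * (W x)^-1 * Y v x.

Lemma is_derive_wd x v : O x ->
  is_derive x v wd ('D_v W x * (eucl x)^-1 - W x * dot x v * (eucl x)^-1 ^+ 3).
Proof.
move=> Ox; have s0 := eucl_neq0 Ox.
have := is_derive_mul (Ck_is_derive v hW Ox) (is_derive_inv s0 (is_derive_eucl v Ox)).
move=> /is_derive_eq; apply.
have alg (a b c s : R) : a * - (s * s * (b * s)) + s * c = c * s - a * b * s ^+ 3 by ring.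
exact: alg.
Qed.

(** When [Q] is replaced by means of the equation in the derivative of [Psi], the terms in
    [gradsq W] cancel. What remains of [Psi] is the trace part subtracted in [Y]. *)
Lemma is_derive_k x v : O x -> is_derive x v k (dk v x).
Proof.
move=> Ox; have s0 := eucl_neq0 Ox; have w0 : W x != 0 by rewrite gt_eqF // W0.
have d1 := is_derive_mul (is_derive_mul (is_derive_eucl v Ox) (is_derive_gradsq hW v Ox))
  (is_derive_inv w0 (Ck_is_derive v hW Ox)).
have d2 := is_derive_comp1 (is_derive_wd v Ox) (hPsi Ox).
apply: is_derive_eq (is_derive_add (is_derive_mul (is_derive_const 2^-1 x v) d1) (is_derive_opp d2)) _.
rewrite -(eqn_punctured Ox).
have alg (s w T E S xv wv : R) : s != 0 -> w != 0 ->
  2^-1 * (s * E * - (w^-1 * w^-1 * wv) + w^-1 * (s * (2 * S) + E * (xv / s)))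
   + s * E * w^-1 * 0 -
   (2 / m * w * T - E) / (2 * (w * s^-1) ^+ 2) * (wv * s^-1 - w * xv * s^-1 ^+ 3) =
  s * w^-1 * (S - m^-1 * T * (wv - w * xv * s^-1 ^+ 2)).
  by move=> s1 w1; field; rewrite s1 w1 m0.
exact: alg.
Qed.

Lemma Ck_dk v : Ck O 1 (dk v).
Proof.
have cs : Ck O 1 (@eucl R n) := Ck_eucl 1.
have csV : Ck O 1 (fun x => (eucl x)^-1) by apply: (CkV oO); [exact: eucl_neq0|].
have cW : Ck O 1 W := Ck_le (isT : (1 <= 3)%N) hW.
apply: (CkM oO).
  apply: (CkM oO cs); apply: (CkV oO) cW => x Ox; by rewrite gt_eqF // W0.
apply: (CkB oO).
  apply: (Ck_sum oO) => j _; apply: (CkM oO).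
    by apply: Ck_derive; exact: Ck_derive.
  by apply: CkW; exact: Ck_derive.
apply: (CkM oO).
  by apply: (CkZ oO); exact: Ck_laplacian.
apply: (CkB oO).
  by apply: CkW; exact: Ck_derive.
apply: (CkM oO); last exact: (CkX oO).
exact: (CkM oO cW (@Ck_dotl _ _ _ 1 v oO)).
Qed.

Lemma Ck_wd : Ck O 1 wd.
Proof.
apply: (CkM oO); first exact: Ck_le (isT : (1 <= 3)%N) hW.
by apply: (CkV oO) (Ck_eucl 1); exact: eucl_neq0.
Qed.

(** [Psi] is only known to be differentiable along the values of [wd], but [dk] no longer contains
    [Psi] or [Q]: two derivatives of [k] cost three of [W]. *)
Lemma Ck_k : Ck O 2 k.
Proof.
have cWV : Ck O 0 (fun x => (W x)^-1).
  by apply: (CkV oO) (Ck_le (leq0n 3) hW) => x Ox; rewrite gt_eqF // W0.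
have cE := Ck_le (leq0n 2) (Ck_gradsq hW).
have c1 := CkZ oO 2^-1 (CkM oO (CkM oO (Ck_eucl 0) cE) cWV).
apply: (@Ck_step _ _ _ oO _ _ dk) => [x Ox|x v Ox|v].
- apply: continuousB; first exact: Ck_continuous c1 Ox.
  apply: (@continuous_comp _ _ _ wd Psi); first exact: Ck_continuous Ck_wd Ox.
  apply: differentiable_continuous; apply/derivable1_diffP.
  by case: (hPsi Ox).
- exact: is_derive_k.
- exact: Ck_dk.
Qed.

Lemma k_dilation a x : 0 < a -> O x -> k (a *: x) = k x.
Proof.
move=> a0 Ox; have Oax := punctured_dilation a0 Ox.
have w0 : W x != 0 by rewrite gt_eqF // W0.
have s0 := eucl_neq0 Ox; have a1 : a != 0 by rewrite gt_eqF.
have -> : k (a *: x) = 2^-1 * (a * eucl x * gradsq W x * (a * W x)^-1)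
     - Psi (a * W x * (a * eucl x)^-1).
  by rewrite /k /wd homW // gradsq_dilation // euclZ gtr0_norm.
have -> : a * W x * (a * eucl x)^-1 = wd x by rewrite /wd; field; rewrite a1 s0.
have alg (E s w : R) : w != 0 -> 2^-1 * (a * s * E * (a * w)^-1) = 2^-1 * (s * E * w^-1).
  by move=> w1; field; rewrite a1 w1.
by rewrite /k alg.
Qed.

Lemma derive2_k v x : sphere x ->
  'D_v ('D_v k) x = (dot x v * (W x)^-1 - (W x)^-1 ^+ 2 * 'D_v W x) * Y v x
   + (W x)^-1 * (\sum_j ('D_v ('D_v ('D_(e j) W)) x * 'D_(e j) W x
                          + ('D_v ('D_(e j) W) x) ^+ 2)
      - m^-1 * ('D_v (laplacian W) x * ('D_v W x - W x * dot x v)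
        + laplacian W x * ('D_v ('D_v W) x - 'D_v W x * dot x v - W x * dot v v
              + 2 * W x * dot x v ^+ 2))).
Proof.
move=> sx; have Ox := punctured_sphere sx; have s0 := eucl_neq0 Ox.
have w0 : W x != 0 by rewrite gt_eqF // W0.
have -> : 'D_v ('D_v k) x = 'D_v (dk v) x.
  by apply: (derive_open _ oO Ox) => y Oy; case: (is_derive_k v Oy).
apply: derive_val.
have dV := is_derive_inv s0 (is_derive_eucl v Ox).
have dS : is_derive x v (fun y => \sum_j 'D_v ('D_(e j) W) y * 'D_(e j) W y)
    (\sum_j ('D_v ('D_v ('D_(e j) W)) x * 'D_(e j) W x + ('D_v ('D_(e j) W) x) ^+ 2)).
  apply: is_derive_bigsum => j _.
  have alg (a b c : R) : a * a + b * c = c * b + a ^+ 2 by ring.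
  apply: is_derive_eq (is_derive_mul (Ck_is_derive v (Ck_derive v (Ck_derive (e j) hW)) Ox)
    (Ck_is_derive v (Ck_derive (e j) hW) Ox)) _.
  exact: alg.
have dT := Ck_is_derive v (Ck_laplacian hW) Ox.
have dW := Ck_is_derive v hW Ox.
have dW2 := Ck_is_derive v (Ck_derive v hW) Ox.
have d1 := is_derive_add dS (is_derive_opp (is_derive_mul
  (is_derive_mul (is_derive_const m^-1 x v) dT)
  (is_derive_add dW2 (is_derive_opp (is_derive_mul
     (is_derive_mul dW (is_derive_dotl v x v)) (is_derive_pow 2 dV)))))).
have d2 := is_derive_mul (is_derive_mul (is_derive_eucl v Ox) (is_derive_inv w0 dW)) d1.
apply: is_derive_eq d2 _; rewrite (sx : eucl x = 1) /Y (sx : eucl x = 1).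
have alg (w wv wvv T Tv xv vv S1 S2 : R) : 
  1 * w^-1 * (S2 - (m^-1 * T * (wvv - ((w * xv) * (2%:R * 1^-1 ^+ 1 * - (1^-1 * 1^-1 * (xv / 1)))
     + 1^-1 ^+ 2 * (w * vv + xv * wv))) + (wv - w * xv * 1^-1 ^+ 2) * (m^-1 * Tv + T * 0)))
  + (S1 - m^-1 * T * (wv - w * xv * 1^-1 ^+ 2)) * (1 * - (w^-1 * w^-1 * wv) + w^-1 * (xv / 1))
  = (xv * w^-1 - w^-1 ^+ 2 * wv) * (S1 - m^-1 * T * (wv - w * xv * 1^-1 ^+ 2))
   + w^-1 * (S2 - m^-1 * (Tv * (wv - w * xv) + T * (wvv - wv * xv - w * vv + 2 * w * xv ^+ 2))).
  by rewrite !invr1 !expr1n; ring.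
exact: alg.
Qed.



(** The differentiated equation, solved for the gradient of the Laplacian. [Q] contributes through
    the derivative of [wd], which on the sphere is the tangential part of DW. *)
Lemma derive_laplacian_eqn x v : sphere x ->
  W x * 'D_v (laplacian W) x = m * (\sum_j 'D_v ('D_(e j) W) x * 'D_(e j) W x)
    - laplacian W x * 'D_v W x + m / 2 * dQ (W x) * ('D_v W x - W x * dot x v).
Proof.
move=> sx; have Ox := punctured_sphere sx.
have wdx : wd x = W x by rewrite /wd (sx : eucl x = 1) invr1 mulr1.
have dT := Ck_is_derive v (Ck_laplacian hW) Ox.
have dW := Ck_is_derive v hW Ox.
have d1 := is_derive_add (is_derive_mul (is_derive_mul (is_derive_const (2 / m) x v) dW) dT)
  (is_derive_opp (is_derive_gradsq hW v Ox)).
have d2 := is_derive_comp1 (is_derive_wd v Ox) (hQ Ox).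
have E1 := derive_open v oO Ox eqn_punctured.
have := @derive_val _ _ _ _ _ _ _ d1.
rewrite E1 (@derive_val _ _ _ _ _ _ _ d2) wdx (sx : eucl x = 1).
have alg (w wv T Tv S q xv : R) : q * (wv * 1^-1 - w * xv * 1^-1 ^+ 3) =
   2 / m * w * Tv + T * (2 / m * wv + w * 0) - 2 * S ->
   w * Tv = m * S - T * wv + m / 2 * q * (wv - w * xv).
  move=> H; rewrite -[m / 2 * q * _]mulrA.
  have -> : q * (wv - w * xv) = 2 / m * w * Tv + T * (2 / m * wv) - 2 * S.
    by move: H; rewrite invr1 expr1n !mulr1 mulr0 addr0.
  by field.
exact: alg.
Qed.

(** The expansion behind [laplacian_k] with all derivatives abstracted: [X] is the point, [D] is DW,
    [y] is D^2 W(DW), [t] the gradient of the Laplacian [T], [B2] is |D^2 W|^2, [P] is D^2 W(DW, DW)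
    and [Z] is D(lap W).DW. The last term disappears when N = m + 1. *)
Lemma sum_algebra (N w T E P Z B2 : R) (X D y t b bb dd : 'I_n -> R) :
  N = n%:R -> w != 0 ->
  \sum_i X i * y i = 0 -> \sum_i X i * D i = w -> \sum_i X i * X i = 1 ->
  \sum_i D i * D i = E -> \sum_i D i * y i = P -> \sum_i dd i = Z ->
  \sum_i t i * D i = Z -> \sum_i t i * X i = - T -> \sum_i bb i = T -> \sum_i b i = B2 ->
  w * (\sum_i ((X i * w^-1 - w^-1 ^+ 2 * D i) * (y i - m^-1 * T * (D i - w * X i))
    + w^-1 * ((dd i + b i) - m^-1 * (t i * (D i - w * X i)
       + T * (bb i - D i * X i - w + 2 * w * X i ^+ 2)))))
  - (m - 2) * (\sum_i D i * (w^-1 * (y i - m^-1 * T * (D i - w * X i)))) =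
  B2 - T ^+ 2 / m + (m - 1) / m * (Z + T * w) - (m - 1) / w * (P - T / m * (E - w ^+ 2))
   + (N - m - 1) * (T / m * w).
Proof.
move=> -> w0 h1 h2 h3 h4 h5 h6 h7 h8 h9 h10.
pose c := m^-1 * T.
transitivity (\sum_i (X i * y i + (- c - (m - 2) * c) * (X i * D i) + (- c * w) * (X i * X i)
   + (- w^-1 - (m - 2) * w^-1) * (D i * y i) + (c * w^-1 + (m - 2) * c * w^-1) * (D i * D i)
   + dd i + b i + (- m^-1) * (t i * D i) + (m^-1 * w) * (t i * X i) + (- c) * bb i + c * w)).
  by rewrite !mulr_sumr -sumrB; apply: eq_bigr => i _; rewrite /c; field; rewrite m0 w0.
rewrite !big_split /= -!mulr_sumr sumr_const card_ord -[_ *+ n]mulr_natr.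
by rewrite h1 h2 h3 h4 h5 h6 h7 h8 h9 h10 /c; field; rewrite m0 w0.
Qed.

(** [I - X X^T] is a projection of trace n - 1 and [B] annihilates [X], so the cross term is the
    trace of [B]. *)
Lemma traceless_norm (B : 'I_n -> 'I_n -> R) (X : 'I_n -> R) (c : R) :
  (forall i j, B i j = B j i) -> (forall j, \sum_i X i * B i j = 0) ->
  \sum_i X i * X i = 1 ->
  \sum_i \sum_j (B i j - c * ((i == j)%:R - X i * X j)) ^+ 2 =
  \sum_i \sum_j B i j ^+ 2 - 2 * c * (\sum_i B i i) + c ^+ 2 * (n%:R - 1).
Proof.
move=> Bsym xB sxx.
transitivity (\sum_i (\sum_j B i j ^+ 2 + (- 2 * c) * B i i + c ^+ 2 - c ^+ 2 * (X i * X i))).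
  apply: eq_bigr => i _.
  transitivity (\sum_j (B i j ^+ 2 + (- 2 * c) * ((i == j)%:R * B i j) + (2 * c * X i) * (X j * B j i)
     + c ^+ 2 * (i == j)%:R + (- 2 * c ^+ 2 * X i) * ((i == j)%:R * X j)
     + (c ^+ 2 * X i ^+ 2) * (X j * X j))).
    apply: eq_bigr => j _; rewrite [B j i]Bsym.
    have : ((i == j)%:R : R) ^+ 2 = (i == j)%:R by case: eqP => _; rewrite ?expr1n ?expr0n.
    move: (B i j) (X i) (X j) ((i == j)%:R : R) => b xi xj d dd.
    have -> : (b - c * (d - xi * xj)) ^+ 2 = b ^+ 2 - 2 * c * (d * b) + 2 * c * xi * (xj * b)
       + c ^+ 2 * d ^+ 2 - 2 * c ^+ 2 * xi * (d * xj) + c ^+ 2 * xi ^+ 2 * (xj * xj) by ring.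
    by rewrite dd; ring.
  have pick (g : 'I_n -> R) : \sum_j (i == j)%:R * g j = g i.
    rewrite (bigD1 i) //= eqxx mul1r big1 ?addr0 // => j ji.
    by rewrite eq_sym (negbTE ji) mul0r.
  have pick1 : \sum_j (i == j)%:R = 1 :> R.
    by rewrite -[RHS](pick (fun=> 1)); apply: eq_bigr => j _; rewrite mulr1.
  rewrite 5!big_split /=.
  by rewrite -5!mulr_sumr xB sxx !pick pick1; ring.
rewrite 3!big_split /= sumrN sumr_const card_ord -[_ *+ n]mulr_natr -2!mulr_sumr sxx.
by ring.
Qed.

(** The third derivatives of [W] contract to D(lap W).DW, which the differentiated equation
    eliminates. This produces (m - 1) D^2 W(DW, DW) / W; the Laplacian of [k] contains -1 times D^2
    W(DW, DW) / W and the drift contributes the missing - (m - 2). *)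
Lemma laplacian_k x : sphere x ->
  W x * (\sum_i 'D_(e i) ('D_(e i) k) x) - (m - 2) * (\sum_i 'D_(e i) W x * 'D_(e i) k x)
  = \sum_i \sum_j ('D_(e i) ('D_(e j) W) x - m^-1 * laplacian W x * ((i == j)%:R - x 0 i * x 0 j)) ^+ 2
   + (m - 1) / (2 * W x) * (dQ (W x) * (gradsq W x - W x ^+ 2)).
Proof.
move=> sx; have Ox := punctured_sphere sx.
have w0 : W x != 0 by rewrite gt_eqF // W0.
pose B i j := 'D_(e i) ('D_(e j) W) x.
have Bsym i j : B i j = B j i by exact: derive2_sym.
have xB j : \sum_i x 0 i * B i j = 0 by exact: euler2.
pose y i := \sum_j B i j * 'D_(e j) W x.
have sxx : \sum_i x 0 i * x 0 i = 1 by exact/sphereE.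
have sDD : \sum_i 'D_(e i) W x * 'D_(e i) W x = gradsq W x.
  by apply: eq_bigr => i _; rewrite expr2.
have sxD := euler1 hW homW Ox.
set P := \sum_i 'D_(e i) W x * y i.
set Z := \sum_i 'D_(e i) (laplacian W) x * 'D_(e i) W x.
have sxy : \sum_i x 0 i * y i = 0.
  under eq_bigr do rewrite mulr_sumr; rewrite exchange_big big1 //= => j _.
  under eq_bigr do rewrite mulrA; by rewrite -mulr_suml xB mul0r.
have sZ : \sum_i \sum_j 'D_(e i) ('D_(e i) ('D_(e j) W)) x * 'D_(e j) W x = Z.
  rewrite exchange_big /=; apply: eq_bigr => j _.
  by rewrite -mulr_suml (derive_laplacian hW).
have stx : \sum_i 'D_(e i) (laplacian W) x * x 0 i = - laplacian W x.
  by rewrite -(euler3 hW homW Ox); apply: eq_bigr => i _; rewrite mulrC.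
have sBB : \sum_i B i i = laplacian W x by [].
have YE i : Y (e i) x = y i - m^-1 * laplacian W x * ('D_(e i) W x - W x * x 0 i).
  by rewrite /Y (sx : eucl x = 1) invr1 expr1n mulr1 dot_delta.
have dkE i : 'D_(e i) k x = (W x)^-1 * (y i - m^-1 * laplacian W x * ('D_(e i) W x - W x * x 0 i)).
  case: (is_derive_k (e i) Ox) => _ ->.
  by rewrite /dk YE (sx : eucl x = 1) mul1r.
have d2kE i : 'D_(e i) ('D_(e i) k) x = (x 0 i * (W x)^-1 - (W x)^-1 ^+ 2 * 'D_(e i) W x)
     * (y i - m^-1 * laplacian W x * ('D_(e i) W x - W x * x 0 i))
   + (W x)^-1 * ((\sum_j 'D_(e i) ('D_(e i) ('D_(e j) W)) x * 'D_(e j) W x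
       + \sum_j B i j ^+ 2)
      - m^-1 * ('D_(e i) (laplacian W) x * ('D_(e i) W x - W x * x 0 i)
        + laplacian W x * (B i i - 'D_(e i) W x * x 0 i - W x
              + 2 * W x * x 0 i ^+ 2))).
  have eii : dot (e i) (e i) = 1 by rewrite dot_delta mxE !eqxx.
  by rewrite (derive2_k (e i) sx) YE dot_delta eii mulr1 big_split.
rewrite (eq_bigr _ (fun i _ => d2kE i)).
rewrite [X in _ - _ * X = _](eq_bigr _ (fun i _ => congr1 ( *%R _) (dkE i))).
rewrite (@sum_algebra n%:R _ _ (gradsq W x) P Z (\sum_i \sum_j B i j ^+ 2)) //.
have sP : \sum_i 'D_(e i) W x * 'D_(e i) (laplacian W) x * W x =
    m * P - laplacian W x * gradsq W x + m / 2 * dQ (W x) * (gradsq W x - W x ^+ 2).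
  transitivity (\sum_i (m * ('D_(e i) W x * y i) + (- laplacian W x) * ('D_(e i) W x * 'D_(e i) W x)
      + (m / 2 * dQ (W x)) * ('D_(e i) W x * 'D_(e i) W x) + (- (m / 2 * dQ (W x)) * W x) * (x 0 i * 'D_(e i) W x))).
    apply: eq_bigr => i _; have := derive_laplacian_eqn (e i) sx; rewrite dot_delta -/(y i).
    have alg (D t w mu Y' T q X : R) : w * t = mu * Y' - T * D + q * (D - w * X) ->
      D * t * w = mu * (D * Y') + - T * (D * D) + q * (D * D) + (- q * w) * (X * D).
      by move=> H; have -> : D * t * w = D * (w * t) by [ring]; rewrite H; ring.
    exact: alg.
  rewrite !big_split /= -!mulr_sumr sDD sxD -/P.
  have alg (p l g q w : R) : m * p + - l * g + m / 2 * q * g + - (m / 2 * q) * w * w =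
    m * p - l * g + m / 2 * q * (g - w ^+ 2) by field.
  exact: alg.
have sZ2 : W x * Z = m * P - laplacian W x * gradsq W x + m / 2 * dQ (W x) * (gradsq W x - W x ^+ 2).
  by rewrite -sP mulr_sumr; apply: eq_bigr => i _; rewrite mulrC ['D_(e i) (laplacian W) x * _]mulrC.
have sA := traceless_norm (m^-1 * laplacian W x) Bsym xB sxx.
rewrite sA nm.
have alg (w z T P' E q B2 : R) : w != 0 -> w * z = m * P' - T * E + m / 2 * q * (E - w ^+ 2) ->
  B2 - T ^+ 2 / m + (m - 1) / m * (z + T * w) - (m - 1) / w * (P' - T / m * (E - w ^+ 2))
   + (m + 1 - m - 1) * (T / m * w) =
  B2 - 2 * (m^-1 * T) * T + (m^-1 * T) ^+ 2 * (m + 1 - 1) + (m - 1) / (2 * w) * (q * (E - w ^+ 2)).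
  move=> w1 H; have -> : z = (w * z) / w by field.
  by rewrite H; field; rewrite m0 w1.
exact: alg.
Qed.

Lemma tangential_gradsq x : sphere x ->
  \sum_i ('D_(e i) W x - W x * x 0 i) ^+ 2 = gradsq W x - W x ^+ 2.
Proof.
move=> sx; have Ox := punctured_sphere sx.
have sxx : \sum_i x 0 i * x 0 i = 1 by exact/sphereE.
transitivity (\sum_i ('D_(e i) W x ^+ 2 + (- 2 * W x) * (x 0 i * 'D_(e i) W x)
   + (W x ^+ 2) * (x 0 i * x 0 i))).
  apply: eq_bigr => i _.
  have alg (d w y : R) : (d - w * y) ^+ 2 = d ^+ 2 + (- 2 * w) * (y * d) + w ^+ 2 * (y * y) by ring.
  exact: alg.
rewrite 2!big_split /= -2!mulr_sumr sxx (euler1 hW homW Ox) -/(gradsq W x).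
have alg (g w : R) : g + - 2 * w * w + w ^+ 2 * 1 = g - w ^+ 2 by ring.
exact: alg.
Qed.

Lemma sum_sqr_eq0 (J : finType) (h : J -> R) :
  \sum_j h j ^+ 2 = 0 -> forall j, h j = 0.
Proof.
move=> /eqP; rewrite psumr_eq0 => [/allP H j|j _]; last exact: sqr_ge0.
by have := H j; rewrite mem_index_enum => /(_ isT) /implyP /(_ isT); rewrite sqrf_eq0 => /eqP.
Qed.

Lemma traceless_hessian_eq0 x : sphere x ->
  (forall i j, 'D_(e i) ('D_(e j) W) x = m^-1 * laplacian W x * ((i == j)%:R - x 0 i * x 0 j))
  /\ dQ (W x) * (gradsq W x - W x ^+ 2) = 0.
Proof.
move=> sx; have Ox := punctured_sphere sx.
have W0' y : O y -> W y != 0 by move=> Oy; rewrite gt_eqF // W0.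
have n2 : (2 <= n)%N := ltnW n3.
have m21 : 0 < m - 1 by apply: lt_le_trans (ltr01) _; rewrite lerBrDr.
have rhs0 y : sphere y ->
    0 <= \sum_i \sum_j ('D_(e i) ('D_(e j) W) y - m^-1 * laplacian W y * ((i == j)%:R - y 0 i * y 0 j)) ^+ 2
    /\ 0 <= (m - 1) / (2 * W y) * (dQ (W y) * (gradsq W y - W y ^+ 2)).
  move=> sy; have Oy := punctured_sphere sy; split.
    by apply: sumr_ge0 => i _; apply: sumr_ge0 => j _; exact: sqr_ge0.
  apply: mulr_ge0; first by apply: divr_ge0; apply: ltW => //; rewrite mulr_gt0 // W0.
  apply: mulr_ge0.
    by have := dQ0 Oy; rewrite /wd (sy : eucl y = 1) invr1 mulr1.
  by rewrite -tangential_gradsq //; apply: sumr_ge0 => i _; exact: sqr_ge0.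
(* Drift of the operator obtained by dividing [laplacian_k] by [W]; it is bounded because the sphere
   is compact. *)
pose b y : 'rV[R]_n := \row_i (- (m - 2) * (W y)^-1 * 'D_(e i) W y).
have [M hM] : exists M, forall y, sphere y -> dot (b y) (b y) <= M.
  have cW1 : Ck O 0 (fun y => (W y)^-1) by apply: (CkV oO W0'); exact: Ck_le (leq0n 3) hW.
  have cg : Ck O 0 (fun y => dot (b y) (b y)).
    apply: (Ck_sum oO) => i _.
    have c1 : Ck O 0 (fun y => - (m - 2) * (W y)^-1 * 'D_(e i) W y).
      by apply: (CkM oO (CkZ oO _ cW1)); apply: Ck_le (leq0n 2) _; exact: Ck_derive.
    by apply: Ck_eq (CkM oO c1 c1) => // y _; rewrite !mxE.
  have [||y yS ymax] := EVT_max_rV (f := fun y => dot (b y) (b y)) _ (@sphere_compact R n).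
  - by exists x.
  - apply: continuous_in_subspaceT => y /set_mem /punctured_sphere Oy.
    exact: Ck_continuous cg Oy.
  - by exists (dot (b y) (b y)) => z sz; apply: ymax; exact/mem_set.
have sumb y : \sum_i b y 0 i * 'D_(e i) k y =
    - (W y)^-1 * ((m - 2) * \sum_i 'D_(e i) W y * 'D_(e i) k y).
  rewrite !mulr_sumr; apply: eq_bigr => i _; rewrite mxE.
  have alg (p q r s : R) : - p * q * r * s = - q * (p * (r * s)) by ring.
  exact: alg.
have [|c kc] := strong_maximum_principle n2 Ck_k k_dilation hM.
  move=> y sy; have Oy := punctured_sphere sy; rewrite sumb -(pmulr_rge0 _ (W0 Oy)).
  rewrite mulrDr [W y * (- _ * _)]mulrA mulrN mulfV ?W0' // mulN1r laplacian_k //.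
  by have [h1 h2] := rhs0 y sy; apply: addr_ge0.
have dk0 y v : O y -> 'D_v k y = 0.
  by move=> Oy; rewrite (derive_open v oO Oy kc) derive_cst.
have d2k0 v : 'D_v ('D_v k) x = 0.
  by rewrite (derive_open v oO Ox (fun y Oy => dk0 y v Oy)) derive_cst.
have := laplacian_k sx.
rewrite (big1 _ _ _ (fun i _ => d2k0 (e i))) mulr0 sub0r.
rewrite big1 => [|i _]; last by rewrite dk0 ?mulr0.
rewrite mulr0 oppr0 => /esym/eqP.
have [h1 h2] := rhs0 x sx; rewrite paddr_eq0 // => /andP[/eqP E1 /eqP E2]; split.
  move=> i j; apply/eqP; rewrite -subr_eq0; apply/eqP.
  move: E1 => /eqP; rewrite psumr_eq0 => [/allP H|k' _]; last first.
    by apply: sumr_ge0 => j' _; exact: sqr_ge0.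
  have := H i; rewrite mem_index_enum => /(_ isT) /implyP /(_ isT) /eqP /sum_sqr_eq0.
  exact.
apply/eqP; move/eqP: E2; rewrite mulf_eq0 => /orP[|//].
by rewrite mulf_eq0 (gt_eqF m21) /= invr_eq0 mulf_eq0 pnatr_eq0 /= (negbTE (W0' x Ox)).
Qed.

(** When A = 0 the Hessian on the sphere is (lap W / m) (I - x x^T), the Hessian of a multiple of
    |x|. After subtraction of this multiple the gradient is constant. The second conclusion is the
    surviving term in Q', with the tangential gradient computed from [be]. *)
Theorem rigidity : exists (a : R) (be : 'rV[R]_n),
  (forall x, O x -> W x = a * eucl x + dot x be) /\
  (forall x, sphere x -> dQ (W x) * (dot be be - dot x be ^+ 2) = 0).
Proof.
have n2 : (2 <= n)%N := ltnW n3.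
have cW1 : Ck O 1 W := Ck_le (isT : (1 <= 3)%N) hW.
have deg0 (f : 'rV[R]_n -> R) : Ck O 1 f -> (forall a x, 0 < a -> O x -> f (a *: x) = f x) ->
    (forall x i, sphere x -> 'D_(e i) f x = 0) -> exists c, forall x, O x -> f x = c.
  move=> cf hf df; apply: punctured_gradient0_cst => // x i Ox.
  have s0 := eucl_gt0 Ox; have sx := sphere_normalize Ox.
  have := df _ i sx; rewrite (@derive_dilation _ _ f x (e i) (eucl x)^-1 1).
  - rewrite div1r invrK => /eqP; rewrite mulf_eq0 gt_eqF //= => /eqP; exact.
  - by rewrite invr_eq0 gt_eqF.
  - by [].
  - by move=> y Oy; rewrite mul1r hf // invr_gt0.
  - by case: (Ck_is_derive (e i) cf Ox).
(* For a |x| + b.x this constant is m a, which dictates [a] below. *)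
have [a0 ha] : exists c, forall x, O x -> eucl x * laplacian W x = c.
  apply: deg0 => [|a x a0' Ox|x i sx].
  - by apply: (CkM oO (Ck_eucl 1)); exact: Ck_laplacian.
  - rewrite euclZ (gtr0_norm a0') (laplacian_dilation hW homW a0' Ox).
    have alg (p q : R) : a * p * (a^-1 * q) = p * q by field; rewrite gt_eqF.
    exact: alg.
  have Ox := punctured_sphere sx.
  have [hB hq] := traceless_hessian_eq0 sx.
  have dT := Ck_is_derive (e i) (Ck_laplacian hW) Ox.
  apply: derive_val.
  apply: is_derive_eq (is_derive_mul (is_derive_eucl (e i) Ox) dT) _.
  rewrite (sx : eucl x = 1) dot_delta.
  (* Either [dQ] or the tangential gradient vanishes; both kill the last term of the differentiated
     equation. *)
  have hq1 : dQ (W x) * ('D_(e i) W x - W x * x 0 i) = 0.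
    move/eqP: hq; rewrite mulf_eq0 => /orP[/eqP ->|]; first by rewrite mul0r.
    by rewrite -tangential_gradsq // => /eqP /sum_sqr_eq0 ->; rewrite mulr0.
  have sB : \sum_j 'D_(e i) ('D_(e j) W) x * 'D_(e j) W x =
      m^-1 * laplacian W x * ('D_(e i) W x - x 0 i * W x).
    transitivity (\sum_j m^-1 * laplacian W x * (((i == j)%:R * 'D_(e j) W x) - x 0 i * (x 0 j * 'D_(e j) W x))).
      apply: eq_bigr => j _; rewrite hB.
      have alg (c d p q r : R) : c * (d - p * q) * r = c * (d * r - p * (q * r)) by ring.
      exact: alg.
    rewrite -mulr_sumr; congr (_ * _); rewrite sumrB -mulr_sumr (euler1 hW homW Ox); congr (_ - _).
    rewrite (bigD1 i) //= eqxx mul1r big1 ?addr0 // => j ji.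
    by rewrite eq_sym (negbTE ji) mul0r.
  have := derive_laplacian_eqn (e i) sx; rewrite dot_delta sB.
  have alg (w t T D q X : R) : w != 0 -> q * (D - w * X) = 0 ->
    w * t = m * (m^-1 * T * (D - X * w)) - T * D + m / 2 * q * (D - w * X) ->
    1 * t + T * (X / 1) = 0.
    move=> w0 h; rewrite -[m / 2 * q * _]mulrA h mulr0 addr0 => H.
    apply: (mulfI w0); rewrite mulrDr mul1r H; field.
    by rewrite m0.
  by apply: alg hq1; rewrite gt_eqF // W0.
pose a := a0 / m.
pose V x := W x - a * eucl x.
have cV : Ck O 3 V by apply: (CkB oO hW); apply: (CkZ oO); exact: Ck_eucl.
have dV v x : O x -> 'D_v V x = 'D_v W x - a * (dot x v / eucl x).
  move=> Ox; apply: derive_val.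
  have := is_derive_add (Ck_is_derive v hW Ox) (is_derive_opp
    (is_derive_mul (is_derive_const a x v) (is_derive_eucl v Ox))).
  by rewrite mulr0 addr0.
have homV c x : 0 < c -> O x -> V (c *: x) = c * V x.
  move=> c0 Ox; rewrite /V homW // euclZ gtr0_norm //.
  by rewrite mulrBr [a * _]mulrCA.
have dVcst j : exists c, forall x, O x -> 'D_(e j) V x = c.
  apply: deg0 => [|c x c0 Ox|x i sx].
  - by apply: CkW; exact: Ck_derive.
  - exact: (homogeneous_derive cV homV).
  have Ox := punctured_sphere sx.
  have [hB _] := traceless_hessian_eq0 sx.
  rewrite (derive_open (e i) oO Ox (fun y Oy => dV (e j) y Oy)); apply: derive_val.
  have dW2 := Ck_is_derive (e i) (Ck_derive (e j) hW) Ox.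
  have dS := is_derive_mul (is_derive_dotl (e j) x (e i))
    (is_derive_inv (eucl_neq0 Ox) (is_derive_eucl (e i) Ox)).
  apply: is_derive_eq (is_derive_add dW2 (is_derive_opp (is_derive_mul (is_derive_const a x (e i)) dS))) _.
  rewrite hB (sx : eucl x = 1) !dot_delta mxE eqxx [j == i]eq_sym /=.
  have -> : laplacian W x = a0 by rewrite -(ha x Ox) (sx : eucl x = 1) mul1r.
  rewrite /a !invr1 !mulr1 !mul1r mulr0 addr0; by field.
pose be : 'rV[R]_n := \row_j xget 0 [set c | forall x, O x -> 'D_(e j) V x = c].
have hbe x j : O x -> 'D_(e j) V x = be 0 j.
  move=> Ox; rewrite mxE; case: xgetP => [c -> /(_ x Ox) //|H].
  by have [c /(H c)] := dVcst j.
have [c hc] : exists c, forall x, O x -> V x - dot x be = c.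
  apply: (punctured_gradient0_cst n2).
    apply: (CkB oO); first exact: Ck_le (isT : (1 <= 3)%N) cV.
    exact: Ck_dotl.
  move=> x i Ox; apply: derive_val.
  apply: is_derive_eq (is_derive_add (Ck_is_derive (e i) cV Ox) (is_derive_opp (is_derive_dotl be x (e i)))) _.
  by rewrite hbe // dotC dot_delta subrr.
(* The constant is also of degree 1: compare [x] with [2 *: x]. *)
have c0 : c = 0.
  have [x sx] : @sphere R n !=set0.
    pose i0 : 'I_n := Ordinal (leq_trans (isT : (0 < 2)%N) n2).
    by exists (e i0); apply/sphereE; rewrite dot_delta mxE !eqxx.
  have Ox := punctured_sphere sx.
  have two0 : 0 < (2 : R) by [].
  have := hc _ (punctured_dilation two0 Ox).
  rewrite homV // dotZl -mulrBr (hc x Ox) => H; lra.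
exists a, be; split=> [x Ox|x sx].
  have := hc x Ox; rewrite c0 /V => H; lra.
have Ox := punctured_sphere sx.
have [_ <-] := traceless_hessian_eq0 sx; congr (_ * _).
rewrite -tangential_gradsq //.
have DW i : 'D_(e i) W x - W x * x 0 i = be 0 i - dot x be * x 0 i.
  have := hc x Ox; rewrite c0 => HV.
  have -> : W x = dot x be + a by move: HV; rewrite /V (sx : eucl x = 1) => H; lra.
  have := dV (e i) x Ox; rewrite hbe // (sx : eucl x = 1) dot_delta => H.
  have {H} -> : 'D_(e i) W x = be 0 i + a * (x 0 i / 1) by rewrite H subrK.
  by field.
under eq_bigr do rewrite DW.
transitivity (dot (be - dot x be *: x) (be - dot x be *: x)).
  move/sphereE: (sx) => sxx; rewrite dotBl !dotBr !dotZl !dotZr sxx [dot be x]dotC; ring.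
by apply: eq_bigr => i _; rewrite !mxE expr2.
Qed.

End Rigidity.

(** * Mean curvature of graphs in null cones *)

Section Frame.
Context {R : realType} {n : nat}.
Variable x : 'rV[R]_n.
Hypothesis sx : sphere x.
Local Notation E0 := (frame x).

Lemma frame_tangent : E0 *m x^T = 0.
Proof. by apply/sub_kermxP; rewrite eq_row_base. Qed.

Lemma frame_row_tangent i : row i E0 *m x^T = 0.
Proof. by rewrite -row_mul frame_tangent row0. Qed.

Lemma mulmx_tr_eq0 k l (M : 'M[R]_(k, l)) : M *m M^T = 0 -> M = 0.
Proof.
move=> H; apply/matrixP => i j; rewrite [RHS]mxE.
have := congr1 (fun A : 'M[R]_k => A i i) H; rewrite !mxE.
under eq_bigr do rewrite mxE -expr2.
by move/sum_sqr_eq0 => ->.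
Qed.

Lemma frame_gram_unit : E0 *m E0^T \in unitmx.
Proof.
rewrite -row_free_unit -kermx_eq0; apply/eqP.
set M := kermx (E0 *m E0^T); have H : M *m (E0 *m E0^T) = 0 by rewrite mulmx_ker.
have /mulmx_tr_eq0 H2 : (M *m E0) *m (M *m E0)^T = 0.
  by rewrite trmx_mul mulmxA -[M *m E0 *m _]mulmxA H mul0mx.
have /row_freeP[Q HQ] : row_free E0 by exact: row_base_free.
by rewrite -[M]mulmx1 -HQ mulmxA H2 mul0mx.
Qed.

Definition tangent_proj : 'M[R]_n := 1%:M - x^T *m x.

(** Both sides are the orthogonal projection onto the row space of the frame: with P = C E0 and E0 M
    = E0 one gets M = P M = C E0 M = P. It frees all traces from the arbitrary basis chosen in
    [frame]. *)
Lemma frame_proj : E0^T *m invmx (E0 *m E0^T) *m E0 = tangent_proj.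
Proof.
have xx : x *m x^T = 1%:M.
  by apply/matrixP => i j; rewrite !ord1 dot_mx mxE eqxx; exact/sphereE.
have /submxP[C HC] : (tangent_proj <= E0)%MS.
  rewrite /frame eq_row_base; apply/sub_kermxP.
  by rewrite /tangent_proj mulmxBl mul1mx -mulmxA xx mulmx1 subrr.
set M := E0^T *m _ *m E0.
have EM : E0 *m M = E0 by rewrite /M !mulmxA mulmxV ?mul1mx // frame_gram_unit.
have xE : x *m E0^T = 0 by apply: trmx_inj; rewrite trmx_mul trmxK frame_tangent trmx0.
have PM : tangent_proj *m M = M.
  by rewrite /tangent_proj mulmxBl mul1mx /M !mulmxA -[x^T *m x *m _]mulmxA xE mulmx0 !mul0mx subr0.
by rewrite -PM HC -mulmxA EM.
Qed.

Lemma tangent_proj_trace : \tr tangent_proj = n%:R - 1.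
Proof.
rewrite /tangent_proj raddfB /= mxtrace1; congr (_ - _).
rewrite mxtrace_mulC trace_mx11 dot_mx; exact/sphereE.
Qed.

Lemma tangent_proj_mul (u : 'rV[R]_n) : u *m x^T = 0 -> u *m tangent_proj = u.
Proof. by move=> ux; rewrite mulmxBr mulmx1 mulmxA ux mul0mx subr0. Qed.

End Frame.

(** Pythagoras for the normal part of [H0]: the rows of [D] span the tangent space, [J] inverts the
    induced metric, and [z] represents the pairing of [H0] with tangent vectors. *)
Lemma projected_norm {R : realType} {k n N : nat} (H0 : 'rV[R]_N) (G : 'M[R]_N)
    (D : 'M[R]_(k, N)) (E : 'M[R]_(k, n)) (J : 'M[R]_k) (z : 'rV[R]_n) :
  G^T = G -> J^T = J -> J *m (D *m G *m D^T) = 1%:M -> H0 *m G *m D^T = z *m E^T ->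
  (H0 - z *m E^T *m J *m D) *m G *m (H0 - z *m E^T *m J *m D)^T =
  H0 *m G *m H0^T - z *m E^T *m J *m E *m z^T.
Proof.
move=> Gsym Jt JJ HD.
have HD2 : D *m G *m H0^T = E *m z^T.
  by apply: trmx_inj; rewrite !trmx_mul !trmxK Gsym mulmxA HD.
rewrite linearB /= !trmx_mul trmxK Jt mulmxBl mulmxBl !mulmxBr !mulmxA HD.
have -> : z *m E^T *m J *m D *m G *m D^T *m J *m E *m z^T =
     z *m E^T *m (J *m (D *m G *m D^T)) *m J *m E *m z^T by rewrite !mulmxA.
rewrite JJ mulmx1 (_ : z *m E^T *m J *m D *m G *m H0^T = z *m E^T *m J *m E *m z^T).
  by rewrite opprB addrA subrK.
by rewrite -2!mulmxA (mulmxA D) HD2 !mulmxA.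
Qed.

(** * Mean curvature when the induced metric is [rho ^+ 2] times the round metric *)

Section MeanCurvature.
Context {R : realType} {n N N' : nat}.
Variables (g : 'rV[R]_N -> 'M[R]_N) (F : 'rV[R]_n -> 'rV[R]_N) (x : 'rV[R]_n).
Hypothesis sx : sphere x.
Local Notation E0 := (frame x).
Local Notation k := (\rank (kermx x^T)).
Local Notation G := (g (F x)).
Hypothesis Gsym : G^T = G.

Let D : 'M[R]_(k, N) := \matrix_i dmap F x (row i E0).
Let H0 : 'rV[R]_N :=
  \sum_i \sum_j (invmx (Defs.induced g F x)) i j *: hess_map g F x (row i E0) (row j E0).

Lemma induced_mx : Defs.induced g F x = D *m G *m D^T.
Proof.
apply/matrixP => i j; rewrite mxE /inner.
have -> : dmap F x (row i E0) = row i D by rewrite rowK.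
have -> : dmap F x (row j E0) = row j D by rewrite rowK.
rewrite (_ : (D *m G *m D^T) i j = row i (D *m G *m D^T) 0 j); last by rewrite [RHS]mxE.
rewrite !row_mul !mxE; apply: eq_bigr => a _; rewrite !mxE.
by congr (_ * _); apply: eq_bigr => b _; rewrite !mxE.
Qed.

Lemma normal_part_mx w : normal_part g F x w =
  w - w *m G *m D^T *m (invmx (Defs.induced g F x))^T *m D.
Proof.
congr (_ - _); rewrite [RHS]mulmx_sum_row; apply: eq_bigr => i _.
rewrite -scaler_suml rowK; congr (_ *: _); rewrite [RHS]mxE; apply: eq_bigr => j _.
rewrite mulrC [in RHS]mxE; congr (_ * _); last by rewrite mxE.
have -> : dmap F x (row j E0) = row j D by rewrite rowK.
by rewrite /inner !mxE; apply: eq_bigr => b _; rewrite !mxE.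
Qed.

Variables (rho : R).
Hypothesis rho0 : rho != 0.
Hypothesis hJ : forall u v, u *m x^T = 0 -> v *m x^T = 0 ->
  inner g (F x) (dmap F x u) (dmap F x v) = rho ^+ 2 * dot u v.

Lemma inv_induced : invmx (Defs.induced g F x) = rho ^- 2 *: invmx (E0 *m E0^T).
Proof.
have -> : Defs.induced g F x = rho ^+ 2 *: (E0 *m E0^T).
  apply/matrixP => i j; rewrite !mxE hJ ?frame_row_tangent //; congr (_ * _).
  by apply: eq_bigr => a _; rewrite !mxE.
have r2 : rho ^+ 2 != 0 by rewrite expf_neq0.
by rewrite invmxZ // unitmxZ ?unitfE // frame_gram_unit.
Qed.

Lemma inv_induced_sym : (invmx (Defs.induced g F x))^T = invmx (Defs.induced g F x).
Proof.
by rewrite trmx_inv induced_mx !trmx_mul trmxK Gsym mulmxA.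
Qed.

Lemma induced_unit : Defs.induced g F x \in unitmx.
Proof.
have -> : Defs.induced g F x = rho ^+ 2 *: (E0 *m E0^T).
  apply/matrixP => i j; rewrite !mxE hJ ?frame_row_tangent //; congr (_ * _).
  by apply: eq_bigr => a _; rewrite !mxE.
by rewrite unitmxZ ?unitfE ?expf_neq0 // frame_gram_unit.
Qed.

Lemma mean_curvatureE : mean_curvature g F x =
  H0 - H0 *m G *m D^T *m invmx (Defs.induced g F x) *m D.
Proof.
transitivity (\sum_i \sum_j (invmx (Defs.induced g F x)) i j *:
    (hess_map g F x (row i E0) (row j E0) *m
      (1%:M - G *m D^T *m invmx (Defs.induced g F x) *m D))).
  apply: eq_bigr => i _; apply: eq_bigr => j _; congr (_ *: _).
  by rewrite normal_part_mx inv_induced_sym mulmxBr mulmx1 !mulmxA.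
transitivity (H0 *m (1%:M - G *m D^T *m invmx (Defs.induced g F x) *m D)).
  rewrite /H0 mulmx_suml; apply: eq_bigr => i _; rewrite mulmx_suml.
  by apply: eq_bigr => j _; rewrite scalemxAl.
by rewrite mulmxBr mulmx1 !mulmxA.
Qed.

Lemma mean_curvature_norm (z : 'rV[R]_n) :
  (forall u, u *m x^T = 0 -> inner g (F x) H0 (dmap F x u) = dot z u) ->
  inner g (F x) (mean_curvature g F x) (mean_curvature g F x) =
  inner g (F x) H0 H0 - rho ^- 2 * (dot z z - dot z x ^+ 2).
Proof.
move=> hz.
have HD : H0 *m G *m D^T = z *m E0^T.
  apply/rowP => i; have := hz _ (frame_row_tangent i); rewrite /inner => H.
  transitivity ((H0 *m G *m (dmap F x (row i E0))^T) 0 0).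
    by rewrite !mxE; apply: eq_bigr => b _; rewrite !mxE.
  by rewrite H !mxE; apply: eq_bigr => b _; rewrite !mxE.
set J := invmx (Defs.induced g F x).
have JJ : J *m (D *m G *m D^T) = 1%:M by rewrite -induced_mx /J mulVmx // induced_unit.
have Jt : J^T = J := inv_induced_sym.
rewrite /inner mean_curvatureE -/J HD.
rewrite (projected_norm Gsym Jt JJ HD).
rewrite mxE [in X in _ + X]mxE; congr (_ - _).
rewrite /J inv_induced -scalemxAr -!scalemxAl mxE; congr (_ * _).
rewrite -[z *m E0^T *m _]mulmxA -[z *m _ *m E0]mulmxA (frame_proj sx).
rewrite mulmxBr mulmx1 mulmxBl mulmxA mxE dot_mx; congr (_ + _).
rewrite mxE -mulmxA mxE big_ord1 !dot_mx [dot x z]dotC expr2 //.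
Qed.

Lemma frame_sum (V : lmodType R) (h : 'I_k -> 'I_k -> V) :
  \sum_i \sum_j (invmx (Defs.induced g F x)) i j *: h i j =
  rho ^- 2 *: \sum_i \sum_j (invmx (E0 *m E0^T)) i j *: h i j.
Proof.
rewrite inv_induced scaler_sumr; apply: eq_bigr => i _; rewrite scaler_sumr.
by apply: eq_bigr => j _; rewrite mxE scalerA.
Qed.

End MeanCurvature.

(** * Traces over a tangent frame *)

Section FrameTrace.
Context {R : realType} {k n : nat} (E : 'M[R]_(k, n)) (Ga : 'M[R]_k).
Hypothesis Ga_sym : Ga^T = Ga.

Lemma trace_bilinear (S : 'M[R]_n) :
  \sum_i \sum_j Ga i j * (row i E *m S *m (row j E)^T) 0 0 = \tr (E^T *m Ga *m E *m S).
Proof.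
rewrite -!mulmxA mxtrace_mulC -!mulmxA.
transitivity (\tr (Ga *m (E *m S *m E^T)^T)).
  rewrite /mxtrace; apply: eq_bigr => i _; rewrite mxE; apply: eq_bigr => j _.
  congr (_ * _); rewrite [RHS]mxE.
  rewrite (_ : (E *m S *m E^T) i j = row i (E *m S *m E^T) 0 j); last by rewrite [RHS]mxE.
  by rewrite !row_mul !mxE; apply: eq_bigr => a _; rewrite !mxE.
by rewrite -mxtrace_tr trmx_mul trmxK Ga_sym mxtrace_mulC !mulmxA.
Qed.

Lemma trace_rank1 (d : 'rV[R]_n) :
  \sum_i \sum_j Ga i j *: (dot (row i E) d *: row j E) = d *m (E^T *m Ga *m E).
Proof.
rewrite !mulmxA [RHS]mulmx_sum_row exchange_big /=.
apply: eq_bigr => j _; rewrite [in RHS]mxE scaler_suml; apply: eq_bigr => i _.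
rewrite scalerA mulrC; congr ((_ * _) *: _).
by rewrite -dot_mx !mxE; apply: eq_bigr => b _; rewrite !mxE mulrC.
Qed.

Lemma trace_rank1_sym (d : 'rV[R]_n) :
  \sum_i \sum_j Ga i j *: (dot (row j E) d *: row i E) = d *m (E^T *m Ga *m E).
Proof.
rewrite -trace_rank1 exchange_big /=; apply: eq_bigr => j _; apply: eq_bigr => i _.
by rewrite -[in LHS]Ga_sym mxE.
Qed.

Lemma trace_dot : \sum_i \sum_j Ga i j * dot (row i E) (row j E) = \tr (E^T *m Ga *m E).
Proof.
rewrite -[E^T *m Ga *m E]mulmx1 -trace_bilinear.
by apply: eq_bigr => i _; apply: eq_bigr => j _; rewrite mulmx1 dot_mx.
Qed.

(* The trace of a second fundamental form of the shape found on a null cone: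
   S is the Hessian of the radius, d its gradient, L the null generator. *)
Lemma trace_cone_form N (S : 'M[R]_n) (d : 'rV[R]_n) (L X : 'rV[R]_N) (K : 'M[R]_(n, N)) (rho : R) :
  \sum_i \sum_j Ga i j *: ((row i E *m S *m (row j E)^T) 0 0 *: L
     + dot (row i E) d *: (row j E *m K) + dot (row j E) d *: (row i E *m K)
     - (rho * dot (row i E) (row j E)) *: X) =
  \tr (E^T *m Ga *m E *m S) *: L + 2 *: (d *m (E^T *m Ga *m E) *m K)
   - (rho * \tr (E^T *m Ga *m E)) *: X.
Proof.
rewrite -trace_bilinear -trace_dot scaler_suml mulr_sumr scaler_suml.
rewrite scaler_nat mulr2n -{1}trace_rank1 -trace_rank1_sym !mulmx_suml -!big_split -sumrB.
apply: eq_bigr => i _.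
rewrite scaler_suml mulr_sumr scaler_suml !mulmx_suml -!big_split -sumrB.
apply: eq_bigr => j _; rewrite /= -!scalemxAl !scalerBr !scalerDr !scalerA addrA.
by rewrite [rho * (Ga i j * _)]mulrCA.
Qed.

End FrameTrace.

(* J is the differential at F x of an isometric embedding Psi into a flat space
   with form B; without an embedding, J = 1%:M, Psi = 0 and kappa = 0. *)
Section ConeMeanCurvature.
Context {R : realType} {n N N' : nat}.
Variables (g : 'rV[R]_N -> 'M[R]_N) (F : 'rV[R]_n -> 'rV[R]_N) (x : 'rV[R]_n).
Hypothesis sx : sphere x.
Local Notation E0 := (frame x).
Local Notation G := (g (F x)).
Hypothesis Gsym : G^T = G.
Variables (B : 'M[R]_N') (Bsym : B^T = B) (J : 'M[R]_(N, N')) (Psi : 'rV[R]_N') (kappa rho : R).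
Hypothesis JBJ : J *m B *m J^T = G.
Hypothesis PsiJ : Psi *m B *m J^T = 0.
Hypothesis Psi2 : kappa ^+ 2 * (Psi *m B *m Psi^T) 0 0 = kappa.
Hypothesis rho0 : rho != 0.
Variables (S : 'M[R]_n) (d : 'rV[R]_n) (L X : 'rV[R]_N') (K : 'M[R]_(n, N')) (q : R).
Local Notation bf a b := ((a *m B *m b^T) 0 0).
Hypothesis LL : bf L L = 0.
Hypothesis LX : bf L X = 1.
Hypothesis XX : bf X X = q.
Hypothesis LK : forall u : 'rV[R]_n, u *m x^T = 0 -> bf L (u *m K) = 0.
Hypothesis XK : forall u : 'rV[R]_n, u *m x^T = 0 -> bf X (u *m K) = 0.
Hypothesis KK : forall u v : 'rV[R]_n, u *m x^T = 0 -> v *m x^T = 0 -> bf (u *m K) (v *m K) = dot u v.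
Hypothesis dx : d *m x^T = 0.
Hypothesis hd : forall u : 'rV[R]_n, u *m x^T = 0 -> dmap F x u *m J = dot u d *: L + rho *: (u *m K).
Hypothesis hh : forall u v : 'rV[R]_n, u *m x^T = 0 -> v *m x^T = 0 ->
  hess_map g F x u v *m J - (kappa * (rho ^+ 2 * dot u v)) *: Psi =
  (u *m S *m v^T) 0 0 *: L + dot u d *: (v *m K) + dot v d *: (u *m K) - (rho * dot u v) *: X.

Lemma bf_sym (a b : 'rV[R]_N') : bf a b = bf b a.
Proof.
have -> : b *m B *m a^T = (a *m B *m b^T)^T by rewrite !trmx_mul trmxK Bsym mulmxA.
by rewrite [RHS]mxE.
Qed.

Lemma bfDl (a b c : 'rV[R]_N') : bf (a + b) c = bf a c + bf b c.
Proof. by rewrite !mulmxDl mxE. Qed.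

Lemma bfZl (s : R) (a b : 'rV[R]_N') : bf (s *: a) b = s * bf a b.
Proof. by rewrite -!scalemxAl mxE. Qed.

Lemma bfDr (a b c : 'rV[R]_N') : bf c (a + b) = bf c a + bf c b.
Proof. by rewrite !(bf_sym c) bfDl. Qed.

Lemma bfZr (s : R) (a b : 'rV[R]_N') : bf b (s *: a) = s * bf b a.
Proof. by rewrite !(bf_sym b) bfZl. Qed.

(** The image of the traced Hessian is H1 + kappa m Psi, with H1 in the span of [L], [X] and the
    rows of [K]. It is orthogonal to [Psi], which fixes the pairing of [Psi] with H1 and produces -
    kappa m^2. In the coefficient of |d|^2, the 4 comes from the square of H1 and (n - 3)^2 from its
    tangential part. *)
Lemma cone_mean_curvature :
  inner g (F x) (mean_curvature g F x) (mean_curvature g F x) =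
  rho ^- 4 * (- 2 * (n%:R - 1) * rho * \tr (tangent_proj x *m S)
     + (4 - (n%:R - 3) ^+ 2) * dot d d + (n%:R - 1) ^+ 2 * rho ^+ 2 * q)
  - kappa * (n%:R - 1) ^+ 2.
Proof.
set m := n%:R - 1 : R.
have innerJ (a b : 'rV[R]_N) : inner g (F x) a b = bf (a *m J) (b *m J).
  by rewrite /inner -JBJ trmx_mul !mulmxA.
have Fuv (u v : 'rV[R]_n) : u *m x^T = 0 -> v *m x^T = 0 ->
    inner g (F x) (dmap F x u) (dmap F x v) = rho ^+ 2 * dot u v.
  move=> ux vx; rewrite innerJ !hd // !(bfDl, bfDr, bfZl, bfZr) LL (bf_sym (u *m K)) !LK // KK //.
  by ring.
set H0 := \sum_i \sum_j (invmx (Defs.induced g F x)) i j *: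
  hess_map g F x (row i E0) (row j E0).
have frs (V : lmodType R) (h : 'I_(\rank (kermx x^T)) -> 'I_(\rank (kermx x^T)) -> V) :=
  frame_sum rho0 Fuv h.
have Gas : (invmx (E0 *m E0^T))^T = invmx (E0 *m E0^T).
  by rewrite trmx_inv (trmx_mul E0) trmxK.
pose H1 := rho ^- 2 *: (\tr (tangent_proj x *m S) *: L + 2 *: (d *m K) - (rho * m) *: X).
have EH : H0 *m J = H1 + (kappa * m) *: Psi.
  rewrite /H0 mulmx_suml.
  under eq_bigr => i _ do rewrite mulmx_suml.
  transitivity (\sum_i \sum_j (invmx (Defs.induced g F x)) i j *:
     (((row i E0 *m S *m (row j E0)^T) 0 0 *: L
     + dot (row i E0) d *: (row j E0 *m K) + dot (row j E0) d *: (row i E0 *m K)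
     - (rho * dot (row i E0) (row j E0)) *: X) + (kappa * (rho ^+ 2 * dot (row i E0) (row j E0))) *: Psi)).
    apply: eq_bigr => i _; apply: eq_bigr => j _; rewrite -scalemxAl -hh ?frame_row_tangent //.
    by rewrite subrK.
  rewrite frs.
  under eq_bigr => i _ do (under eq_bigr => j _ do rewrite scalerDr; rewrite big_split).
  rewrite big_split /= scalerDr (trace_cone_form _ Gas) (frame_proj sx) (tangent_proj_trace sx) -/m.
  rewrite (tangent_proj_mul dx); congr (_ + _).
  have -> : \sum_i \sum_j invmx (E0 *m E0^T) i j *:
      (kappa * (rho ^+ 2 * dot (row i E0) (row j E0)) *: Psi) =
      (kappa * rho ^+ 2 * \sum_i \sum_j invmx (E0 *m E0^T) i j * dot (row i E0) (row j E0)) *: Psi.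
    rewrite mulr_sumr scaler_suml; apply: eq_bigr => i _.
    rewrite mulr_sumr scaler_suml; apply: eq_bigr => j _.
    rewrite scalerA; congr (_ *: _); ring.
  rewrite (trace_dot _ Gas) (frame_proj sx) (tangent_proj_trace sx) -/m scalerA; congr (_ *: _).
  by field.
have PsiK (u : 'rV[R]_n) : u *m x^T = 0 -> bf Psi (dmap F x u *m J) = 0.
  by move=> ux; rewrite trmx_mul mulmxA PsiJ mul0mx mxE.
have PsiH0 : bf Psi (H0 *m J) = 0 by rewrite trmx_mul mulmxA PsiJ mul0mx mxE.
have H1L : bf H1 L = - rho^-1 * m.
  rewrite /H1 -scaleNr !(bfDl, bfZl) LL (bf_sym X) LX (bf_sym (d *m K)) LK //; by field.
have H1K (u : 'rV[R]_n) : u *m x^T = 0 -> bf H1 (u *m K) = rho ^- 2 * 2 * dot d u.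
  move=> ux; rewrite /H1 -scaleNr !(bfDl, bfZl) LK // XK // KK //; by ring.
have H11 : bf H1 H1 = rho ^- 4 * (- 2 * m * rho * \tr (tangent_proj x *m S)
   + 4 * dot d d + m ^+ 2 * rho ^+ 2 * q).
  have H1X : bf H1 X = rho ^- 2 * (\tr (tangent_proj x *m S) - rho * m * q).
    rewrite /H1 -scaleNr !(bfDl, bfZl) LX (bf_sym (d *m K)) XK // XX; by ring.
  rewrite {2}/H1 -scaleNr bfZr !bfDr !bfZr H1L H1K // H1X; by field.
(* This form of the hypothesis on [Psi] covers at once the square 1 / kappa and the case where
   [kappa] and [Psi] are 0. *)
have PsiH1 : kappa * (kappa * bf Psi Psi) = kappa by rewrite mulrA -expr2 Psi2.
have H1Psi : bf Psi H1 = - (kappa * m) * bf Psi Psi.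
  have -> : H1 = H0 *m J + (- (kappa * m)) *: Psi by rewrite EH scaleNr addrK.
  by rewrite bfDr bfZr PsiH0 add0r.
clearbody H1.
(* In the pairing with (u.d) L + rho u K, the vector [L] contributes - m / rho and [K] contributes 2
   / rho, and 2 - m = 3 - n. *)
rewrite (mean_curvature_norm sx Gsym rho0 Fuv (z := (rho^-1 * (3 - n%:R)) *: d)); last first.
  move=> u ux; rewrite -/H0 innerJ EH bfDl bfZl PsiK // mulr0 addr0.
  rewrite hd // bfDr !bfZr H1L H1K // dotZl [dot u d]dotC /m; by field.
rewrite -/H0 innerJ EH bfDl !bfZl -EH PsiH0 EH bfDr bfZr H11 (bf_sym H1) H1Psi.
have dx0 : dot d x = 0 by rewrite -dot_mx dx mxE.
rewrite !dotZl !dotZr dx0 !mulr0 expr0n subr0.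
have -> : kappa * m * (- (kappa * m) * bf Psi Psi) = - (m ^+ 2 * kappa).
  by rewrite -[in RHS]PsiH1; ring.
by rewrite /m; field.
Qed.

End ConeMeanCurvature.

(** * The static metric and its Christoffel symbols *)

Section Christoffel.
Context {R : realType}.

Lemma mx_entry N (M : 'M[R]_N) i j : ((delta_mx 0 i : 'rV[R]_N) *m M *m (delta_mx 0 j : 'rV[R]_N)^T) 0 0 = M i j.
Proof. by rewrite -rowE trmx_delta -colE !mxE. Qed.

Lemma lin_sum N (phi : 'rV[R]_N -> R) (u : 'rV[R]_N) :
  (forall s u v, phi (s *: u + v) = s * phi u + phi v) ->
  \sum_b u 0 b * phi (delta_mx 0 b) = phi u.
Proof.
move=> lin; have p0 : phi 0 = 0.
  by have := lin 1 0 0; rewrite scale1r addr0 mul1r => /eqP; rewrite -subr_eq0 opprD addrA subrr sub0r oppr_eq0 => /eqP.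
rewrite [u in RHS]row_sum_delta.
have H (r : seq 'I_N) : \sum_(b <- r) u 0 b * phi (delta_mx 0 b) =
   phi (\sum_(b <- r) u 0 b *: delta_mx 0 b).
  elim: r => [|b r IH]; first by rewrite !big_nil.
  by rewrite !big_cons lin IH.
exact: H.
Qed.

(** Koszul's formula: the contracted symbol is determined by its pairings with all vectors [Z], so a
    candidate [ga] is verified without inverting the metric. [T] is the trilinear extension of
    [dmetric]. *)
Lemma christoffel_contract N (g : 'rV[R]_N -> 'M[R]_N) (p u v ga : 'rV[R]_N)
    (T : 'rV[R]_N -> 'rV[R]_N -> 'rV[R]_N -> R) :
  (g p)^T = g p -> g p \in unitmx ->
  (forall b d c, dmetric g p b d c = T (delta_mx 0 b) (delta_mx 0 d) (delta_mx 0 c)) ->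
  (forall s u v a b, T (s *: u + v) a b = s * T u a b + T v a b) ->
  (forall s u v a b, T a (s *: u + v) b = s * T a u b + T a v b) ->
  (forall s u v a b, T a b (s *: u + v) = s * T a b u + T a b v) ->
  (forall Z, (ga *m g p *m Z^T) 0 0 = 2^-1 * (T u Z v + T v Z u - T Z u v)) ->
  \row_a \sum_b \sum_c christoffel g p a b c * u 0 b * v 0 c = ga.
Proof.
move=> gs gu HT l1 l2 l3 Hga.
apply/rowP => a; rewrite mxE.
have E d : \sum_b \sum_c (dmetric g p b d c + dmetric g p c d b - dmetric g p d b c) *
     (u 0 b * v 0 c) = 2 * (ga *m g p) 0 d.
  set e := delta_mx 0 d : 'rV[R]_N.
  have -> : (ga *m g p) 0 d = (ga *m g p *m e^T) 0 0.
    by rewrite trmx_delta -colE [RHS]mxE.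
  rewrite Hga mulrA mulfV ?mul1r ?pnatr_eq0 //.
  transitivity (\sum_b \sum_c (u 0 b * (v 0 c * T (delta_mx 0 b) e (delta_mx 0 c))
    + u 0 b * (v 0 c * T (delta_mx 0 c) e (delta_mx 0 b))
    - u 0 b * (v 0 c * T e (delta_mx 0 b) (delta_mx 0 c)))).
    apply: eq_bigr => b _; apply: eq_bigr => c _; rewrite !HT -/e.
    have alg (x1 x2 x3 x4 x5 : R) : (x1 + x2 - x3) * (x4 * x5) =
      x4 * (x5 * x1) + x4 * (x5 * x2) - x4 * (x5 * x3) by ring.
    exact: alg.
  under eq_bigr => b _ do rewrite sumrB big_split /= -!mulr_sumr.
  rewrite sumrB big_split /=; congr (_ + _ - _).
  - transitivity (\sum_b u 0 b * T (delta_mx 0 b) e v).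
      apply: eq_bigr => b _; rewrite (@lin_sum N (fun w => T (delta_mx 0 b) e w)) //.
    by rewrite (@lin_sum N (fun w => T w e v)).
  - transitivity (\sum_b u 0 b * T v e (delta_mx 0 b)).
      apply: eq_bigr => b _; rewrite (@lin_sum N (fun w => T w e (delta_mx 0 b))) //.
    by rewrite (@lin_sum N (fun w => T v e w)).
  - transitivity (\sum_b u 0 b * T e (delta_mx 0 b) v).
      apply: eq_bigr => b _; rewrite (@lin_sum N (fun w => T e (delta_mx 0 b) w)) //.
    by rewrite (@lin_sum N (fun w => T e w v)).
transitivity (\sum_d (invmx (g p)) a d * (ga *m g p) 0 d).
  transitivity (\sum_b \sum_c \sum_d (invmx (g p)) a d * (2^-1 *
     ((dmetric g p b d c + dmetric g p c d b - dmetric g p d b c) * (u 0 b * v 0 c)))).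
    apply: eq_bigr => b _; apply: eq_bigr => c _.
    rewrite /christoffel mulr_sumr !mulr_suml; apply: eq_bigr => d _; ring.
  under eq_bigr => b _ do rewrite exchange_big /=.
  rewrite exchange_big /=; apply: eq_bigr => d _.
  under eq_bigr => b _ do rewrite -mulr_sumr -mulr_sumr.
  by rewrite -!mulr_sumr E (mulrA 2^-1) mulVf ?mul1r ?pnatr_eq0.
have -> : ga 0 a = (ga *m g p *m invmx (g p)) 0 a by rewrite mulmxK.
rewrite [RHS]mxE; apply: eq_bigr => d _; rewrite mulrC; congr (_ * _).
by rewrite -[in RHS]gs -trmx_inv mxE.
Qed.

End Christoffel.

Section StaticMetric.
Context {R : realType} {n : nat}.
Implicit Types (a b c u v p q Z : 'rV[R]_(1 + n)) (y : 'rV[R]_n).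

Lemma tcoord_lin (s : R) u v : tcoord (s *: u + v) = s * tcoord u + tcoord v.
Proof. by rewrite /tcoord linearP !mxE. Qed.

Lemma ycoord_lin (s : R) u v : ycoord (s *: u + v) = s *: ycoord u + ycoord v.
Proof. by rewrite /ycoord linearP. Qed.

Lemma tcoordD u v : tcoord (u + v) = tcoord u + tcoord v.
Proof. by rewrite /tcoord linearD mxE. Qed.

Lemma tcoordZ (s : R) u : tcoord (s *: u) = s * tcoord u.
Proof. by rewrite /tcoord linearZ mxE. Qed.

Lemma tcoordN u : tcoord (- u) = - tcoord u.
Proof. by rewrite /tcoord linearN mxE. Qed.

Lemma ycoordD u v : ycoord (u + v) = ycoord u + ycoord v.
Proof. by rewrite /ycoord linearD. Qed.

Lemma ycoordZ (s : R) u : ycoord (s *: u) = s *: ycoord u.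
Proof. by rewrite /ycoord linearZ. Qed.

Lemma ycoordN u : ycoord (- u) = - ycoord u.
Proof. by rewrite /ycoord linearN. Qed.

Definition coordE := (tcoordD, tcoordZ, tcoordN, ycoordD, ycoordZ, ycoordN).

Lemma tcoord_event (t : R) y : tcoord (event t y) = t.
Proof. by rewrite /tcoord /event row_mxKl mxE eqxx. Qed.

Lemma ycoord_event (t : R) y : ycoord (event t y) = y.
Proof. by rewrite /ycoord /event row_mxKr. Qed.

Lemma event_coord p : event (tcoord p) (ycoord p) = p.
Proof. by rewrite /event /tcoord /ycoord -mx11_scalar hsubmxK. Qed.

Lemma eventP p q : tcoord p = tcoord q -> ycoord p = ycoord q -> p = q.
Proof. by move=> h1 h2; rewrite -[p]event_coord h1 h2 event_coord. Qed.

Lemma event_lin (s t1 t2 : R) y1 y2 :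
  s *: event t1 y1 + event t2 y2 = event (s * t1 + t2) (s *: y1 + y2).
Proof. by rewrite -[LHS]event_coord tcoord_lin ycoord_lin !tcoord_event !ycoord_event. Qed.

Lemma radius_event (t : R) y : Defs.radius (event t y) = eucl y.
Proof. by rewrite /Defs.radius ycoord_event. Qed.

(** Coefficient of (y.dy)^2 in the metric; division by zero makes it 0 at the centre. *)
Definition hcoef (f : R -> R) (r : R) : R := (f r ^- 2 - 1) / r ^+ 2.

Lemma inner_static (f : R -> R) p a b : inner (static_metric f) p a b =
  - f (Defs.radius p) ^+ 2 * tcoord a * tcoord b + dot (ycoord a) (ycoord b)
   + hcoef f (Defs.radius p) * dot (ycoord p) (ycoord a) * dot (ycoord p) (ycoord b).
Proof.
rewrite /inner /static_metric -[in LHS](event_coord a) -[in LHS](event_coord b) /event.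
rewrite mul_row_block !mulmx0 addr0 add0r tr_row_mx mul_row_col mxE -addrA; congr (_ + _).
  rewrite -scalar_mxM tr_scalar_mx -scalar_mxM [LHS]mxE eqxx mulr1n; ring.
rewrite mulmxDr mulmx1 mulmxDl mxE dot_mx -/(hcoef f (Defs.radius p)); congr (_ + _).
rewrite -scalemxAr -scalemxAl mxE -mulrA; congr (_ * _).
by rewrite mulmxA -(mulmxA (_ *m _)) (mx11_scalar (_ *m (ycoord p)^T)) mul_scalar_mx [LHS]mxE !dot_mx [dot (ycoord a) _]dotC.
Qed.

Lemma static_metric_sym (f : R -> R) p : (static_metric f p)^T = static_metric f p.
Proof.
rewrite /static_metric tr_block_mx !trmx0 tr_scalar_mx; congr block_mx.
by rewrite linearD /= tr_scalar_mx linearZ /= trmx_mul trmxK.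
Qed.

(** The inverse has the same shape with f replaced by 1 / f, since Y Y = r^2 Y. At the centre Y =
    0. *)
Lemma static_metric_unit (f : R -> R) p : f (Defs.radius p) != 0 ->
  static_metric f p \in unitmx.
Proof.
move=> f0; set r := Defs.radius p; set Y := (ycoord p)^T *m ycoord p.
have YY : Y *m Y = r ^+ 2 *: Y.
  rewrite /Y mulmxA -[(ycoord p)^T *m _ *m _]mulmxA.
  have -> : ycoord p *m (ycoord p)^T = (r ^+ 2)%:M.
    by apply/matrixP => i j; rewrite !ord1 dot_mx -eucl_sqr mxE eqxx mulr1n.
  by rewrite mul_mx_scalar -scalemxAl.
pose M : 'M[R]_(1 + n) := block_mx (- f r ^- 2)%:M 0 0 (1%:M + ((f r ^+ 2 - 1) / r ^+ 2) *: Y).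
suff : static_metric f p *m M = 1%:M by move/mulmx1_unit => [].
rewrite /static_metric -/r -/Y /M mulmx_block !mulmx0 !mul0mx !addr0 !add0r.
rewrite -scalar_mxM mulrNN mulfV ?expf_neq0 // [RHS]scalar_mx_block; congr block_mx.
rewrite mulmxDr mulmx1 mulmxDl mul1mx -scalemxAl -scalemxAr YY !scalerA -addrA -!scalerDl.
have [r0|r0] := eqVneq r 0.
  suff -> : Y = 0 by rewrite scaler0 addr0.
  rewrite /Y; suff -> : ycoord p = 0 by rewrite mulmx0.
  by apply/eqP; rewrite -dotxx_eq0 -eucl_sqr -/(Defs.radius p) -/r r0 expr0n.
rewrite [X in X *: Y](_ : _ = 0) ?scale0r ?addr0 //.
by field; rewrite r0 f0.
Qed.

End StaticMetric.

Section StaticChristoffel.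
Context {R : realType} {n : nat}.
Implicit Types (a b c u v p q Z : 'rV[R]_(1 + n)) (y : 'rV[R]_n).

Lemma is_derive_ycoord_dot p c y :
  is_derive p c (fun q => dot (ycoord q) y) (dot (ycoord c) y).
Proof.
apply: (is_derive_line0 _ _ _ _).2.
have -> : (fun h => dot (ycoord (h *: c + p)) y) =
  (fun h => (fun z => dot z y) (h *: ycoord c + ycoord p)).
  by apply/funext => h; rewrite ycoord_lin.
by apply: (is_derive_line0 (fun z => dot z y) _ _ _).1; exact: is_derive_dotl.
Qed.

Lemma is_derive_radius p c : ycoord p != 0 ->
  is_derive p c (@Defs.radius R n) (dot (ycoord p) (ycoord c) / Defs.radius p).
Proof.
move=> y0; apply: (is_derive_line0 _ _ _ _).2.
have -> : (fun h => Defs.radius (h *: c + p)) = (fun h => eucl (h *: ycoord c + ycoord p)).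
  by apply/funext => h; rewrite /Defs.radius ycoord_lin.
by apply: (is_derive_line0 (@eucl R n) _ _ _).1; exact: is_derive_eucl.
Qed.

Lemma radius_sqr p : Defs.radius p ^+ 2 = dot (ycoord p) (ycoord p).
Proof. exact: eucl_sqr. Qed.

Lemma radius_eq0 p : (Defs.radius p == 0) = (ycoord p == 0).
Proof. by rewrite -dotxx_eq0 -radius_sqr sqrf_eq0. Qed.

Lemma is_derive_hcoef (f : R -> R) r f1 : is_derive r (1 : R) f f1 -> f r != 0 -> r != 0 ->
  is_derive r (1 : R) (hcoef f) (- 2 * f1 / f r ^+ 3 / r ^+ 2 - 2 * hcoef f r / r).
Proof.
move=> df f0 r0.
have d1 := is_derive_pow 2 (is_derive_inv f0 df).
have d2 := is_derive_pow 2 (is_derive_inv r0 (is_derive_id r (1 : R))).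
have d3 := is_derive_mul (is_derive_add d1 (is_derive_const (- 1) r (1 : R))) d2.
have -> : hcoef f = fun z => ((f z)^-1 ^+ 2 + -1) * (z^-1 ^+ 2).
  by apply/funext => z; rewrite /hcoef !exprVn.
apply: is_derive_eq d3 _; rewrite /hcoef; field.
by rewrite r0 f0.
Qed.

(* The derivative in direction c of the (a, b) component of a metric
   -F(r) dt^2 + |dy|^2 + h(r) (y.dy)^2. *)
Definition cubic_form (A B C : R) p c a b : R :=
  A * dot (ycoord p) (ycoord c) * tcoord a * tcoord b
  + B * dot (ycoord p) (ycoord c) * dot (ycoord p) (ycoord a) * dot (ycoord p) (ycoord b)
  + C * (dot (ycoord c) (ycoord a) * dot (ycoord p) (ycoord b)
         + dot (ycoord p) (ycoord a) * dot (ycoord c) (ycoord b)).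

Lemma static_entry (f : R -> R) p (d c : 'I_(1 + n)) :
  static_metric f p d c = inner (static_metric f) p (delta_mx 0 d) (delta_mx 0 c).
Proof. by rewrite /inner mx_entry. Qed.

Lemma dmetric_static (f : R -> R) p f1 (b d c : 'I_(1 + n)) :
  ycoord p != 0 -> f (Defs.radius p) != 0 -> is_derive (Defs.radius p) (1 : R) f f1 ->
  dmetric (static_metric f) p b d c =
  cubic_form (- 2 * f (Defs.radius p) * f1 / Defs.radius p)
    ((- 2 * f1 / f (Defs.radius p) ^+ 3 / Defs.radius p ^+ 2
      - 2 * hcoef f (Defs.radius p) / Defs.radius p) / Defs.radius p)
    (hcoef f (Defs.radius p)) p (delta_mx 0 b) (delta_mx 0 d) (delta_mx 0 c).
Proof.
move=> y0 f0 df; have r0 : Defs.radius p != 0 by rewrite radius_eq0.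
rewrite /dmetric; move: (delta_mx 0 b) => e.
have -> : (fun q => static_metric f q d c : R) = (fun q =>
   - f (Defs.radius q) ^+ 2 * tcoord (delta_mx 0 d) * tcoord (delta_mx 0 c)
   + dot (ycoord (delta_mx 0 d)) (ycoord (delta_mx 0 c))
   + hcoef f (Defs.radius q) * dot (ycoord q) (ycoord (delta_mx 0 d)) *
       dot (ycoord q) (ycoord (delta_mx 0 c))).
  by apply/funext => q; rewrite static_entry inner_static.
move: (delta_mx 0 d) (delta_mx 0 c) => a b'; apply: derive_val.
have dr := is_derive_radius e y0.
have d1 := is_derive_opp (is_derive_pow 2 (is_derive_comp1 dr df)).
have d2 := is_derive_comp1 dr (is_derive_hcoef df f0 r0).
have d3 := is_derive_add (is_derive_add
   (is_derive_mul (is_derive_mul d1 (is_derive_const (tcoord a) p e)) (is_derive_const (tcoord b') p e))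
   (is_derive_const (dot (ycoord a) (ycoord b')) p e))
  (is_derive_mul (is_derive_mul d2 (is_derive_ycoord_dot p e (ycoord a))) (is_derive_ycoord_dot p e (ycoord b'))).
apply: is_derive_eq d3 _; rewrite /cubic_form /=.
by move: (hcoef f _) => h; field; rewrite r0 f0.
Qed.

(** By symmetry only a time and a radial component occur; the two equations are Koszul's formula
    tested against time and space vectors. [A], [B], [C] are left free to serve both a general [f]
    away from the centre and the space forms including it. *)
Lemma static_christoffel (f : R -> R) p a b A B C g0 g1 :
  f (Defs.radius p) != 0 ->
  (forall b d c : 'I_(1 + n), dmetric (static_metric f) p b d c =
     cubic_form A B C p (delta_mx 0 b) (delta_mx 0 d) (delta_mx 0 c)) ->
  - f (Defs.radius p) ^+ 2 * g0 = 2^-1 * A * (dot (ycoord p) (ycoord a) * tcoord b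
                                 + dot (ycoord p) (ycoord b) * tcoord a) ->
  g1 * (1 + hcoef f (Defs.radius p) * Defs.radius p ^+ 2) = - (2^-1 * A * tcoord a * tcoord b)
     + 2^-1 * B * dot (ycoord p) (ycoord a) * dot (ycoord p) (ycoord b)
     + C * dot (ycoord a) (ycoord b) ->
  \row_i \sum_j \sum_l christoffel (static_metric f) p i j l * a 0 j * b 0 l =
  event g0 (g1 *: ycoord p).
Proof.
move=> f0 HT E0 E1.
apply: (@christoffel_contract _ _ _ _ _ _ _ (cubic_form A B C p)) => //.
- exact: static_metric_sym.
- exact: static_metric_unit.
- by move=> s u1 v1 a1 b1; rewrite /cubic_form ycoord_lin !(dotDr, dotDl, dotZr, dotZl); ring.
- by move=> s u1 v1 a1 b1; rewrite /cubic_form tcoord_lin ycoord_lin !(dotDr, dotDl, dotZr, dotZl); ring.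
- by move=> s u1 v1 a1 b1; rewrite /cubic_form tcoord_lin ycoord_lin !(dotDr, dotDl, dotZr, dotZl); ring.
move=> Z; rewrite -/(inner (static_metric f) p _ _) inner_static tcoord_event ycoord_event.
rewrite dotZl dotZr -radius_sqr E0 /cubic_form.
rewrite [dot (ycoord Z) (ycoord b)]dotC [dot (ycoord Z) (ycoord a)]dotC.
rewrite [dot (ycoord b) (ycoord a)]dotC.
have alg (h r2 ya yb yZ a0 b0 Z0 ab aZ bZ : R) :
  g1 * (1 + h * r2) = - (2^-1 * A * a0 * b0) + 2^-1 * B * ya * yb + C * ab ->
  2^-1 * A * (ya * b0 + yb * a0) * Z0 + g1 * yZ + h * (g1 * r2) * yZ =
  2^-1 * (A * ya * Z0 * b0 + B * ya * yZ * yb + C * (aZ * yb + yZ * ab)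
    + (A * yb * Z0 * a0 + B * yb * yZ * ya + C * (bZ * ya + yZ * ab))
    - (A * yZ * a0 * b0 + B * yZ * ya * yb + C * (aZ * yb + ya * bZ))).
  move=> H; have -> : 2^-1 * A * (ya * b0 + yb * a0) * Z0 + g1 * yZ + h * (g1 * r2) * yZ =
    2^-1 * A * (ya * b0 + yb * a0) * Z0 + (g1 * (1 + h * r2)) * yZ by ring.
  by rewrite H; field.
exact: alg.
Qed.

(** [r] may be an endpoint of [J]: the two-sided derivative exists by assumption and can be computed
    along points of [J] alone. *)
Lemma derive_zero_on_interval (h : R -> R) (J : set R) r h1 : nondegenerate_interval J -> J r ->
  (forall t, J t -> h t = 0) -> is_derive r (1 : R) h h1 -> h1 = 0.
Proof.
move=> [iJ [a [b [Ja Jb ab]]]] Jr h0 [dh <-].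
apply/eqP; apply/negPn/negP => D0.
have [e Je re] : exists2 e, J e & e != r.
  have [E|] := eqVneq a r; last by exists a.
  by exists b => //; rewrite -E gt_eqF.
have [d /= d0 hd] : \forall t \near 0^', t^-1 *: ((h \o shift r) (t *: (1 : R)) - h r) != 0.
  apply: (cvgr_neq0 _ dh); exact: D0.
(* A step from [r] towards the other point [e] of [J], shorter than [d]. *)
pose t := Num.min (d / 2 / `|e - r|) 1 * (e - r).
have er0 : 0 < `|e - r| by rewrite normr_gt0 subr_eq0.
have th0 : 0 < Num.min (d / 2 / `|e - r|) 1 by rewrite lt_min ltr01 andbT !divr_gt0.
have th1 : Num.min (d / 2 / `|e - r|) 1 <= 1 by rewrite ge_min lexx orbT.
have := hd t; rewrite /= sub0r normrN => /(_ _ _)/eqP; apply.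
- rewrite /t normrM (gtr0_norm th0).
  apply: (@le_lt_trans _ _ (d / 2)); last by rewrite ltr_pdivrMr // ltr_pMr // ltr1n.
  by rewrite -ler_pdivlMr // ge_min lexx.
- by rewrite /t mulf_eq0 negb_or subr_eq0 re gt_eqF.
have Jt : J (t + r).
  have [le_er|lt_re] := leP e r.
    apply: (iJ e r) => //; apply/andP; split.
      have : Num.min (d / 2 / `|e - r|) 1 * (r - e) <= r - e by rewrite ler_piMl // subr_ge0.
      rewrite /t; lra.
    have : 0 <= Num.min (d / 2 / `|e - r|) 1 * (r - e) by rewrite mulr_ge0 ?subr_ge0 // ltW.
    rewrite /t; lra.
  apply: (iJ r e) => //; apply/andP; split.
    have : 0 <= Num.min (d / 2 / `|e - r|) 1 * (e - r) by rewrite mulr_ge0 ?subr_ge0 // ltW.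
    rewrite /t; lra.
  have : Num.min (d / 2 / `|e - r|) 1 * (e - r) <= e - r by rewrite ler_piMl // subr_ge0 ltW.
  rewrite /t; lra.
by rewrite [t *: _]mulr1 !h0 // subrr scaler0.
Qed.

End StaticChristoffel.

Section SmoothComponents.
Context {R : realType}.

Lemma smooth_on_derive {V W : normedModType R} (U : set V) (f : V -> W) v :
  smooth_on U f -> smooth_on U ('D_v f).
Proof.
move=> sf vs x Ux; have := sf (rcons vs v) x Ux.
by rewrite /iter_derive foldr_rcons.
Qed.

Lemma smooth_on_Ck {V : normedModType R} (U : set V) (f : V -> R) k :
  smooth_on U f -> Ck U k f.
Proof.
elim: k f => [|k IH] f sf; first by split=> // x Ux; have [] := sf [::] x Ux.
split; first by move=> x Ux; have [] := sf [::] x Ux.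
split=> [x v Ux|v]; first by have [_] := sf [::] x Ux; apply.
by apply: IH; exact: smooth_on_derive.
Qed.

Lemma smooth_on_coord_derive {V : normedModType R} {N : nat} (U : set V) (f : V -> 'rV[R]_N) x v i :
  smooth_on U f -> U x -> ('D_v f x) 0 i = 'D_v (fun y => f y 0 i) x.
Proof.
move=> sf Ux; have [_ /(_ v) d] := sf [::] x Ux.
by have /rowP/(_ i) := derive_mx d; rewrite mxE.
Qed.

Lemma smooth_on_coord {V : normedModType R} {N : nat} (U : set V) (f : V -> 'rV[R]_N) i k :
  open U -> smooth_on U f -> Ck U k (fun y => f y 0 i).
Proof.
move=> oU.
have cont (g : V -> 'rV[R]_N) x : smooth_on U g -> U x -> {for x, continuous (fun y => g y 0 i)}.
  move=> sg Ux; have [c _] := sg [::] x Ux.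
  exact: (@continuous_comp _ _ _ g (fun M : 'rV[R]_N => M 0 i) x c (@coord_continuous _ _ _ 0 i _)).
elim: k f => [|k IH] f sf; first by split=> // x; exact: cont.
split; first by move=> x; exact: cont.
split=> [x v Ux|v].
  by have [_ /(_ v) /derivable_mxP] := sf [::] x Ux.
have := IH _ (smooth_on_derive v sf); apply: Ck_eq => // x Ux.
exact: smooth_on_coord_derive sf Ux.
Qed.

Lemma smooth_on_coord_derive2 {V : normedModType R} {N : nat} (U : set V) (f : V -> 'rV[R]_N) x u v i :
  open U -> smooth_on U f -> U x ->
  ('D_u ('D_v f) x) 0 i = 'D_u ('D_v (fun y => f y 0 i)) x.
Proof.
move=> oU sf Ux; rewrite (smooth_on_coord_derive _ _ (smooth_on_derive v sf) Ux).
apply: (derive_open _ oU Ux) => y Uy; exact: smooth_on_coord_derive sf Uy.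
Qed.

End SmoothComponents.

(** * Christoffel symbols of the space forms, centre included *)

Section ModelChristoffel.
Context {R : realType} {n : nat}.
Variables (f : R -> R) (J : set R) (kappa : R) (p : 'rV[R]_(1 + n)) (f1 : R).
Hypothesis nJ : nondegenerate_interval J.
Hypothesis J0 : forall r, J r -> 0 <= r.
Hypothesis hJ : forall r, J r -> f r ^+ 2 = 1 - kappa * r ^+ 2.
Hypothesis Jp : J (Defs.radius p).
Hypothesis fJ : forall r, J r -> f r != 0.
Let f0 : f (Defs.radius p) != 0 := fJ Jp.
Hypothesis df : is_derive (Defs.radius p) (1 : R) f f1.

Lemma model_slope : f (Defs.radius p) * f1 = - kappa * Defs.radius p.
Proof.
have d1 := is_derive_add (is_derive_pow 2 df) (is_derive_opp (is_derive_add
  (is_derive_const (1 : R) (Defs.radius p) (1 : R))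
  (is_derive_opp (is_derive_mul (is_derive_const kappa _ _)
     (is_derive_pow 2 (is_derive_id (Defs.radius p) (1 : R))))))).
have : 2%:R * f (Defs.radius p) ^+ 1 * f1 - (0 - (kappa * (2%:R * Defs.radius p ^+ 1 * 1) + Defs.radius p ^+ 2 * 0)) = 0.
  apply: (derive_zero_on_interval nJ Jp _ d1) => t Jt.
  by rewrite hJ //= subrr.
rewrite !expr1 => H; lra.
Qed.

Lemma hcoef_model r : J r -> f r != 0 -> r != 0 -> hcoef f r = kappa / (1 - kappa * r ^+ 2).
Proof.
move=> Jr fr0 r0; have N0 : 1 - kappa * r ^+ 2 != 0 by rewrite -hJ // expf_neq0.
by rewrite /hcoef hJ //; field; rewrite r0 N0.
Qed.

(** At the centre the chain rule through the radius fails. There the entries are rewritten near [p]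
    as rational functions of r^2, which is a polynomial in the coordinates. *)
Lemma dmetric_model (b d c : 'I_(1 + n)) : dmetric (static_metric f) p b d c =
  cubic_form (2 * kappa) (2 * kappa ^+ 2 / f (Defs.radius p) ^+ 4) (kappa / f (Defs.radius p) ^+ 2)
   p (delta_mx 0 b) (delta_mx 0 d) (delta_mx 0 c).
Proof.
have [y0|y0] := eqVneq (ycoord p) 0; last first.
  have r0 : Defs.radius p != 0 by rewrite radius_eq0.
  rewrite (dmetric_static b d c y0 f0 df) hcoef_model // -?hJ //.
  have E1 : f1 = - kappa * Defs.radius p / f (Defs.radius p) by rewrite -model_slope; field.
  have Kp : kappa = (1 - f (Defs.radius p) ^+ 2) / Defs.radius p ^+ 2 by rewrite hJ //; field.
  rewrite E1; congr cubic_form; [by field; rewrite r0 f0|].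
  by rewrite Kp; field; rewrite r0 f0.
rewrite /dmetric /cubic_form y0 !dot0l !mulr0 !mul0r !addr0 mulr0.
move: (delta_mx 0 b) => e; set a := delta_mx 0 d : 'rV[R]_(1 + n); set a' := delta_mx 0 c : 'rV[R]_(1 + n).
have rp : Defs.radius p = 0 by apply/eqP; rewrite radius_eq0 y0.
(* Here 0 is the left end of [J], which is nondegenerate and so contains all radii close to 0. *)
have [de de0 hde] : exists2 de, 0 < de & forall r, 0 <= r < de -> J r.
  case: nJ => iJ [s [t [Js Jt st]]]; exists t; first by rewrite (le_lt_trans (J0 Js)).
  by move=> r /andP[r0 rt]; apply: (iJ _ _ Jp Jt); rewrite rp r0 ltW.
have near1 : \forall q \near p, J (Defs.radius q).
  have cr : {for p, continuous (fun q : 'rV[R]_(1 + n) => Defs.radius q ^+ 2)}.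
    apply: (@Ck_continuous _ _ setT 0) => //.
    apply: (Ck_eq openT (f := fun q : 'rV[R]_(1 + n) => \sum_(i < n) q 0 (rshift 1 i) ^+ 2)).
      move=> q _; rewrite radius_sqr; apply: eq_bigr => i _.
      by rewrite /ycoord mxE expr2.
    by apply: (Ck_sum openT) => i _; apply: (CkX openT); exact: Ck_coord openT.
  have de2 : 0 < de ^+ 2 by rewrite exprn_gt0.
  move/cvgrPdist_lt: cr => /(_ _ de2) /nbhs_ballP[d1 /= d10 hd1].
  apply/nbhs_ballP; exists d1 => // q /hd1 /=; rewrite rp expr0n sub0r normrN => H.
  apply: hde; rewrite sqrtr_ge0 /=.
  rewrite ger0_norm ?sqr_ge0 // in H.
  by move: H; rewrite ltr_pXn2r // ?nnegrE ?sqrtr_ge0 // ltW.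
pose N (q : 'rV[R]_(1 + n)) : R := 1 - kappa * Defs.radius q ^+ 2.
have -> : 'D_e (fun q => static_metric f q d c : R) p =
   'D_e (fun q => - N q * tcoord a * tcoord a' + dot (ycoord a) (ycoord a')
     + kappa * (N q)^-1 * dot (ycoord q) (ycoord a) * dot (ycoord q) (ycoord a')) p.
  apply: near_eq_derive; apply: filterS near1 => q Jq.
  rewrite static_entry inner_static -/a -/a' hJ // -/(N q); congr (_ + _).
  have [yq|yq] := eqVneq (ycoord q) 0; first by rewrite yq !dot0l !mulr0.
  by rewrite hcoef_model ?fJ ?radius_eq0.
have dr : is_derive p e (fun q => Defs.radius q ^+ 2) 0.
  have -> : (fun q => Defs.radius q ^+ 2) = (fun q : 'rV[R]_(1 + n) => \sum_i q 0 (rshift 1 i) ^+ 2).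
    apply/funext => q; rewrite radius_sqr; apply: eq_bigr => i _.
    by rewrite /ycoord mxE expr2.
  apply: is_derive_eq (@is_derive_bigsum _ _ _ _ _ (fun i (q : 'rV[R]_(1 + n)) => q 0 (rshift 1 i) ^+ 2)
     _ p e (fun i _ => is_derive_pow 2 (is_derive_coord (rshift 1 i) p e))) _.
  rewrite big1 // => i _; have /rowP/(_ i) := y0; rewrite /ycoord !mxE => ->.
  by rewrite expr1 mulr0 mul0r.
have N1 : N p = 1 by rewrite /N rp expr0n mulr0 subr0.
have N0 : N p != 0 by rewrite N1 oner_neq0.
have dN : is_derive p e N 0.
  have := is_derive_add (is_derive_const (1 : R) p e)
    (is_derive_opp (is_derive_mul (is_derive_const kappa p e) dr)).
  by rewrite !mulr0 addr0 oppr0 addr0.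
have d1 := is_derive_ycoord_dot p e (ycoord a).
have d2 := is_derive_ycoord_dot p e (ycoord a').
have d3 := is_derive_add (is_derive_add (is_derive_mul (is_derive_mul (is_derive_opp dN)
    (is_derive_const (tcoord a) p e)) (is_derive_const (tcoord a') p e))
   (is_derive_const (dot (ycoord a) (ycoord a')) p e))
  (is_derive_mul (is_derive_mul (is_derive_mul (is_derive_const kappa p e) (is_derive_inv N0 dN)) d1) d2).
apply: derive_val; apply: is_derive_eq d3 _.
by rewrite y0 !dot0l; ring.
Qed.

(** The space part kappa g(a, b) y is Gauss's formula: the y_i are restrictions of ambient linear
    functions to the quadric, and such functions have Hessian - kappa g y_i. *)
Lemma model_christoffel (a b : 'rV[R]_(1 + n)) :
  \row_i \sum_j \sum_l christoffel (static_metric f) p i j l * a 0 j * b 0 l =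
  event (- (kappa / f (Defs.radius p) ^+ 2 * (dot (ycoord p) (ycoord a) * tcoord b
           + dot (ycoord p) (ycoord b) * tcoord a)))
    ((kappa * inner (static_metric f) p a b) *: ycoord p).
Proof.
apply: (static_christoffel f0 dmetric_model); first by field.
rewrite inner_static.
have [y0|y0] := eqVneq (ycoord p) 0.
  have r0 : Defs.radius p = 0 by apply/eqP; rewrite radius_eq0 y0.
  rewrite y0 !dot0l r0 hJ -?r0 // r0 expr0n /= !mulr0 !subr0 addr0.
  by field.
have r0 : Defs.radius p != 0 by rewrite radius_eq0.
have Kp : kappa = (1 - f (Defs.radius p) ^+ 2) / Defs.radius p ^+ 2 by rewrite hJ //; field.
rewrite hcoef_model // -hJ // Kp.
by field; rewrite r0 f0.
Qed.

End ModelChristoffel.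

(** * Null cones of the static spacetime *)

Section ConeCalculus.
Context {R : realType} {n : nat}.
Implicit Types (x u v y : 'rV[R]_n).
Local Notation O := (@punctured R n).
Local Notation e i := (delta_mx 0 i : 'rV[R]_n).
Let oO := @open_punctured R n.
Variable W : 'rV[R]_n -> R.
Hypothesis hW : Ck O 3 W.
Hypothesis W0 : forall x, O x -> 0 < W x.
Hypothesis homW : forall a x, 0 < a -> O x -> W (a *: x) = a * W x.

(** [radial] and [position] extend with degree 0 the radius 1 / W and the Cartesian coordinates of
    the point x / W of the graph. *)
Definition radial y : R := eucl y * (W y)^-1.
Definition position i y : R := y 0 i * (W y)^-1.
Definition grad_mx x : 'rV[R]_n := \row_i 'D_(e i) W x.
Definition hess_mx x : 'M[R]_n := \matrix_(i, j) 'D_(e i) ('D_(e j) W) x.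
(** [radial_grad] is the tangential gradient of 1 / W on the sphere; [radial_hess] represents its
    Hessian on tangent vectors, the identity term coming from the factor |y| of the extension. *)
Definition radial_grad x : 'rV[R]_n := - (W x) ^- 2 *: (grad_mx x - W x *: x).
Definition radial_hess x : 'M[R]_n :=
  (W x)^-1 *: 1%:M - (W x) ^- 2 *: hess_mx x + (2 * (W x) ^- 3) *: ((grad_mx x)^T *m grad_mx x).

Lemma W_neq0 y : O y -> W y != 0.
Proof. by move=> Oy; rewrite gt_eqF // W0. Qed.

Lemma derive_grad_mx x u : O x -> 'D_u W x = dot u (grad_mx x).
Proof.
move=> Ox; rewrite (derive_coordE _ oO hW Ox).
by apply: eq_bigr => i _; rewrite mxE.
Qed.

Lemma derive_hess_mx x u v : O x -> 'D_u ('D_v W) x = (u *m hess_mx x *m v^T) 0 0.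
Proof.
move=> Ox.
have -> : 'D_u ('D_v W) x = \sum_j v 0 j * 'D_u ('D_(e j) W) x.
  rewrite (derive_open u oO Ox (fun y Oy => derive_coordE v oO hW Oy)).
  apply: derive_val; apply: is_derive_bigsum => j _.
  have := is_derive_mul (is_derive_const (v 0 j) x u) (Ck_is_derive u (Ck_derive (e j) hW) Ox).
  by rewrite mulr0 addr0.
rewrite [RHS]mxE; apply: eq_bigr => j _; rewrite [v^T _ _]mxE mulrC; congr (_ * _).
rewrite [RHS]mxE (derive_coordE _ oO (Ck_derive (e j) hW) Ox).
by apply: eq_bigr => i _; rewrite mxE.
Qed.

Lemma derive_radial y v : O y ->
  is_derive y v radial (eucl y * - ((W y)^-1 * (W y)^-1 * 'D_v W y) + (W y)^-1 * (dot y v / eucl y)).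
Proof.
move=> Oy; exact: is_derive_mul (is_derive_eucl v Oy) (is_derive_inv (W_neq0 Oy) (Ck_is_derive v hW Oy)).
Qed.

Lemma derive_position i y v : O y ->
  is_derive y v (position i) (y 0 i * - ((W y)^-1 * (W y)^-1 * 'D_v W y) + (W y)^-1 * v 0 i).
Proof.
move=> Oy; exact: is_derive_mul (is_derive_coord i y v) (is_derive_inv (W_neq0 Oy) (Ck_is_derive v hW Oy)).
Qed.

Lemma Ck_radial k : (k <= 3)%N -> Ck O k radial.
Proof.
move=> k3; apply: (CkM oO (Ck_eucl k)); apply: (CkV oO); first exact: W_neq0.
exact: Ck_le k3 hW.
Qed.

Section AtSphere.
Variable x : 'rV[R]_n.
Hypothesis sx : sphere x.
Let Ox : O x := punctured_sphere sx.
Let x1 : eucl x = 1 := sx.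

Lemma radial_sphere : radial x = (W x)^-1.
Proof. by rewrite /radial x1 mul1r. Qed.

Lemma radial_grad_tangent : radial_grad x *m x^T = 0.
Proof.
apply/matrixP => i j; rewrite !ord1 dot_mx mxE dotZl dotBl dotZl.
have -> : dot (grad_mx x) x = W x.
  by rewrite dotC -[RHS](euler1 hW homW Ox); apply: eq_bigr => k _; rewrite mxE.
by move/sphereE: (sx) => ->; rewrite mulr1 subrr mulr0.
Qed.

Lemma derive_radial_sphere u : u *m x^T = 0 -> 'D_u radial x = dot u (radial_grad x).
Proof.
move=> ux; have xu : dot x u = 0 by rewrite dotC -dot_mx ux mxE.
rewrite (@derive_val _ _ _ _ _ _ _ (derive_radial u Ox)) x1 xu (derive_grad_mx u Ox).
rewrite /radial_grad dotZr dotBr dotZr [dot u x]dotC xu.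
by rewrite invr1; field; exact: W_neq0.
Qed.

Lemma derive_position_sphere i u : u *m x^T = 0 ->
  'D_u (position i) x = dot u (radial_grad x) * x 0 i + (W x)^-1 * u 0 i.
Proof.
move=> ux; have xu : dot x u = 0 by rewrite dotC -dot_mx ux mxE.
rewrite (@derive_val _ _ _ _ _ _ _ (derive_position i u Ox)) (derive_grad_mx u Ox).
rewrite /radial_grad dotZr dotBr dotZr [dot u x]dotC xu.
by field; exact: W_neq0.
Qed.

Lemma radial_hess_form u v : (u *m radial_hess x *m v^T) 0 0 =
  (W x)^-1 * dot u v - (W x) ^- 2 * 'D_u ('D_v W) x + 2 * (W x) ^- 3 * ('D_u W x * 'D_v W x).
Proof.
have bl (M N : 'M[R]_n) : (u *m (M + N) *m v^T) 0 0 = (u *m M *m v^T) 0 0 + (u *m N *m v^T) 0 0.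
  by rewrite mulmxDr mulmxDl mxE.
have bz c (M : 'M[R]_n) : (u *m (c *: M) *m v^T) 0 0 = c * (u *m M *m v^T) 0 0.
  by rewrite -scalemxAr -scalemxAl mxE.
rewrite /radial_hess -scaleNr !bl !bz mulmx1 dot_mx (derive_hess_mx u v Ox) mulNr.
congr (_ + _ * _); rewrite mulmxA -(mulmxA (u *m _)).
rewrite (mx11_scalar (u *m _)) mul_scalar_mx [LHS]mxE !dot_mx !(derive_grad_mx _ Ox).
by rewrite [dot (grad_mx x) v]dotC.
Qed.

Lemma derive2_radial_sphere u v : u *m x^T = 0 -> v *m x^T = 0 ->
  'D_u ('D_v radial) x = (u *m radial_hess x *m v^T) 0 0.
Proof.
move=> ux vx; have xu : dot x u = 0 by rewrite dotC -dot_mx ux mxE.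
have xv : dot x v = 0 by rewrite dotC -dot_mx vx mxE.
rewrite (@derive_open _ _ _ O _ (fun y => eucl y * - ((W y)^-1 * (W y)^-1 * 'D_v W y) + (W y)^-1 * (dot y v * (eucl y)^-1)) x u oO Ox); last first.
  by move=> y Oy; case: (derive_radial v Oy).
have dI := is_derive_inv (W_neq0 Ox) (Ck_is_derive u hW Ox).
have dE := is_derive_eucl u Ox.
have d1 := is_derive_add (is_derive_mul dE (is_derive_opp (is_derive_mul (is_derive_mul dI dI)
   (Ck_is_derive u (Ck_derive v hW) Ox))))
  (is_derive_mul dI (is_derive_mul (is_derive_dotl v x u) (is_derive_inv (eucl_neq0 Ox) dE))).
apply: derive_val; apply: is_derive_eq d1 _.
rewrite radial_hess_form x1 xu xv invr1.
have alg (w wu wv wuv uv : R) : w != 0 ->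
  1 * - (w^-1 * w^-1 * wuv + wv * (w^-1 * - (w^-1 * w^-1 * wu) + w^-1 * - (w^-1 * w^-1 * wu)))
  + - (w^-1 * w^-1 * wv) * (0 / 1) + (w^-1 * (0 * - (1 * 1 * (0 / 1)) + 1 * uv)
   + 0 * 1 * - (w^-1 * w^-1 * wu)) = w^-1 * uv - w ^- 2 * wuv + 2 * w ^- 3 * (wu * wv).
  by move=> w0; field.
by have := W_neq0 Ox; rewrite invr1 in alg *; exact: alg.
Qed.

Lemma derive2_position_sphere i u v : u *m x^T = 0 -> v *m x^T = 0 ->
  'D_u ('D_v (position i)) x = (u *m radial_hess x *m v^T) 0 0 * x 0 i
   + dot u (radial_grad x) * v 0 i + dot v (radial_grad x) * u 0 i
   - (W x)^-1 * dot u v * x 0 i.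
Proof.
move=> ux vx.
rewrite (@derive_open _ _ _ O _ (fun y => y 0 i * - ((W y)^-1 * (W y)^-1 * 'D_v W y) + (W y)^-1 * v 0 i) x u oO Ox); last first.
  by move=> y Oy; case: (derive_position i v Oy).
have dI := is_derive_inv (W_neq0 Ox) (Ck_is_derive u hW Ox).
have d1 := is_derive_add (is_derive_mul (is_derive_coord i x u) (is_derive_opp (is_derive_mul (is_derive_mul dI dI)
   (Ck_is_derive u (Ck_derive v hW) Ox))))
  (is_derive_mul dI (is_derive_const (v 0 i) x u)).
apply: derive_val; apply: is_derive_eq d1 _.
rewrite radial_hess_form /radial_grad !dotZr !dotBr !dotZr -!(derive_grad_mx _ Ox).
have -> : dot u x = 0 by rewrite -dot_mx ux mxE.
have -> : dot v x = 0 by rewrite -dot_mx vx mxE.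
have alg (w wu wv wuv uv xi ui vi : R) : w != 0 ->
  xi * - (w^-1 * w^-1 * wuv + wv * (w^-1 * - (w^-1 * w^-1 * wu) + w^-1 * - (w^-1 * w^-1 * wu)))
  + - (w^-1 * w^-1 * wv) * ui + (w^-1 * 0 + vi * - (w^-1 * w^-1 * wu)) =
  (w^-1 * uv - w ^- 2 * wuv + 2 * w ^- 3 * (wu * wv)) * xi + - w ^- 2 * (wu - w * 0) * vi
   + - w ^- 2 * (wv - w * 0) * ui - w^-1 * uv * xi.
  by move=> w0; field.
exact: alg (W_neq0 Ox).
Qed.

Lemma grad_mx_sqr : dot (grad_mx x) (grad_mx x) = gradsq W x.
Proof. by apply: eq_bigr => i _; rewrite mxE expr2. Qed.

Lemma grad_mx_dot : dot (grad_mx x) x = W x.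
Proof.
by rewrite dotC -[RHS](euler1 hW homW Ox); apply: eq_bigr => k _; rewrite mxE.
Qed.

Lemma radial_grad_sqr : dot (radial_grad x) (radial_grad x) = (W x) ^- 4 * (gradsq W x - W x ^+ 2).
Proof.
rewrite /radial_grad dotZl dotZr dotBl !dotBr !dotZl !dotZr grad_mx_sqr [dot x _]dotC grad_mx_dot.
by move/sphereE: (sx) => ->; field; exact: W_neq0.
Qed.

Lemma radial_hess_trace : \tr (tangent_proj x *m radial_hess x) =
  (W x)^-1 * (n%:R - 1) - (W x) ^- 2 * laplacian W x + 2 * (W x) ^- 3 * (gradsq W x - W x ^+ 2).
Proof.
have tx (M : 'M[R]_n) : \tr (tangent_proj x *m M) = \tr M - (x *m M *m x^T) 0 0.
  rewrite /tangent_proj mulmxBl mul1mx linearB /=; congr (_ - _).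
  by rewrite -(mulmxA x^T) mxtrace_mulC [LHS]trace_mx11.
rewrite /radial_hess mulmxDr mulmxBr -!scalemxAr linearD linearB /= !mxtraceZ mulmx1.
rewrite (tangent_proj_trace sx); congr (_ - _ * _ + _ * _).
  rewrite tx -(derive_hess_mx x x Ox).
  have -> : 'D_x ('D_x W) x = 0.
    rewrite -(sum_derive_coord x (CkW (Ck_derive x hW)) Ox); exact: (euler2 hW homW).
  by rewrite subr0; apply: eq_bigr => i _; rewrite mxE.
rewrite tx; congr (_ - _).
  by rewrite mxtrace_mulC [LHS]trace_mx11 dot_mx grad_mx_sqr.
rewrite mulmxA -(mulmxA (x *m _)) (mx11_scalar (x *m _)) mul_scalar_mx [LHS]mxE !dot_mx.
by rewrite [dot x _]dotC grad_mx_dot expr2.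
Qed.

(** The reason for working with W instead of the radius: the gradient term of the Hessian of 1 / W
    combines with 4 - (n - 3)^2 and leaves the expression to which [rigidity] applies. *)
Lemma curvature_simplify (q kappa : R) :
  (W x)^-1 ^- 4 * (- 2 * (n%:R - 1) * (W x)^-1 * \tr (tangent_proj x *m radial_hess x)
     + (4 - (n%:R - 3) ^+ 2) * dot (radial_grad x) (radial_grad x)
     + (n%:R - 1) ^+ 2 * (W x)^-1 ^+ 2 * q) - kappa * (n%:R - 1) ^+ 2 =
  (n%:R - 1) * (2 * W x * laplacian W x - (n%:R - 1) *
    (gradsq W x - (q - 1) * W x ^+ 2 + kappa)).
Proof.
rewrite radial_hess_trace radial_grad_sqr.
have alg (w T E N : R) : w != 0 ->
  w^-1 ^- 4 * (- 2 * (N - 1) * w^-1 * (w^-1 * (N - 1) - w ^- 2 * T + 2 * w ^- 3 * (E - w ^+ 2))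
     + (4 - (N - 3) ^+ 2) * (w ^- 4 * (E - w ^+ 2))
     + (N - 1) ^+ 2 * w^-1 ^+ 2 * q) - kappa * (N - 1) ^+ 2 =
  (N - 1) * (2 * w * T - (N - 1) * (E - (q - 1) * w ^+ 2 + kappa)).
  by move=> w0; field.
exact: alg (W_neq0 Ox).
Qed.

End AtSphere.
End ConeCalculus.

Section EventDerivative.
Context {R : realType} {n : nat}.
Variable F : 'rV[R]_n -> 'rV[R]_(1 + n).
Hypothesis sF : smooth_sphere F.
Local Notation O := (@punctured R n).

Let tF y : R := tcoord (hext F y).
Let yF i y : R := ycoord (hext F y) 0 i.

Lemma tcoordE (p : 'rV[R]_(1 + n)) : tcoord p = p 0 (lshift n 0).
Proof. by rewrite /tcoord mxE. Qed.

Lemma ycoordE (p : 'rV[R]_(1 + n)) i : ycoord p 0 i = p 0 (rshift 1 i).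
Proof. by rewrite /ycoord mxE. Qed.

Lemma Ck_tcoord k : Ck O k tF.
Proof.
apply: (Ck_eq (@open_punctured R n)); last exact: smooth_on_coord (lshift n 0) k open_punctured sF.
by move=> y _; rewrite /tF tcoordE.
Qed.

Lemma Ck_ycoord i k : Ck O k (yF i).
Proof.
apply: (Ck_eq (@open_punctured R n)); last exact: smooth_on_coord (rshift 1 i) k open_punctured sF.
by move=> y _; rewrite /yF ycoordE.
Qed.

Lemma dmap_event x u : O x -> dmap F x u = event ('D_u tF x) (\row_i 'D_u (yF i) x).
Proof.
move=> Ox; rewrite -[LHS]event_coord; congr event.
  rewrite tcoordE (smooth_on_coord_derive _ _ sF Ox).
  have -> : (fun y => hext F y 0 (lshift n 0)) = tF by apply/funext => y; rewrite /tF tcoordE.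
  by [].
apply/rowP => i; rewrite ycoordE mxE (smooth_on_coord_derive _ _ sF Ox).
have -> : (fun y => hext F y 0 (rshift 1 i)) = yF i by apply/funext => y; rewrite /yF ycoordE.
by [].
Qed.

Lemma derive2_event x u v : O x -> 'D_u ('D_v (hext F)) x =
  event ('D_u ('D_v tF) x) (\row_i 'D_u ('D_v (yF i)) x).
Proof.
move=> Ox; rewrite -[LHS]event_coord; congr event.
  rewrite tcoordE (smooth_on_coord_derive2 _ _ _ open_punctured sF Ox).
  have -> : (fun y => hext F y 0 (lshift n 0)) = tF by apply/funext => y; rewrite /tF tcoordE.
  by [].
apply/rowP => i; rewrite ycoordE mxE (smooth_on_coord_derive2 _ _ _ open_punctured sF Ox).
have -> : (fun y => hext F y 0 (rshift 1 i)) = yF i by apply/funext => y; rewrite /yF ycoordE.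
by [].
Qed.

Lemma hext_sphere x : sphere x -> hext F x = F x.
Proof. by rewrite /hext /sphere /= => ->; rewrite invr1 scale1r. Qed.

End EventDerivative.

(** * The equation on the cones of the static spacetime *)

Section StaticConeEquation.
Context {R : realType} {n : nat}.
Variables (I : set R) (f : R -> R) (F : 'rV[R]_n -> 'rV[R]_(1 + n)) (s w0 : R)
  (rstar : R -> R) (W : 'rV[R]_n -> R).
Hypothesis ss : s * s = 1.
Hypothesis f0 : forall r, I r -> f r != 0.
Hypothesis df : forall r, I r -> derivable f r 1.
Hypothesis sF : smooth_sphere F.
Hypothesis hstar : forall r, I r -> is_derive r (1 : R) rstar (f r ^- 2).
Local Notation O := (@punctured R n).
Let oO := @open_punctured R n.
Hypothesis hW : Ck O 3 W.
Hypothesis W0 : forall x, O x -> 0 < W x.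
Hypothesis homW : forall a x, 0 < a -> O x -> W (a *: x) = a * W x.
Hypothesis hI : forall x, O x -> I (radial W x).
Hypothesis hY : forall x i, O x -> ycoord (hext F x) 0 i = position W i x.
Hypothesis hT : forall x, O x -> tcoord (hext F x) = w0 + s * rstar (radial W x).

Lemma derive_static_time x v : O x -> is_derive x v (fun y => tcoord (hext F y))
  (s * ((f (radial W x))^-1 ^+ 2 * 'D_v (radial W) x)).
Proof.
move=> Ox; have dr := Ck_is_derive v (Ck_radial hW W0 (isT : (1 <= 3)%N)) Ox.
have d1 := is_derive_add (is_derive_const w0 x v)
  (is_derive_mul (is_derive_const s x v) (is_derive_comp1 dr (hstar (hI Ox)))).
apply: (is_derive_open oO Ox (f := fun y => w0 + s * (rstar \o radial W) y)).
  by move=> y Oy; rewrite hT.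
by apply: is_derive_eq d1 _; rewrite exprVn mulr0 addr0 add0r.
Qed.

Lemma derive2_static_time x u v : O x -> 'D_u ('D_v (fun y => tcoord (hext F y))) x =
  s * ((f (radial W x)) ^- 2 * 'D_u ('D_v (radial W)) x
    - 2 * 'D_1 f (radial W x) * (f (radial W x)) ^- 3 * ('D_u (radial W) x * 'D_v (radial W) x)).
Proof.
move=> Ox; have r2 := Ck_radial hW W0 (isT : (2 <= 3)%N).
have dr := Ck_is_derive u r2 Ox.
have fr := f0 (hI Ox).
have dfr : is_derive x u (fun y => f (radial W y)) ('D_1 f (radial W x) * 'D_u (radial W) x).
  exact: is_derive_comp1 dr (derivableP (df (hI Ox))).
rewrite (@derive_open _ _ _ O _ (fun y => s * ((f (radial W y))^-1 ^+ 2 * 'D_v (radial W) y)) x u oO Ox); last first.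
  by move=> y Oy; case: (derive_static_time v Oy).
apply: derive_val.
have d1 := is_derive_mul (is_derive_const s x u)
  (is_derive_mul (is_derive_pow 2 (is_derive_inv fr dfr)) (Ck_is_derive u (Ck_derive v r2) Ox)).
apply: is_derive_eq d1 _.
have alg (a b c d' e : R) : a != 0 ->
  s * (a^-1 ^+ 2 * b + c * (2%:R * a^-1 ^+ 1 * - (a^-1 * a^-1 * (d' * e)))) + a^-1 ^+ 2 * c * 0
  = s * (a ^- 2 * b - 2 * d' * a ^- 3 * (e * c)).
  by move=> a0; field.
exact: alg.
Qed.

(** [cone_mean_curvature] is applied in the coordinates (t, y) themselves, with the static metric at
    [F x] as the form, no embedding and kappa = 0. *)
Lemma static_cone_mean_curvature x : sphere x ->
  inner (static_metric f) (F x) (mean_curvature (static_metric f) F x)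
    (mean_curvature (static_metric f) F x) =
  (n%:R - 1) * (2 * W x * laplacian W x - (n%:R - 1) *
    (gradsq W x - (f (W x)^-1 ^+ 2 - 1) * W x ^+ 2)).
Proof.
move=> sx; have Ox := punctured_sphere sx.
have w0' := W_neq0 W0 Ox; have rE := radial_sphere W sx.
set rho := (W x)^-1; have rho0 : rho != 0 by rewrite invr_eq0.
have rhop : 0 < rho by rewrite invr_gt0 W0.
have Ir : I rho by rewrite /rho -rE; exact: hI.
have fr := f0 Ir.
have sxx : dot x x = 1 by exact/sphereE.
have yx : ycoord (F x) = rho *: x.
  apply/rowP => i; rewrite -(hext_sphere F sx) hY // /position mxE mulrC.
  by [].
have rad : Defs.radius (F x) = rho.
  by rewrite /Defs.radius yx euclZ (sx : eucl x = 1) mulr1 gtr0_norm.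
pose d := radial_grad W x; pose S := radial_hess W x.
have Dm u : u *m x^T = 0 -> dmap F x u = event (s * (f rho ^- 2 * dot u d)) (dot u d *: x + rho *: u).
  move=> ux; rewrite (dmap_event sF u Ox); congr event.
    case: (derive_static_time u Ox) => _ ->.
    by rewrite (derive_radial_sphere hW W0 sx ux) rE exprVn.
  apply/rowP => i; rewrite [LHS]mxE.
  rewrite (@derive_open _ _ _ O _ (position W i) x u oO Ox (fun y Oy => hY i Oy)).
  by rewrite (derive_position_sphere hW W0 sx i ux) [RHS]mxE [X in _ = X + _]mxE [X in _ = _ + X]mxE.
have D2 u v : u *m x^T = 0 -> v *m x^T = 0 -> 'D_u ('D_v (hext F)) x =
   event (s * (f rho ^- 2 * (u *m S *m v^T) 0 0 - 2 * 'D_1 f rho * f rho ^- 3 * (dot u d * dot v d)))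
     (((u *m S *m v^T) 0 0 - rho * dot u v) *: x + dot u d *: v + dot v d *: u).
  move=> ux vx; rewrite (derive2_event sF u v Ox); congr event.
    rewrite (derive2_static_time u v Ox) rE (derive2_radial_sphere hW W0 sx ux vx).
    by rewrite (derive_radial_sphere hW W0 sx ux) (derive_radial_sphere hW W0 sx vx).
  apply/rowP => i; rewrite [LHS]mxE.
  have -> : 'D_u ('D_v (fun y => ycoord (hext F y) 0 i)) x = 'D_u ('D_v (position W i)) x.
    apply: (derive_open _ oO Ox) => y Oy.
    by apply: (derive_open _ oO Oy) => z Oz; exact: hY.
  rewrite (derive2_position_sphere hW W0 sx i ux vx) -/S -/d -/rho !mxE; ring.
have Bsym := static_metric_sym f (F x).
(* [L] is the null generator d_r + s f^-2 d_t; [X] is radial with <L, X> = 1 and <X, X> = f^2; [K]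
   includes the space vectors. *)
pose L : 'rV[R]_(1 + n) := event (s * f rho ^- 2) x.
pose X : 'rV[R]_(1 + n) := event 0 (f rho ^+ 2 *: x).
pose K : 'M[R]_(n, 1 + n) := row_mx 0 1%:M.
have uK (u : 'rV[R]_n) : u *m K = event 0 u.
  by rewrite /K mul_mx_row mulmx0 mulmx1 /event; congr row_mx; apply/matrixP => i j; rewrite !mxE mul0rn.
have bfE (a b : 'rV[R]_(1 + n)) : (a *m static_metric f (F x) *m b^T) 0 0 =
  - f rho ^+ 2 * tcoord a * tcoord b + dot (ycoord a) (ycoord b)
   + (f rho ^- 2 - 1) * dot x (ycoord a) * dot x (ycoord b).
  rewrite -[LHS]/(inner (static_metric f) (F x) a b) inner_static rad yx !dotZl /hcoef.
  by field; rewrite fr rho0.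
have ev := (@tcoord_event R n, @ycoord_event R n).
have tan (u : 'rV[R]_n) : u *m x^T = 0 -> dot x u = 0 by move=> ux; rewrite dotC -dot_mx ux mxE.
have := @cone_mean_curvature R n (1 + n) (1 + n) (static_metric f) F x sx Bsym
  (static_metric f (F x)) Bsym 1%:M 0 0 rho _ _ _ rho0 S d L X K (f rho ^+ 2).
rewrite (curvature_simplify hW W0 homW sx) addr0; apply.
- by rewrite trmx1 mul1mx mulmx1.
- by rewrite !mul0mx.
- by rewrite expr0n mul0r.
- rewrite bfE /L !ev sxx.
  have -> : - f rho ^+ 2 * (s * f rho ^- 2) * (s * f rho ^- 2) = - ((s * s) * f rho ^- 2) by field.
  by rewrite ss; ring.
- by rewrite bfE /L /X !ev !dotZr sxx; field.
- by rewrite bfE /X !ev !(dotZr, dotZl) sxx; field.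
- by move=> u ux; rewrite uK bfE /L !ev tan //; ring.
- by move=> u ux; rewrite uK bfE /X !ev !dotZl tan //; ring.
- by move=> u v ux vx; rewrite !uK bfE !ev !tan //; ring.
- have h := radial_grad_tangent hW homW sx; exact: h.
- move=> u ux; rewrite mulmx1 Dm // uK /L.
  by apply: eventP; rewrite !coordE !ev //; ring.
move=> u v ux vx.
rewrite mulmx1 scaler0 subr0.
(* The terms in f' cancel between the second derivative of r* and the Christoffel symbols: the
   generators are geodesics with affine parameter r. *)
have hess : hess_map (static_metric f) F x u v =
    event (s * (f rho ^- 2 * (u *m S *m v^T) 0 0))
     (((u *m S *m v^T) 0 0 - rho * f rho ^+ 2 * dot u v) *: x + dot u d *: v + dot v d *: u).
  pose h := hcoef f rho.
  have hE : h = (f rho ^- 2 - 1) / rho ^+ 2 by [].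
  have Ay (w : 'rV[R]_n) : w *m x^T = 0 -> dot (ycoord (F x)) (dot w d *: x + rho *: w) = rho * dot w d.
    by move=> wx; rewrite yx dotZl dotDr !dotZr sxx tan //; ring.
  have y0 : ycoord (F x) != 0 by rewrite -radius_eq0 rad.
  have dfr : is_derive (Defs.radius (F x)) (1 : R) f ('D_1 f rho).
    by rewrite rad; apply/derivableP; exact: df.
  have f0' : f (Defs.radius (F x)) != 0 by rewrite rad.
  rewrite /hess_map (static_christoffel (g0 := 2 * s * 'D_1 f rho * f rho ^- 3 * (dot u d * dot v d))
     (g1 := (1 - f rho ^+ 2) * dot u v) f0' (fun b d c => dmetric_static b d c y0 f0' dfr)).
  - rewrite (D2 u v ux vx) yx -[event _ _ in LHS]scale1r event_lin; congr event; first by ring.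
    rewrite scale1r scalerA; apply/rowP => i; rewrite !mxE; ring.
  - rewrite rad !Dm // !ev !Ay //; field.
    by rewrite fr rho0.
  rewrite rad !Dm // !ev !Ay //.
  have -> : dot (dot u d *: x + rho *: u) (dot v d *: x + rho *: v) = dot u d * dot v d + rho ^+ 2 * dot u v.
    by rewrite dotDl !dotDr !dotZl !dotZr sxx [dot u x]dotC !tan //; ring.
  have alg (du dv uv f1 : R) :
    (1 - f rho ^+ 2) * uv * (1 + hcoef f rho * rho ^+ 2) =
    - (2^-1 * (- 2 * f rho * f1 / rho) * (s * (f rho ^- 2 * du)) * (s * (f rho ^- 2 * dv)))
    + 2^-1 * ((- 2 * f1 / f rho ^+ 3 / rho ^+ 2 - 2 * hcoef f rho / rho) / rho) * (rho * du) * (rho * dv)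
    + hcoef f rho * (du * dv + rho ^+ 2 * uv).
    have -> : 2^-1 * (- 2 * f rho * f1 / rho) * (s * (f rho ^- 2 * du)) * (s * (f rho ^- 2 * dv)) =
      (s * s) * (2^-1 * (- 2 * f rho * f1 / rho) * (f rho ^- 2 * du) * (f rho ^- 2 * dv)) by ring.
    by rewrite ss -/h hE; field; rewrite fr rho0.
  exact: alg.
rewrite hess !uK /L /X; apply: eventP; rewrite !coordE !ev; first by ring.
by apply/rowP => i; rewrite !mxE; ring.
Qed.

End StaticConeEquation.

(** * Null cones of the space forms *)

Section AmbientCone.
Context {R : realType} {n N : nat}.
Local Notation O := (@punctured R n).
Let oO := @open_punctured R n.
Variables (W : 'rV[R]_n -> R) (c l : 'rV[R]_N) (K : 'M[R]_(n, N)).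
Hypothesis hW : Ck O 3 W.
Hypothesis W0 : forall x, O x -> 0 < W x.
Hypothesis homW : forall a x, 0 < a -> O x -> W (a *: x) = a * W x.

(** At a unit vector x it is c + (1 / W x) (l + x K): [c] is the vertex of a light cone and l + x K
    its generator in direction x. *)
Definition cone_point (y : 'rV[R]_n) : 'rV[R]_N :=
  c + radial W y *: l + (\row_i position W i y) *m K.

Variable chi : 'rV[R]_N -> R.
Hypothesis chi_lin : forall a u v, chi (a *: u + v) = a * chi u + chi v.

Let chi0 : chi 0 = 0.
Proof.
have := chi_lin 1 0 0; rewrite scale1r addr0 mul1r => /eqP.
by rewrite -subr_eq0 opprD addrA subrr sub0r oppr_eq0 => /eqP.
Qed.

Let chiD u v : chi (u + v) = chi u + chi v.
Proof. by rewrite -[u]scale1r chi_lin mul1r scale1r. Qed.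

Let chiZ a u : chi (a *: u) = a * chi u.
Proof. by rewrite -[a *: u]addr0 chi_lin chi0 addr0. Qed.

Let chi_mul (z : 'rV[R]_n) : chi (z *m K) = \sum_i z 0 i * chi (row i K).
Proof.
rewrite mulmx_sum_row.
have H (r : seq 'I_n) : chi (\sum_(b <- r) z 0 b *: row b K) = \sum_(b <- r) z 0 b * chi (row b K).
  by elim: r => [|b r IH]; rewrite ?big_nil ?chi0 // !big_cons chi_lin IH.
exact: H.
Qed.

Lemma derive_cone_point x v : O x -> is_derive x v (fun y => chi (cone_point y))
  ('D_v (radial W) x * chi l + \sum_i 'D_v (position W i) x * chi (row i K)).
Proof.
move=> Ox.
have -> : (fun y => chi (cone_point y)) =
   (fun y => chi c + radial W y * chi l + \sum_i position W i y * chi (row i K)).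
  apply/funext => y; rewrite /cone_point !chiD chiZ chi_mul; congr (_ + _).
  by apply: eq_bigr => i _; rewrite mxE.
have dr := derive_radial hW W0 v Ox.
have d1 := is_derive_add (is_derive_add (is_derive_const (chi c) x v)
  (is_derive_mul dr (is_derive_const (chi l) x v)))
  (@is_derive_bigsum _ _ _ (index_enum 'I_n) predT _ _ x v (fun i _ => is_derive_mul (derive_position hW W0 i v Ox)
     (is_derive_const (chi (row i K)) x v))).
apply: is_derive_eq d1 _.
rewrite (@derive_val _ _ _ _ _ _ _ dr) mulr0 !add0r mulrC; congr (_ + _).
apply: eq_bigr => i _; rewrite (@derive_val _ _ _ _ _ _ _ (derive_position hW W0 i v Ox)).
by rewrite mulr0 add0r mulrC.
Qed.

Lemma Ck_position i k : (k <= 3)%N -> Ck O k (position W i).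
Proof.
move=> k3; apply: (CkM oO (@Ck_coord _ _ O k i oO)).
apply: (CkV oO); first by move=> y Oy; rewrite gt_eqF // W0.
exact: Ck_le k3 hW.
Qed.

Variable x : 'rV[R]_n.
Hypothesis sx : sphere x.
Let Ox : O x := punctured_sphere sx.

Lemma derive_cone_point_sphere u : u *m x^T = 0 -> 'D_u (fun y => chi (cone_point y)) x =
  chi (dot u (radial_grad W x) *: (l + x *m K) + (W x)^-1 *: (u *m K)).
Proof.
move=> ux; rewrite (@derive_val _ _ _ _ _ _ _ (derive_cone_point u Ox)).
rewrite !(chiD, chiZ) !chi_mul (derive_radial_sphere hW W0 sx ux) mulrDr -addrA; congr (_ + _).
rewrite !mulr_sumr -big_split; apply: eq_bigr => i _.
by rewrite (derive_position_sphere hW W0 sx i ux) mulrDl !mulrA.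
Qed.

Lemma derive2_cone_point_sphere u v : u *m x^T = 0 -> v *m x^T = 0 ->
  'D_u ('D_v (fun y => chi (cone_point y))) x =
  chi ((u *m radial_hess W x *m v^T) 0 0 *: (l + x *m K) + dot u (radial_grad W x) *: (v *m K)
     + dot v (radial_grad W x) *: (u *m K) - ((W x)^-1 * dot u v) *: (x *m K)).
Proof.
move=> ux vx.
rewrite (@derive_open _ _ _ O _ (fun y => 'D_v (radial W) y * chi l + \sum_i 'D_v (position W i) y * chi (row i K)) x u oO Ox); last first.
  by move=> y Oy; case: (derive_cone_point v Oy).
have r2 := Ck_derive v (Ck_radial hW W0 (isT : (2 <= 3)%N)).
have d1 := is_derive_add (is_derive_mul (Ck_is_derive u r2 Ox) (is_derive_const (chi l) x u))
  (@is_derive_bigsum _ _ _ (index_enum 'I_n) predT _ _ x u (fun i _ => is_derive_mul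
     (Ck_is_derive u (Ck_derive v (Ck_position i (isT : (2 <= 3)%N))) Ox)
     (is_derive_const (chi (row i K)) x u))).
rewrite (@derive_val _ _ _ _ _ _ _ d1) -scaleNr !(chiD, chiZ) !chi_mul.
rewrite (derive2_radial_sphere hW W0 sx ux vx) mulr0 add0r mulrC mulrDr -!addrA; congr (_ + _).
under eq_bigr => i _ do rewrite mulr0 add0r (derive2_position_sphere hW W0 sx i ux vx).
move: (dot u v) (dot u (radial_grad W x)) (dot v (radial_grad W x)) => uv du dv.
rewrite !mulr_sumr -!big_split; apply: eq_bigr => i _ /=.
have alg (a b c0 k e1 e2 e3 p q : R) : k * (a * e1 + b * e2 + c0 * e3 - p * q * e1) =
  a * (e1 * k) + (b * (e2 * k) + (c0 * (e3 * k) + - (p * q) * (e1 * k))) by ring.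
exact: alg.
Qed.

End AmbientCone.

(** * The static patch as a quadric in a flat space *)

Section Quadric.
Context {R : realType} {n : nat}.
Variables (kappa eps : R) (e1 e2 d1 d2 : R -> R).
Hypothesis k0 : kappa != 0.
Hypothesis ee : forall t, - e1 t * e1 t + eps * e2 t * e2 t = kappa^-1.
Hypothesis ed : forall t, - e1 t * d1 t + eps * e2 t * d2 t = 0.
Hypothesis dd : forall t, - d1 t * d1 t + eps * d2 t * d2 t = -1.
Implicit Types (p a b Z : 'rV[R]_(1 + n)) (X Y : 'rV[R]_(1 + (1 + n))).

(** The sign [eps] treats R^{n,2} (-1) and R^{n+1,1} (1) together. *)
Definition quadric_form : 'M[R]_(1 + (1 + n)) :=
  block_mx (-1)%:M 0 0 (block_mx eps%:M 0 0 1%:M).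

Lemma quadric_formE X Y : (X *m quadric_form *m Y^T) 0 0 =
  - tcoord X * tcoord Y + eps * tcoord (ycoord X) * tcoord (ycoord Y)
  + dot (ycoord (ycoord X)) (ycoord (ycoord Y)).
Proof.
rewrite -[in LHS](event_coord X) -[in LHS](event_coord Y).
rewrite -[in LHS](event_coord (ycoord X)) -[in LHS](event_coord (ycoord Y)) /event /quadric_form.
rewrite mul_row_block !mulmx0 addr0 add0r tr_row_mx mul_row_col mxE -addrA; congr (_ + _).
  by rewrite -scalar_mxM tr_scalar_mx -scalar_mxM [LHS]mxE eqxx mulr1n; ring.
rewrite mul_row_block !mulmx0 addr0 add0r tr_row_mx mul_row_col mxE; congr (_ + _).
  by rewrite -scalar_mxM tr_scalar_mx -scalar_mxM [LHS]mxE eqxx mulr1n; ring.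
by rewrite mulmx1 dot_mx.
Qed.

Lemma quadric_form_sym : quadric_form^T = quadric_form.
Proof. by rewrite /quadric_form !tr_block_mx !trmx0 !tr_scalar_mx. Qed.

Definition quadric_emb p : 'rV[R]_(1 + (1 + n)) :=
  event (flin kappa (Defs.radius p) * e1 (tcoord p))
    (event (flin kappa (Defs.radius p) * e2 (tcoord p)) (ycoord p)).

(** The differential of [quadric_emb]; [sZ] is the derivative of the lapse along [Z], written so as
    to make sense at y = 0. *)
Definition quadric_diff p Z : 'rV[R]_(1 + (1 + n)) :=
  let s := flin kappa (Defs.radius p) in
  let sZ := - kappa * dot (ycoord p) (ycoord Z) / s in
  event (sZ * e1 (tcoord p) + s * tcoord Z * d1 (tcoord p))
    (event (sZ * e2 (tcoord p) + s * tcoord Z * d2 (tcoord p)) (ycoord Z)).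

Lemma quadric_diff_lin p (s : R) a b :
  quadric_diff p (s *: a + b) = s *: quadric_diff p a + quadric_diff p b.
Proof.
rewrite /quadric_diff; apply: eventP; rewrite !coordE !(tcoord_event, ycoord_event).
  by rewrite dotDr dotZr; ring.
apply: eventP; rewrite !coordE !(tcoord_event, ycoord_event) //.
by rewrite dotDr dotZr; ring.
Qed.

Variable p : 'rV[R]_(1 + n).
Hypothesis N0 : 0 < 1 - kappa * Defs.radius p ^+ 2.

Lemma flin_gt0 : 0 < flin kappa (Defs.radius p).
Proof. by rewrite sqrtr_gt0. Qed.

Lemma flin_sqr : flin kappa (Defs.radius p) ^+ 2 = 1 - kappa * Defs.radius p ^+ 2.
Proof. by rewrite sqr_sqrtr // ltW. Qed.

Lemma quadric_emb_emb :
  (quadric_emb p *m quadric_form *m (quadric_emb p)^T) 0 0 = kappa^-1.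
Proof.
rewrite quadric_formE /quadric_emb !(tcoord_event, ycoord_event) -radius_sqr.
set s := flin _ _; set t := tcoord p.
have -> : - (s * e1 t) * (s * e1 t) + eps * (s * e2 t) * (s * e2 t) =
  s ^+ 2 * (- e1 t * e1 t + eps * e2 t * e2 t) by ring.
by rewrite ee /s flin_sqr; field.
Qed.

Lemma quadric_emb_diff Z :
  (quadric_emb p *m quadric_form *m (quadric_diff p Z)^T) 0 0 = 0.
Proof.
rewrite quadric_formE /quadric_emb /quadric_diff !(tcoord_event, ycoord_event).
have := flin_gt0; set s := flin _ _; set t := tcoord p => s0.
have s1 : s != 0 by rewrite gt_eqF.
have -> : - (s * e1 t) * (- kappa * dot (ycoord p) (ycoord Z) / s * e1 t + s * tcoord Z * d1 t) +
  eps * (s * e2 t) * (- kappa * dot (ycoord p) (ycoord Z) / s * e2 t + s * tcoord Z * d2 t) =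
  - kappa * dot (ycoord p) (ycoord Z) * (- e1 t * e1 t + eps * e2 t * e2 t)
  + s ^+ 2 * tcoord Z * (- e1 t * d1 t + eps * e2 t * d2 t) by field.
by rewrite ee ed; field.
Qed.

Lemma quadric_diff_diff a b :
  (quadric_diff p a *m quadric_form *m (quadric_diff p b)^T) 0 0 =
  - flin kappa (Defs.radius p) ^+ 2 * tcoord a * tcoord b + dot (ycoord a) (ycoord b)
  + kappa / flin kappa (Defs.radius p) ^+ 2 * dot (ycoord p) (ycoord a) * dot (ycoord p) (ycoord b).
Proof.
rewrite quadric_formE /quadric_diff !(tcoord_event, ycoord_event).
have := flin_gt0; set s := flin _ _; set t := tcoord p => s0.
have s1 : s != 0 by rewrite gt_eqF.
move: (dot (ycoord p) (ycoord a)) (dot (ycoord p) (ycoord b)) (dot (ycoord a) (ycoord b)) => ya yb ab.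
have -> : - (- kappa * ya / s * e1 t + s * tcoord a * d1 t) * (- kappa * yb / s * e1 t + s * tcoord b * d1 t) +
  eps * (- kappa * ya / s * e2 t + s * tcoord a * d2 t) * (- kappa * yb / s * e2 t + s * tcoord b * d2 t) =
  kappa ^+ 2 * ya * yb / s ^+ 2 * (- e1 t * e1 t + eps * e2 t * e2 t)
  - kappa * (ya * tcoord b + yb * tcoord a) * (- e1 t * d1 t + eps * e2 t * d2 t)
  + s ^+ 2 * tcoord a * tcoord b * (- d1 t * d1 t + eps * d2 t * d2 t) by field.
rewrite ee ed dd; field.
by rewrite k0 s1.
Qed.

End Quadric.

Section MovedConeEquation.
Context {R : realType} {n N : nat}.
Variables (F : 'rV[R]_n -> 'rV[R]_(1 + n)) (f : R -> R).
Variables (W : 'rV[R]_n -> R) (c l : 'rV[R]_N) (K : 'M[R]_(n, N)) (B : 'M[R]_N).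
Local Notation O := (@punctured R n).
Let oO := @open_punctured R n.
Hypothesis hW : Ck O 3 W.
Hypothesis W0 : forall x, O x -> 0 < W x.
Hypothesis homW : forall a x, 0 < a -> O x -> W (a *: x) = a * W x.
Hypothesis Bsym : B^T = B.
Hypothesis ll : (l *m B *m l^T) 0 0 = -1.
Hypothesis lK : forall u : 'rV[R]_n, (l *m B *m (u *m K)^T) 0 0 = 0.
Hypothesis KK : forall u v : 'rV[R]_n, ((u *m K) *m B *m (v *m K)^T) 0 0 = dot u v.
Variables (x : 'rV[R]_n) (J : 'M[R]_(1 + n, N)) (Psi : 'rV[R]_N) (kappa : R).
Hypothesis sx : sphere x.
Hypothesis JBJ : J *m B *m J^T = static_metric f (F x).
Hypothesis PsiJ : Psi *m B *m J^T = 0.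
Hypothesis Psi2 : kappa ^+ 2 * (Psi *m B *m Psi^T) 0 0 = kappa.
Hypothesis d1 : forall u, u *m x^T = 0 ->
  dmap F x u *m J = \row_i 'D_u (fun y => cone_point W c l K y 0 i) x.
Hypothesis d2 : forall u v, u *m x^T = 0 -> v *m x^T = 0 ->
  hess_map (static_metric f) F x u v *m J
    - (kappa * inner (static_metric f) (F x) (dmap F x u) (dmap F x v)) *: Psi =
  \row_i 'D_u ('D_v (fun y => cone_point W c l K y 0 i)) x.

(** The last hypothesis is the Gauss formula of the embedding: the flat second derivative is the
    pushed Hessian minus kappa g Psi. With L = l + x K and X = x K one has <X, X> = 1, so no term in
    W^2 survives and Q is constant. *)
Lemma moved_cone_mean_curvature :
  inner (static_metric f) (F x) (mean_curvature (static_metric f) F x)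
    (mean_curvature (static_metric f) F x) =
  (n%:R - 1) * (2 * W x * laplacian W x - (n%:R - 1) * (gradsq W x + kappa)).
Proof.
have Ox := punctured_sphere sx.
have rho0 : (W x)^-1 != 0 by rewrite invr_eq0 W_neq0.
have sxx : dot x x = 1 by exact/sphereE.
have coord_lin i (a : R) (u v : 'rV[R]_N) : (a *: u + v) 0 i = a * u 0 i + v 0 i by rewrite !mxE.
have D1 u : u *m x^T = 0 ->
    dmap F x u *m J = dot u (radial_grad W x) *: (l + x *m K) + (W x)^-1 *: (u *m K).
  move=> ux; rewrite d1 //; apply/rowP => i; rewrite [LHS]mxE.
  exact: (derive_cone_point_sphere c l K hW W0 (coord_lin i) sx ux).
have D2 u v : u *m x^T = 0 -> v *m x^T = 0 ->
    hess_map (static_metric f) F x u v *m J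
    - (kappa * inner (static_metric f) (F x) (dmap F x u) (dmap F x v)) *: Psi =
  (u *m radial_hess W x *m v^T) 0 0 *: (l + x *m K) + dot u (radial_grad W x) *: (v *m K)
     + dot v (radial_grad W x) *: (u *m K) - ((W x)^-1 * dot u v) *: (x *m K).
  move=> ux vx; rewrite d2 //; apply/rowP => i; rewrite [LHS]mxE.
  exact: (derive2_cone_point_sphere c l K hW W0 (coord_lin i) sx ux vx).
have tan (u : 'rV[R]_n) : u *m x^T = 0 -> dot x u = 0 by move=> ux; rewrite dotC -dot_mx ux mxE.
have bDl := @bfDl R N B; have bDr := @bfDr R N B Bsym.
have bZl := @bfZl R N B; have bZr := @bfZr R N B Bsym.
have LL : ((l + x *m K) *m B *m (l + x *m K)^T) 0 0 = 0.
  by rewrite !(bDl, bDr) ll (bf_sym Bsym (x *m K)) !lK KK sxx; ring.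
have LX : ((l + x *m K) *m B *m (x *m K)^T) 0 0 = 1.
  by rewrite !(bDl, bDr) lK KK sxx; ring.
have LK (u : 'rV[R]_n) : u *m x^T = 0 -> ((l + x *m K) *m B *m (u *m K)^T) 0 0 = 0.
  by move=> ux; rewrite !(bDl, bDr) lK KK tan // addr0.
have := @cone_mean_curvature R n (1 + n) N (static_metric f) F x sx (static_metric_sym f (F x))
  B Bsym J Psi kappa _ JBJ PsiJ Psi2 rho0 (radial_hess W x) (radial_grad W x) (l + x *m K) (x *m K) K 1.
rewrite (curvature_simplify hW W0 homW sx) subrr mul0r subr0; apply.
- exact: LL.
- exact: LX.
- by rewrite KK.
- exact: LK.
- by move=> u ux; rewrite KK tan.
- by move=> u v _ _; exact: KK.
- exact: (radial_grad_tangent hW homW sx).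
- exact: D1.
move=> u v ux vx; rewrite -D2 //; congr (_ - (_ * _) *: _).
have -> : inner (static_metric f) (F x) (dmap F x u) (dmap F x v) =
    ((dmap F x u *m J) *m B *m (dmap F x v *m J)^T) 0 0.
  by rewrite /inner -JBJ trmx_mul !mulmxA.
have KL : ((u *m K) *m B *m (l + x *m K)^T) 0 0 = 0 by rewrite (bf_sym Bsym) LK.
rewrite !D1 //; move: LL (LK _ vx) KL; move: (l + x *m K) => L LL Lv Lu.
rewrite !bDl !bZl !bDr !bZr LL Lv Lu KK.
by move: (dot u v) (dot _ _) (dot _ _) => uv du dv; ring.
Qed.

End MovedConeEquation.

Section QuadricConeEquation.
Context {R : realType} {n : nat}.
Variables (kappa eps : R) (e1 e2 d1 d2 : R -> R).
Hypothesis k0 : kappa != 0.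
Hypothesis ee : forall t, - e1 t * e1 t + eps * e2 t * e2 t = kappa^-1.
Hypothesis ed : forall t, - e1 t * d1 t + eps * e2 t * d2 t = 0.
Hypothesis dd : forall t, - d1 t * d1 t + eps * d2 t * d2 t = -1.
Hypothesis de1 : forall t, is_derive t (1 : R) e1 (d1 t).
Hypothesis de2 : forall t, is_derive t (1 : R) e2 (d2 t).
Hypothesis dd1 : forall t, is_derive t (1 : R) d1 (kappa * e1 t).
Hypothesis dd2 : forall t, is_derive t (1 : R) d2 (kappa * e2 t).
Variables (F : 'rV[R]_n -> 'rV[R]_(1 + n)) (f : R -> R) (J : set R).
Hypothesis nJ : nondegenerate_interval J.
Hypothesis J0 : forall r, J r -> 0 <= r.
Hypothesis hJ : forall r, J r -> f r ^+ 2 = 1 - kappa * r ^+ 2.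
Hypothesis fJ : forall r, J r -> 0 < f r.
Hypothesis df : forall r, J r -> derivable f r 1.
Hypothesis sF : smooth_sphere F.
Local Notation O := (@punctured R n).
Let oO := @open_punctured R n.
Hypothesis FJ : forall y, O y -> J (Defs.radius (hext F y)).
Variables (W : 'rV[R]_n -> R) (c l : 'rV[R]_(1 + (1 + n))) (K : 'M[R]_(n, 1 + (1 + n))).
Hypothesis hW : Ck O 3 W.
Hypothesis W0 : forall x, O x -> 0 < W x.
Hypothesis homW : forall a x, 0 < a -> O x -> W (a *: x) = a * W x.
Local Notation B := (quadric_form (n := n) eps).
Hypothesis ll : (l *m B *m l^T) 0 0 = -1.
Hypothesis lK : forall u : 'rV[R]_n, (l *m B *m (u *m K)^T) 0 0 = 0.
Hypothesis KK : forall u v : 'rV[R]_n, ((u *m K) *m B *m (v *m K)^T) 0 0 = dot u v.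
Hypothesis embF : forall y, O y -> quadric_emb kappa e1 e2 (hext F y) = cone_point W c l K y.

Let tF y : R := tcoord (hext F y).
Let yF i y : R := ycoord (hext F y) 0 i.
Let sigma y : R := flin kappa (Defs.radius (hext F y)).
Let S v y : R := \sum_i yF i y * 'D_v (yF i) y.

Let pos y : O y -> 0 < 1 - kappa * Defs.radius (hext F y) ^+ 2.
Proof. by move=> Oy; have Jy := FJ Oy; rewrite -hJ // exprn_gt0 // fJ. Qed.

Let sigma0 y : O y -> sigma y != 0.
Proof. by move=> Oy; rewrite gt_eqF // sqrtr_gt0 pos. Qed.

Let sigmaE y : sigma y = Num.sqrt (1 - kappa * \sum_i yF i y ^+ 2).
Proof.
by rewrite /sigma /flin radius_sqr; congr (Num.sqrt (_ - _ * _)).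
Qed.

Lemma is_derive_lapse y v : O y -> is_derive y v sigma (- kappa * S v y / sigma y).
Proof.
move=> Oy; have d := is_derive_add (is_derive_const (1 : R) y v)
  (is_derive_opp (is_derive_mul (is_derive_const kappa y v)
    (@is_derive_bigsum _ _ _ (index_enum 'I_n) predT _ _ y v (fun i _ =>
      is_derive_pow 2 (Ck_is_derive v (Ck_ycoord sF i 1) Oy))))).
have p : 0 < 1 - kappa * \sum_i yF i y ^+ 2.
  by have := pos Oy; rewrite radius_sqr; congr (_ < _ - _ * _).
have -> : sigma = Num.sqrt \o (fun z => 1 - kappa * \sum_i yF i z ^+ 2).
  by apply/funext => z; exact: sigmaE.
apply: is_derive_eq (is_derive_comp1 d (is_derive1_sqrt p)) _.
rewrite mulr0 addr0 sub0r /= -sigmaE.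
have -> : \sum_i 2%:R * yF i y ^+ 1 * 'D_v (yF i) y = 2 * S v y.
  by rewrite /S mulr_sumr; apply: eq_bigr => i _; rewrite mulrA.
move: (S v y) (sigma0 Oy) => q; move: (sigma y) => s s0; by field.
Qed.

Lemma is_derive_radial_product y u v : O y -> is_derive y u (S v)
  (\sum_i ('D_u (yF i) y * 'D_v (yF i) y + yF i y * 'D_u ('D_v (yF i)) y)).
Proof.
move=> Oy; apply: is_derive_bigsum => i _.
have := is_derive_mul (Ck_is_derive u (Ck_ycoord sF i 1) Oy)
  (Ck_is_derive u (Ck_derive v (Ck_ycoord sF i 2)) Oy).
by move=> /is_derive_eq; apply; rewrite addrC (mulrC ('D_u (yF i) y)).
Qed.

Section Component.
Variables (e d : R -> R).
Hypothesis de : forall t, is_derive t (1 : R) e (d t).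
Hypothesis ded : forall t, is_derive t (1 : R) d (kappa * e t).

Lemma is_derive_component y v : O y -> is_derive y v (fun z => sigma z * e (tF z))
  (sigma y * (d (tF y) * 'D_v tF y) + e (tF y) * (- kappa * S v y / sigma y)).
Proof.
move=> Oy; exact: is_derive_mul (is_derive_lapse v Oy)
  (is_derive_comp1 (Ck_is_derive v (Ck_tcoord sF 1) Oy) (de (tF y))).
Qed.

(** Only e' = d and d' = kappa e enter, so one computation serves both axial coordinates. *)
Lemma derive2_component y u v : O y -> 'D_u ('D_v (fun z => sigma z * e (tF z))) y =
  (- kappa * (\sum_i ('D_u (yF i) y * 'D_v (yF i) y + yF i y * 'D_u ('D_v (yF i)) y)) / sigma y
   - kappa ^+ 2 * S u y * S v y / sigma y ^+ 3 + kappa * sigma y * 'D_u tF y * 'D_v tF y) * e (tF y)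
  + (sigma y * 'D_u ('D_v tF) y
     - kappa * (S u y * 'D_v tF y + S v y * 'D_u tF y) / sigma y) * d (tF y).
Proof.
move=> Oy.
rewrite (@derive_open _ _ _ O _ (fun y => sigma y * (d (tF y) * 'D_v tF y) + e (tF y) * (- kappa * S v y * (sigma y)^-1)) y u oO Oy); last first.
  by move=> z Oz; case: (is_derive_component v Oz).
have dt := Ck_is_derive u (Ck_tcoord sF 1) Oy.
have ds := is_derive_lapse u Oy.
have D1 := is_derive_add (is_derive_mul ds (is_derive_mul
   (is_derive_comp1 dt (ded (tF y))) (Ck_is_derive u (Ck_derive v (Ck_tcoord sF 2)) Oy)))
  (is_derive_mul (is_derive_comp1 dt (de (tF y))) (is_derive_mul (is_derive_mul
    (is_derive_const (- kappa) y u) (is_derive_radial_product u v Oy)) (is_derive_inv (sigma0 Oy) ds))).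
apply: derive_val; apply: is_derive_eq D1 _.
rewrite -/tF /=; move: (\sum_i _) (S u y) (S v y) (sigma0 Oy) => Z Su Sv.
move: (sigma y) (d (tF y)) (e (tF y)) ('D_u tF y) ('D_v tF y) ('D_u ('D_v tF) y) => s D E tu tv tuv s0.
by field.
Qed.

End Component.

Lemma inner_model y a b : O y -> inner (static_metric f) (hext F y) a b =
  (quadric_diff kappa e1 e2 d1 d2 (hext F y) a *m B
    *m (quadric_diff kappa e1 e2 d1 d2 (hext F y) b)^T) 0 0.
Proof.
move=> Oy; rewrite (quadric_diff_diff k0 ee ed dd (pos Oy)) inner_static.
have Jy := FJ Oy; have fE : f (Defs.radius (hext F y)) ^+ 2 = flin kappa (Defs.radius (hext F y)) ^+ 2.
  by rewrite flin_sqr ?pos // hJ.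
rewrite fE; congr (_ + _).
have [y0|y0] := eqVneq (ycoord (hext F y)) 0; first by rewrite y0 !dot0l !mulr0.
by rewrite (hcoef_model hJ) ?radius_eq0 ?gt_eqF ?fJ // flin_sqr ?pos.
Qed.

Lemma quadric_cone_mean_curvature x : sphere x ->
  inner (static_metric f) (F x) (mean_curvature (static_metric f) F x)
    (mean_curvature (static_metric f) F x) =
  (n%:R - 1) * (2 * W x * laplacian W x - (n%:R - 1) * (gradsq W x + kappa)).
Proof.
move=> sx; have Ox := punctured_sphere sx; have Fx := hext_sphere F sx.
pose q := quadric_diff kappa e1 e2 d1 d2 (F x).
pose Jm : 'M[R]_(1 + n, 1 + (1 + n)) := \matrix_i q (delta_mx 0 i).
have qJ (Z : 'rV[R]_(1 + n)) : Z *m Jm = q Z.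
  rewrite mulmx_sum_row; under eq_bigr => i _ do rewrite rowK.
  apply/rowP => j; rewrite summxE; under eq_bigr => i _ do rewrite mxE.
  apply: (@lin_sum _ _ (fun Z => q Z 0 j)) => s u v.
  by rewrite /q quadric_diff_lin !mxE.
pose Psi := quadric_emb kappa e1 e2 (F x).
have px := pos Ox; rewrite Fx in px.
have ev := (@tcoord_event R, @ycoord_event R).
have s0 := sigma0 Ox.
have sE : flin kappa (Defs.radius (F x)) = sigma x by rewrite /sigma Fx.
have tE : tcoord (F x) = tF x by rewrite /tF Fx.
have Yd u : dot (ycoord (F x)) (\row_i 'D_u (yF i) x) = S u x.
  by rewrite /dot /S -Fx; apply: eq_bigr => i _; rewrite [X in _ * X]mxE.
have c0 y : O y -> cone_point W c l K y 0 (lshift (1 + n) 0) = sigma y * e1 (tF y).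
  by move=> Oy; rewrite -embF // -tcoordE ev.
have c1 y : O y -> cone_point W c l K y 0 (rshift 1 (lshift n 0)) = sigma y * e2 (tF y).
  by move=> Oy; rewrite -embF // -ycoordE -tcoordE !ev.
have c2 y i : O y -> cone_point W c l K y 0 (rshift 1 (rshift 1 i)) = yF i y.
  by move=> Oy; rewrite -embF // -!ycoordE !ev.
apply: (@moved_cone_mean_curvature _ _ _ F f W c l K B hW W0 homW (quadric_form_sym eps) ll lK KK x Jm Psi kappa sx).
- apply/matrixP => i j; rewrite -[LHS]mx_entry -[RHS]mx_entry -[RHS]/(inner _ _ _ _) -Fx inner_model // Fx.
  rewrite -!/(q _) -!qJ trmx_mul !mulmxA.
  by [].
- apply/rowP => i; rewrite [RHS]mxE.
  have -> : (Psi *m B *m Jm^T) 0 i = (Psi *m B *m (q (delta_mx 0 i))^T) 0 0.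
    by rewrite -qJ trmx_mul mulmxA trmx_delta -colE [RHS]mxE.
  by rewrite quadric_emb_diff.
- by rewrite quadric_emb_emb // expr2 mulfK.
- move=> u ux; rewrite qJ (dmap_event sF u Ox) /q /quadric_diff !ev sE tE Yd.
  apply: eventP; first rewrite tcoord_event tcoordE mxE.
    rewrite (@derive_open _ _ _ O _ _ x u oO Ox c0).
    by rewrite (@derive_val _ _ _ _ _ _ _ (is_derive_component de1 u Ox)); ring.
  apply: eventP; first rewrite !ev tcoordE ycoordE mxE.
    rewrite (@derive_open _ _ _ O _ _ x u oO Ox c1).
    by rewrite (@derive_val _ _ _ _ _ _ _ (is_derive_component de2 u Ox)); ring.
  rewrite !ev; apply/rowP => i; rewrite mxE !ycoordE mxE.
  by rewrite (@derive_open _ _ _ O _ _ x u oO Ox (fun y => c2 y i)).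
move=> u v ux vx.
pose nab := inner (static_metric f) (F x) (dmap F x u) (dmap F x v).
have Jx : J (Defs.radius (F x)) by rewrite -Fx; exact: FJ.
have fE : f (Defs.radius (F x)) ^+ 2 = sigma x ^+ 2 by rewrite -sE flin_sqr // hJ.
have mxr k (g : 'I_k -> R) i : (\row_j g j) 0 i = g i by rewrite mxE.
have Td w : tcoord (dmap F x w) = 'D_w tF x by rewrite (dmap_event sF w Ox) tcoord_event.
have Yr w : ycoord (dmap F x w) = \row_i 'D_w (yF i) x by rewrite (dmap_event sF w Ox) ycoord_event.
have hE : hess_map (static_metric f) F x u v =
   event ('D_u ('D_v tF) x - kappa / sigma x ^+ 2 * (S u x * 'D_v tF x + S v x * 'D_u tF x))
     (\row_i 'D_u ('D_v (yF i)) x + (kappa * nab) *: ycoord (F x)).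
  rewrite /hess_map (model_christoffel nJ J0 hJ Jx (fun r Jr => lt0r_neq0 (fJ Jr)) (derivableP (df Jx))).
  rewrite (derive2_event sF u v Ox) (Td u) (Td v) (Yr u) (Yr v) (Yd u) (Yd v) fE -/nab.
  rewrite -[LHS](event_coord _) (tcoordD (event _ _)) (ycoordD (event _ _)).
  by rewrite !tcoord_event !ycoord_event.
have nabE : nab = - sigma x ^+ 2 * 'D_u tF x * 'D_v tF x
    + dot (\row_i 'D_u (yF i) x) (\row_i 'D_v (yF i) x) + kappa / sigma x ^+ 2 * S u x * S v x.
  rewrite /nab -{1}Fx (inner_model _ _ Ox) (quadric_diff_diff k0 ee ed dd (pos Ox)) Fx.
  by rewrite (Td u) (Td v) (Yr u) (Yr v) (Yd u) (Yd v) sE.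
have YY : \sum_i ('D_u (yF i) x * 'D_v (yF i) x + yF i x * 'D_u ('D_v (yF i)) x) =
    dot (\row_i 'D_u (yF i) x) (\row_i 'D_v (yF i) x) + dot (ycoord (F x)) (\row_i 'D_u ('D_v (yF i)) x).
  by rewrite /dot -big_split /= -Fx; apply: eq_bigr => i _; rewrite !mxr.
have s2 : sigma x ^+ 2 = 1 - kappa * dot (ycoord (F x)) (ycoord (F x)).
  by rewrite -fE hJ // radius_sqr.
rewrite -/nab hE qJ /q /quadric_diff tcoord_event ycoord_event sE tE /Psi /quadric_emb sE tE dotDr dotZr.
(* The Gauss formula in an axial coordinate, [E] and [D] standing for e(t) and d(t): the space part
   of the Christoffel symbols cancels the multiple of [Psi] up to the second derivative of the
   lapse. *)
have comp (D E : R) :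
  - kappa * (dot (ycoord (F x)) (\row_i 'D_u ('D_v (yF i)) x) + kappa * nab * dot (ycoord (F x)) (ycoord (F x))) / sigma x * E
  + sigma x * ('D_u ('D_v tF) x - kappa / sigma x ^+ 2 * (S u x * 'D_v tF x + S v x * 'D_u tF x)) * D
  - (kappa * nab) * (sigma x * E) =
  (- kappa * (\sum_i ('D_u (yF i) x * 'D_v (yF i) x + yF i x * 'D_u ('D_v (yF i)) x)) / sigma x
   - kappa ^+ 2 * S u x * S v x / sigma x ^+ 3 + kappa * sigma x * 'D_u tF x * 'D_v tF x) * E
  + (sigma x * 'D_u ('D_v tF) x
     - kappa * (S u x * 'D_v tF x + S v x * 'D_u tF x) / sigma x) * D.
  rewrite YY; move: nab nabE s2 s0 {hE YY}.
  move: (dot _ _) (dot _ _) (dot _ _) => yh yy uv nab nabE.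
  move: (sigma x) (S u x) (S v x) ('D_u tF x) ('D_v tF x) ('D_u ('D_v tF) x) nabE => s Su Sv tu tv tuv nabE s2 s0.
  have -> : kappa * nab * yy = nab * (1 - s ^+ 2) by rewrite s2; ring.
  by rewrite nabE; field.
have D2 (g h : 'rV[R]_n -> R) : (forall y, O y -> g y = h y) -> 'D_u ('D_v g) x = 'D_u ('D_v h) x.
  by move=> gh; apply: (derive_open _ oO Ox) => y Oy; exact: derive_open oO Oy gh.
apply: eventP.
  rewrite tcoordD tcoordN tcoordZ !tcoord_event tcoordE mxr (D2 _ _ c0).
  by rewrite (derive2_component de1 dd1 u v Ox) -comp.
rewrite ycoordD ycoordN ycoordZ !ycoord_event; apply: eventP.
  rewrite tcoordD tcoordN tcoordZ !tcoord_event tcoordE ycoordE mxr (D2 _ _ c1).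
  by rewrite (derive2_component de2 dd2 u v Ox) -comp.
rewrite ycoordD ycoordN ycoordZ !ycoord_event addrK; apply/rowP => i.
by rewrite mxr !ycoordE mxr (D2 _ _ (fun y => c2 y i)).
Qed.

End QuadricConeEquation.

Section FlatConeEquation.
Context {R : realType} {n : nat}.
Variables (F : 'rV[R]_n -> 'rV[R]_(1 + n)) (f : R -> R) (J : set R).
Hypothesis nJ : nondegenerate_interval J.
Hypothesis J0 : forall r, J r -> 0 <= r.
Hypothesis hJ : forall r, J r -> f r ^+ 2 = 1.
Hypothesis fJ : forall r, J r -> 0 < f r.
Hypothesis df : forall r, J r -> derivable f r 1.
Hypothesis sF : smooth_sphere F.
Local Notation O := (@punctured R n).
Let oO := @open_punctured R n.
Hypothesis FJ : forall y, O y -> J (Defs.radius (hext F y)).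
Variables (W : 'rV[R]_n -> R) (c l : 'rV[R]_(1 + n)) (K : 'M[R]_(n, 1 + n)).
Hypothesis hW : Ck O 3 W.
Hypothesis W0 : forall x, O x -> 0 < W x.
Hypothesis homW : forall a x, 0 < a -> O x -> W (a *: x) = a * W x.
Local Notation B := (block_mx (-1)%:M 0 0 1%:M : 'M[R]_(1 + n)).
Hypothesis ll : (l *m B *m l^T) 0 0 = -1.
Hypothesis lK : forall u : 'rV[R]_n, (l *m B *m (u *m K)^T) 0 0 = 0.
Hypothesis KK : forall u v : 'rV[R]_n, ((u *m K) *m B *m (v *m K)^T) 0 0 = dot u v.
Hypothesis embF : forall y, O y -> hext F y = cone_point W c l K y.

Lemma flat_cone_mean_curvature x : sphere x ->
  inner (static_metric f) (F x) (mean_curvature (static_metric f) F x)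
    (mean_curvature (static_metric f) F x) =
  (n%:R - 1) * (2 * W x * laplacian W x - (n%:R - 1) * (gradsq W x + 0)).
Proof.
move=> sx; have Ox := punctured_sphere sx; have Fx := hext_sphere F sx.
have Jx : J (Defs.radius (F x)) by rewrite -Fx; exact: FJ.
have Bsym : B^T = B by rewrite !tr_block_mx !trmx0 !tr_scalar_mx.
have hJ0 r : J r -> f r ^+ 2 = 1 - 0 * r ^+ 2 by move=> Jr; rewrite mul0r subr0 hJ.
have gB : static_metric f (F x) = B.
  rewrite /static_metric hJ // invr1 subrr mul0r scale0r addr0 //.
apply: (@moved_cone_mean_curvature _ _ _ F f W c l K B hW W0 homW Bsym ll lK KK x 1%:M 0 0 sx).
- by rewrite mul1mx trmx1 mulmx1 gB.
- by rewrite !mul0mx.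
- by rewrite expr0n mul0r.
- move=> u ux; rewrite mulmx1; apply/rowP => i; rewrite mxE (smooth_on_coord_derive _ _ sF Ox).
  by apply: (derive_open _ oO Ox) => y Oy; rewrite embF.
move=> u v ux vx; rewrite mulmx1 scaler0 subr0; apply/rowP => i; rewrite [RHS]mxE /hess_map.
rewrite (model_christoffel nJ J0 hJ0 Jx (fun r Jr => lt0r_neq0 (fJ Jr)) (derivableP (df Jx))).
rewrite !mul0r oppr0 scale0r.
have -> : event 0 0 = 0 :> 'rV[R]_(1 + n) by apply: eventP; rewrite ?tcoord_event ?ycoord_event /tcoord /ycoord linear0 ?mxE.
rewrite addr0 (smooth_on_coord_derive2 _ _ _ oO sF Ox).
by apply: (derive_open _ oO Ox) => y Oy; apply: (derive_open _ oO Oy) => z Oz; rewrite embF.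
Qed.

End FlatConeEquation.

(** * Isometries and sections of a null cone *)

Section Isometries.
Context {R : realType} {N : nat}.
Variable B : 'M[R]_N.
Hypothesis Bsym : B^T = B.
Local Notation bf a b := ((a *m B *m b^T) 0 0).
Implicit Types (A X Y w : 'rV[R]_N) (L : 'M[R]_N).

Definition isometry_mx L := L *m B *m L^T = B.

Lemma isometryM L1 L2 : isometry_mx L1 -> isometry_mx L2 -> isometry_mx (L1 *m L2).
Proof.
by move=> h1 h2; rewrite /isometry_mx trmx_mul !mulmxA -(mulmxA L1 L2) -(mulmxA L1 (L2 *m B)) h2 h1.
Qed.

Lemma isometryE L X Y : isometry_mx L -> bf (X *m L) (Y *m L) = bf X Y.
Proof. by move=> hL; rewrite trmx_mul !mulmxA -(mulmxA X L) -(mulmxA X (L *m B)) hL. Qed.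

Definition reflection w : 'M[R]_N := 1%:M - (2 / bf w w) *: (B *m w^T *m w).

Lemma reflectionE w X : X *m reflection w = X + (- (2 / bf w w * bf X w)) *: w.
Proof.
rewrite /reflection mulmxBr mulmx1 -scalemxAr scaleNr; congr (_ - _).
by rewrite !mulmxA [X *m B *m w^T in LHS]mx11_scalar mul_scalar_mx scalerA.
Qed.

Lemma reflection_shift w X : exists c, X *m reflection w = X + c *: w.
Proof. by rewrite reflectionE; eexists. Qed.

Lemma reflection_isometry w : bf w w != 0 -> isometry_mx (reflection w).
Proof.
move=> q0; apply/matrixP => i j; rewrite -[LHS]mx_entry -[RHS]mx_entry.
set X := delta_mx 0 i; set Y := delta_mx 0 j.
have assoc (M : 'M[R]_N) : X *m (M *m B *m M^T) *m Y^T = (X *m M) *m B *m (Y *m M)^T.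
  by rewrite trmx_mul !mulmxA.
rewrite assoc.
rewrite !reflectionE !(bfDl, bfDr Bsym, bfZl, bfZr Bsym) (bf_sym Bsym w Y).
by move: (bf X Y) (bf X w) (bf Y w) (bf w w) q0 => a b c q q0; field.
Qed.

(** Reflection in A - X0, unless it is null, which an indefinite form allows. In that case A + X0
    has square 4 <A, A>, and reflecting in it and in X0 does the work. The last two clauses record
    that only the span of [A] and [X0] is disturbed. *)
Lemma witt A X0 : bf A A = bf X0 X0 -> bf A A != 0 -> exists L,
  [/\ isometry_mx L, A *m L = X0, forall X, exists a b, X *m L = X + a *: A + b *: X0 &
      forall X, bf X A = 0 -> bf X X0 = 0 -> X *m L = X].
Proof.
move=> AA A0; pose w := A - X0.
have [q0|q0] := eqVneq (bf w w) 0; last first.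
  exists (reflection w); split.
  - exact: reflection_isometry.
  - have E : bf A w = bf w w / 2.
      rewrite /w -scaleN1r !(bfDl, bfDr Bsym, bfZl, bfZr Bsym) -AA (bf_sym Bsym X0); lra.
    have -> : A *m reflection w = A + (-1) *: w by rewrite reflectionE E mulrA divfK // divff // pnatr_eq0.
    by rewrite scaleN1r /w opprB addrC subrK.
  - move=> X; have [c ->] := reflection_shift w X; exists c, (- c).
    by rewrite /w scalerBr scaleNr addrA.
  - move=> X XA XX0.
    have Xw : bf X w = 0 by rewrite /w -scaleN1r bfDr // bfZr // XA XX0 mulr0 addr0.
    by rewrite reflectionE Xw mulr0 oppr0 scale0r addr0.
have AX : bf A X0 = bf A A.
  move: q0; rewrite /w -scaleN1r !(bfDl, bfDr Bsym, bfZl, bfZr Bsym) -AA (bf_sym Bsym X0); lra.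
pose p := A + X0.
have pp : bf p p = 4 * bf A A.
  by rewrite /p !(bfDl, bfDr Bsym) -AA (bf_sym Bsym X0) AX; ring.
have p0 : bf p p != 0 by rewrite pp mulf_neq0 // pnatr_eq0.
have X00 : bf X0 X0 != 0 by rewrite -AA.
exists (reflection p *m reflection X0); split.
- by apply: isometryM; exact: reflection_isometry.
- have E : bf A p = bf p p / 2 by rewrite pp /p bfDr // AX; field.
  have Ap : A *m reflection p = - X0.
    have -> : A *m reflection p = A + (-1) *: p by rewrite reflectionE E mulrA divfK // divff // pnatr_eq0.
    by rewrite scaleN1r /p opprD addrA subrr sub0r.
  rewrite mulmxA Ap mulNmx.
  have -> : X0 *m reflection X0 = X0 + (- 2) *: X0 by rewrite reflectionE divfK.
  by rewrite scaleNr scaler_nat mulr2n opprD opprK addKr.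
- move=> X; rewrite mulmxA; have [c ->] := reflection_shift p X.
  have [c' ->] := reflection_shift X0 (X + c *: p); exists c, (c + c').
  by rewrite /p scalerDr scalerDl !addrA.
move=> X XA XX0; have Xp : bf X p = 0 by rewrite /p bfDr // XA XX0 addr0.
have E : X *m reflection p = X by rewrite reflectionE Xp mulr0 oppr0 scale0r addr0.
by rewrite mulmxA E reflectionE XX0 mulr0 oppr0 scale0r addr0.
Qed.

End Isometries.

(** * Sections of a null cone by hyperplanes *)

Section Conic.
Context {R : realType} {n N : nat}.
Variable B : 'M[R]_N.
Hypothesis Bsym : B^T = B.
Hypothesis Bunit : B \in unitmx.
Local Notation bf a b := ((a *m B *m b^T) 0 0).
Variables (l : 'rV[R]_N) (K : 'M[R]_(n, N)).
Hypothesis ll : bf l l = -1.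
Hypothesis lK : forall u : 'rV[R]_n, bf l (u *m K) = 0.
Hypothesis KK : forall u v : 'rV[R]_n, bf (u *m K) (v *m K) = dot u v.
Variables (a : R) (be : 'rV[R]_n) (rho : 'rV[R]_n -> R).
Hypothesis a0 : 0 < a.
Hypothesis abe : dot be be < a ^+ 2.
Hypothesis rhoE : forall x, sphere x -> rho x * (a + dot x be) = 1.

(* The points rho x (l + xK) are the section of a null cone by the hyperplane
   <X, - a l + be K> = 1, the points r1 (l + yK) its section by
   <X, - r1^-1 l> = 1; an isometry between the two normals is needed. *)
Lemma conic_isometry : let r1 := (Num.sqrt (a ^+ 2 - dot be be))^-1 in
  exists2 L, isometry_mx B L /\ (forall V : 'rV[R]_N, bf V l = 0 -> (forall u : 'rV[R]_n, bf V (u *m K) = 0) -> V *m L = V) &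
  (forall x, sphere x -> exists2 y, sphere y & rho x *: (l + x *m K) = (r1 *: (l + y *m K)) *m L) /\
  (forall y, sphere y -> exists2 x, sphere x & rho x *: (l + x *m K) = (r1 *: (l + y *m K)) *m L).
Proof.
move=> r1; pose c := Num.sqrt (a ^+ 2 - dot be be).
have c2 : c ^+ 2 = a ^+ 2 - dot be be by rewrite sqr_sqrtr // subr_ge0 ltW.
have c0 : 0 < c by rewrite sqrtr_gt0 subr_gt0.
(* The normal of the given section, with square - (a^2 - |be|^2) = - c^2, the same as that of
   [- c *: l], the normal of the round section r1 = 1 / c. *)
pose eta := - a *: l + be *m K.
have spanE (s t : R) (z z' : 'rV[R]_n) : bf (s *: l + z *m K) (t *: l + z' *m K) = - s * t + dot z z'.
  by rewrite !(bfDl, bfDr Bsym, bfZl, bfZr Bsym) (bf_sym Bsym (z *m K)) !lK KK ll; ring.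
have lE (s : R) : s *: l = s *: l + 0 *m K by rewrite mul0mx addr0.
have cl (t s : R) (z : 'rV[R]_n) : bf (s *: l + z *m K) (t *: l) = - s * t.
  by rewrite (lE t) spanE dot0r addr0.
have [L [iL AL spL fixL]] : exists L, [/\ isometry_mx B L, (- c *: l) *m L = eta,
    forall X : 'rV[R]_N, exists s t, X *m L = X + s *: (- c *: l) + t *: eta &
      forall X : 'rV[R]_N, bf X (- c *: l) = 0 -> bf X eta = 0 -> X *m L = X].
  apply: (witt Bsym).
    rewrite spanE {1}(lE (- c)) cl.
    have -> : - - c * - c = - c ^+ 2 by ring.
    by rewrite c2; ring.
  rewrite {1}(lE (- c)) cl; have -> : - - c * - c = - c ^+ 2 by ring.
  by rewrite oppr_eq0 expf_neq0 // gt_eqF.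
(* A null vector of the span having product 1 with the normal lies on the right nappe:
   Cauchy-Schwarz gives (1 - s a')^2 <= s^2 a'^2, hence s a' >= 1/2. *)
have section (a' : R) (be' : 'rV[R]_n) (s : R) (z : 'rV[R]_n) : 0 < a' -> dot be' be' < a' ^+ 2 ->
    bf (s *: l + z *m K) (s *: l + z *m K) = 0 -> bf (s *: l + z *m K) (- a' *: l + be' *m K) = 1 ->
    [/\ 0 < s, sphere (s^-1 *: z) & s * (a' + dot (s^-1 *: z) be') = 1].
  move=> a'0 abe'; rewrite !spanE => zz zb.
  have cs := cauchy_schwarz z be'.
  have s0 : 0 < s.
    have h1 : dot z be' = 1 - s * a' by lra.
    have h2 : dot z z = s ^+ 2 by rewrite expr2; lra.
    have h3 : s ^+ 2 * dot be' be' <= s ^+ 2 * a' ^+ 2 by rewrite ler_wpM2l ?sqr_ge0 // ltW.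
    have h4 : (1 - s * a') ^+ 2 <= s ^+ 2 * a' ^+ 2 by rewrite -h1; apply: le_trans cs _; rewrite h2.
    rewrite -(pmulr_lgt0 _ a'0); have : (1 - s * a') ^+ 2 = 1 - 2 * (s * a') + s ^+ 2 * a' ^+ 2 by ring.
    lra.
  have sn : s != 0 by rewrite gt_eqF.
  split=> //; first by apply/sphereE; rewrite dotZl dotZr (_ : dot z z = s ^+ 2) ?expr2; [field|lra].
  by rewrite dotZl mulrDr mulrA mulfV // mul1r; lra.
have uL : L \in unitmx.
  have : L *m (B *m L^T *m invmx B) = 1%:M by rewrite !mulmxA iL mulmxV.
  by case/mulmx1_unit.
have b0 : dot (0 : 'rV[R]_n) 0 < c ^+ 2 by rewrite dot0l exprn_gt0.
(* [L] shifts vectors by combinations of [- c *: l] and [eta], both in this space, so images and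
   preimages of points of the cone stay in it and [section] applies to them. *)
pose span (X : 'rV[R]_N) := exists (s : R) (z : 'rV[R]_n), X = s *: l + z *m K.
have spanD k (X Y : 'rV[R]_N) : span X -> span Y -> span (X + k *: Y).
  move=> [s [z ->]] [s' [z' ->]]; exists (s + k * s'), (z + k *: z').
  by rewrite scalerDr scalerA scalerDl mulmxDl -scalemxAl addrACA.
have span_eta : span eta by exists (- a), be.
have span_l : span (- c *: l) by exists (- c), 0; exact: lE.
exists L; first split=> // V Vl VK.
  apply: fixL; first by rewrite bfZr // Vl mulr0.
  by rewrite /eta bfDr // bfZr // Vl VK mulr0 addr0.
split.
- move=> x sx; pose X := rho x *: (l + x *m K); pose Y := X *m invmx L.
  have YL : Y *m L = X by rewrite /Y mulmxKV.
  have XE : X = rho x *: l + (rho x *: x) *m K by rewrite /X scalerDr scalemxAl.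
  have sxx : dot x x = 1 by exact/sphereE.
  have spanX : span X by exists (rho x), (rho x *: x).
  have [s [z YE]] : span Y.
    have [s [t E]] := spL Y.
    have -> : Y = X + (- s) *: (- c *: l) + (- t) *: eta.
      rewrite -YL E; move: (- c *: l) => v; rewrite !scaleNr.
      by rewrite -[RHS]addrA -opprD -(addrA Y) addrK.
    by apply: (spanD) => //; exact: spanD.
  have YY : bf Y Y = 0.
    rewrite -(isometryE _ _ iL) YL XE spanE dotZl dotZr sxx; ring.
  have Yl : bf Y (- c *: l) = 1.
    by rewrite -(isometryE _ _ iL) YL AL XE spanE dotZl -(rhoE sx); ring.
  rewrite YE in YY; rewrite YE (lE (- c)) in Yl.
  have [s0 sz] := section c 0 s z c0 b0 YY Yl.
  rewrite dot0r addr0 => sc; exists (s^-1 *: z) => //.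
  rewrite -/X -YL YE; congr (_ *m L).
  have -> : r1 = s by rewrite /r1 -/c -[LHS]mul1r -sc mulfK // gt_eqF.
  by rewrite scalerDr -scalemxAl scalerA divff ?scale1r ?gt_eqF.
move=> y sy; pose Y := r1 *: (l + y *m K).
have YE : Y = r1 *: l + (r1 *: y) *m K by rewrite /Y scalerDr scalemxAl.
have syy : dot y y = 1 by exact/sphereE.
have [s [z XE]] : span (Y *m L).
  have [s [t ->]] := spL Y; apply: (spanD) => //; apply: (spanD) => //.
  by exists r1, (r1 *: y).
have XX : bf (Y *m L) (Y *m L) = 0.
  rewrite (isometryE _ _ iL) YE spanE dotZl dotZr syy; ring.
have Xeta : bf (Y *m L) eta = 1.
  by rewrite -AL (isometryE _ _ iL) YE cl mulrN mulNr opprK /r1 -/c mulVf // gt_eqF.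
rewrite XE in XX Xeta.
have [s0 sz sc] := section a be s z a0 abe XX Xeta.
exists (s^-1 *: z) => //; rewrite -/Y XE.
have p0 : a + dot (s^-1 *: z) be != 0.
  by apply/eqP => E; move: sc; rewrite E mulr0 => /eqP; rewrite eq_sym oner_eq0.
have -> : rho (s^-1 *: z) = s by apply: (mulIf p0); rewrite sc; exact: rhoE.
by rewrite scalerDr -scalemxAl scalerA divff ?scale1r ?gt_eqF.
Qed.

End Conic.

Lemma sphere_exists {R : realType} {n : nat} : (0 < n)%N -> exists x : 'rV[R]_n, sphere x.
Proof.
move=> n0; exists (delta_mx 0 (Ordinal n0)); apply/sphereE.
by rewrite dot_delta mxE !eqxx.
Qed.

(** For nonzero [be] the values a + |be| and a - |be| at the two unit multiples of [be] decide. *)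
Lemma affine_positive {R : realType} {n : nat} (a : R) (be : 'rV[R]_n) : (0 < n)%N ->
  (forall x, sphere x -> 0 < a + dot x be) -> 0 < a /\ dot be be < a ^+ 2.
Proof.
move=> n0 H; case: (eqVneq be 0) H => [-> H|b0 H].
  have [x sx] := @sphere_exists R n n0; have := H x sx.
  by rewrite !(dot0r, dot0l) addr0 => a0; rewrite exprn_gt0.
have e0 := eucl_gt0 b0; have s1 := sphere_normalize b0.
have s2 : sphere (- ((eucl be)^-1 *: be)).
  by apply/sphereE; rewrite dotNl dotNr opprK; exact/sphereE.
have := H _ s1; have := H _ s2; rewrite dotNl dotZl -eucl_sqr expr2 mulKf ?gt_eqF // => h2 h1.
split; first lra.
by rewrite -expr2 ltr_pXn2r // ?nnegrE; lra.
Qed.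

Section AxialPlane.
Context {R : realType} {n : nat}.
Variables (kappa eps : R).
Local Notation N := (1 + (1 + n))%N.
Local Notation B := (quadric_form (n := n) eps).
Local Notation bf a b := ((a *m B *m b^T) 0 0).

Definition axial (p q : R) : 'rV[R]_N := event p (event q 0).
Definition space_mx : 'M[R]_(n, N) := row_mx 0 (row_mx 0 1%:M).

Lemma mul_space_mx (u : 'rV[R]_n) : u *m space_mx = event 0 (event 0 u).
Proof.
rewrite /space_mx !mul_mx_row !mulmx0 mulmx1 /event.
by congr row_mx; [|congr row_mx]; apply/matrixP => i j; rewrite !mxE mul0rn.
Qed.

Lemma axial_lin s p q p' q' : axial p q + s *: axial p' q' = axial (p + s * p') (q + s * q').
Proof.
rewrite /axial; apply: eventP; rewrite !coordE !(tcoord_event, ycoord_event) //.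
by apply: eventP; rewrite !coordE !(tcoord_event, ycoord_event) // scaler0 addr0.
Qed.

Lemma axial_form p q p' q' : bf (axial p q) (axial p' q') = - p * p' + eps * q * q'.
Proof. by rewrite quadric_formE !(tcoord_event, ycoord_event) dot0l addr0. Qed.

Lemma axial_space p q (u : 'rV[R]_n) : bf (axial p q) (u *m space_mx) = 0.
Proof.
by rewrite mul_space_mx quadric_formE !(tcoord_event, ycoord_event) dot0l !mulr0 !addr0.
Qed.

Lemma space_space (u v : 'rV[R]_n) : bf (u *m space_mx) (v *m space_mx) = dot u v.
Proof.
by rewrite !mul_space_mx quadric_formE !(tcoord_event, ycoord_event) !mulr0 !add0r.
Qed.

Lemma quadric_form_unit : eps * eps = 1 -> B \in unitmx.
Proof.
move=> e2; suff : B *m B = 1%:M by case/mulmx1_unit.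
rewrite /quadric_form !mulmx_block !mulmx0 !mul0mx !addr0 !add0r mulmx1.
by rewrite -!scalar_mxM e2 mulrNN mulr1 -!scalar_mx_block.
Qed.

End AxialPlane.

(** * From a section of a cone in the quadric to a slice *)

Section QuadricSphere.
Context {R : realType} {n : nat}.
Variables (kappa eps : R) (e1 e2 d1 d2 : R -> R).
Hypothesis n0 : (0 < n)%N.
Hypothesis k0 : kappa != 0.
Hypothesis eps2 : eps * eps = 1.
Hypothesis ee : forall t, - e1 t * e1 t + eps * e2 t * e2 t = kappa^-1.
Hypothesis ed : forall t, - e1 t * d1 t + eps * e2 t * d2 t = 0.
Hypothesis dd : forall t, - d1 t * d1 t + eps * d2 t * d2 t = -1.
(* In de Sitter space the static patch lies in the wedge X1 > |X0|. *)
Hypothesis wedge : 0 < kappa -> eps = 1 /\ forall t, `|e1 t| < e2 t.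
Local Notation N := (1 + (1 + n))%N.
Local Notation B := (quadric_form (n := n) eps).
Local Notation bf a b := ((a *m B *m b^T) 0 0).
Let Bsym : B^T = B := quadric_form_sym eps.
Variables (s t0 r0 : R).
Hypothesis ss : s * s = 1.
Hypothesis r0p : 0 < 1 - kappa * r0 ^+ 2.
Let s0 := flin kappa r0.

(* Along the null geodesic of the sphere t = t0, r = r0 in direction x, the
   embedded point is affine in r: it is V + r (l + xK). *)
Definition null_generator : 'rV[R]_N :=
  axial (s * d1 t0 / s0 - kappa * r0 * e1 t0 / s0) (s * d2 t0 / s0 - kappa * r0 * e2 t0 / s0).
Definition null_apex : 'rV[R]_N :=
  axial (s0 * e1 t0) (s0 * e2 t0) + (- r0) *: null_generator.
Local Notation l := null_generator.
Local Notation V := null_apex.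

Let s0p : s0 != 0. Proof. by rewrite gt_eqF // sqrtr_gt0. Qed.
Let s02 : s0 ^+ 2 = 1 - kappa * r0 ^+ 2. Proof. by rewrite sqr_sqrtr // ltW. Qed.

Lemma null_generator_form : bf l l = -1.
Proof.
rewrite axial_form.
transitivity ((s * s) / s0 ^+ 2 * (- d1 t0 * d1 t0 + eps * d2 t0 * d2 t0)
   - 2 * s * kappa * r0 / s0 ^+ 2 * (- e1 t0 * d1 t0 + eps * e2 t0 * d2 t0)
   + kappa ^+ 2 * r0 ^+ 2 / s0 ^+ 2 * (- e1 t0 * e1 t0 + eps * e2 t0 * e2 t0)); first by field.
rewrite ee ed dd ss; have -> : kappa ^+ 2 * r0 ^+ 2 / s0 ^+ 2 * kappa^-1 = (1 - s0 ^+ 2) / s0 ^+ 2.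
  by rewrite s02; field; rewrite k0 -s02 expf_neq0.
by field.
Qed.

Let base_generator : bf (axial (s0 * e1 t0) (s0 * e2 t0)) l = - r0.
Proof.
rewrite axial_form.
transitivity (s * (- e1 t0 * d1 t0 + eps * e2 t0 * d2 t0)
   - kappa * r0 * (- e1 t0 * e1 t0 + eps * e2 t0 * e2 t0)); first by field.
by rewrite ee ed; field.
Qed.

Let base_base : bf (axial (s0 * e1 t0) (s0 * e2 t0) : 'rV[R]_N) (axial (s0 * e1 t0) (s0 * e2 t0)) =
  s0 ^+ 2 / kappa.
Proof. by rewrite axial_form -(ee t0); ring. Qed.

(** With [null_apex_form] and [null_apex_space] it shows that the vertex is on the quadric and
    orthogonal to all generators: the ambient cone lies in the quadric, and [conic_isometry] fixes
    its vertex. *)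
Lemma null_apex_generator : bf V l = 0.
Proof. by rewrite bfDl bfZl base_generator null_generator_form; ring. Qed.

Lemma null_apex_form : bf V V = kappa^-1.
Proof.
rewrite [X in (_ *m X^T) 0 0]/null_apex bfDr // bfZr // null_apex_generator mulr0 addr0.
rewrite bfDl bfZl (bf_sym Bsym l) base_generator base_base s02.
by field.
Qed.

Lemma null_apex_space (u : 'rV[R]_n) : bf V (u *m space_mx) = 0.
Proof. by rewrite /null_apex axial_lin axial_space. Qed.

Variables (F : 'rV[R]_n -> 'rV[R]_(1 + n)) (L0 : 'M[R]_N) (a : R) (be : 'rV[R]_n) (rho : 'rV[R]_n -> R).
Local Notation emb := (quadric_emb kappa e1 e2).
Hypothesis iL0 : isometry_mx B L0.
Hypothesis Fp : forall x, sphere x -> 0 < 1 - kappa * Defs.radius (F x) ^+ 2.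
Hypothesis rho0 : forall x, sphere x -> 0 < rho x.
Hypothesis rhoE : forall x, sphere x -> rho x * (a + dot x be) = 1.
Hypothesis embF : forall x, sphere x -> emb (F x) = (V + rho x *: (l + x *m space_mx)) *m L0.

(** [L1] takes the round section of radius [r1] to the given one with the vertex fixed, and [L2]
    takes the centre of the slice t = 0, r = r1 to the centre A = V + r1 l of the round section.
    Both centres have square 1 / kappa - r1^2. *)
Lemma quadric_sphere : exists r1, patch_radius kappa r1 /\ exists2 L : 'M[R]_N, isometry_mx B L &
  emb @` (F @` @sphere R n) = (fun X => X *m L) @` (emb @` slice 0 r1).
Proof.
have [a0 abe] : 0 < a /\ dot be be < a ^+ 2.
  apply: affine_positive n0 _ => x sx.
  by rewrite -(pmulr_rgt0 _ (rho0 sx)) rhoE.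
have lK (u : 'rV[R]_n) : bf l (u *m space_mx) = 0 by rewrite axial_space.
have [L1 [iL1 fixL1] [fwd bwd]] := conic_isometry Bsym (quadric_form_unit eps2) null_generator_form
  lK (@space_space R n eps) a0 abe rhoE.
move: fwd bwd; set r1 := (Num.sqrt _)^-1 => fwd bwd.
have r1p : 0 < r1 by rewrite invr_gt0 sqrtr_gt0 subr_gt0.
have VL : V *m L1 = V by apply: fixL1; [exact: null_apex_generator|exact: null_apex_space].
pose A := V + r1 *: l.
have AA : bf A A = kappa^-1 - r1 ^+ 2.
  rewrite /A; move: null_apex_generator null_apex_form null_generator_form.
  move: null_apex null_generator => v w vw vv ww.
  by rewrite !(bfDl, bfZl) !(bfDr Bsym, bfZr Bsym) (bf_sym Bsym w v) vw vv ww; ring.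
have moved x y : sphere x -> rho x *: (l + x *m space_mx) = (r1 *: (l + y *m space_mx)) *m L1 ->
    emb (F x) = (A + r1 *: (y *m space_mx)) *m (L1 *m L0).
  move=> sx E; rewrite embF // E mulmxA; congr (_ *m L0).
  have -> : A + r1 *: (y *m space_mx) = V + r1 *: (l + y *m space_mx) by rewrite scalerDr addrA.
  by rewrite [RHS]mulmxDl VL.
(* For positive kappa the image of [A] is the midpoint of two points of Sigma. They lie in the
   convex wedge X1 > |X0|, so the square 1 / kappa - r1^2 of the midpoint is positive. *)
have patch : 0 < 1 - kappa * r1 ^+ 2.
  have [kn|kp] := ltP kappa 0.
    by rewrite subr_gt0 (le_lt_trans _ ltr01) // nmulr_rle0 // sqr_ge0.
  have {}kp : 0 < kappa by rewrite lt_neqAle eq_sym k0.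
  have [epsE wdg] := wedge kp.
  have [y sy] := @sphere_exists R n n0.
  have sny : sphere (- y) by apply/sphereE; rewrite dotNl dotNr opprK; exact/sphereE.
  have [x1 sx1 E1] := bwd y sy; have [x2 sx2 E2] := bwd _ sny.
  have M1 := moved _ _ sx1 E1; have M2 := moved _ _ sx2 E2.
  have AM : A *m (L1 *m L0) = 2^-1 *: (emb (F x1) + emb (F x2)).
    have avg (X D : 'rV[R]_N) (M : 'M[R]_N) : X *m M = 2^-1 *: ((X + D) *m M + (X - D) *m M).
      have E : X + D + (X - D) = 2 *: X by rewrite addrACA subrr addr0 scaler_nat mulr2n.
      by rewrite -mulmxDl E -scalemxAl scalerA mulVf ?scale1r // pnatr_eq0.
    by rewrite M1 M2 mulNmx scalerN; exact: avg.
  have := isometryE A A (isometryM iL1 iL0); rewrite AM AA quadric_formE !coordE !(tcoord_event, ycoord_event) epsE.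
  have p1 := flin_gt0 (Fp sx1); have p2 := flin_gt0 (Fp sx2).
  have w1 := wdg (tcoord (F x1)); have w2 := wdg (tcoord (F x2)).
  move: p1 p2 w1 w2; move: (flin _ _) (flin _ _) (e1 _) (e1 _) (e2 _) (e2 _) => f1 f2 x0 x0' z z'.
  move: (_ *: _) => Y p1 p2 w1 w2 H.
  have c1 : `|x0| < z -> 0 < f1 * (z - x0) /\ 0 < f1 * (z + x0).
    by rewrite ltr_norml => /andP[h1 h2]; split; rewrite pmulr_rgt0 //; lra.
  have c2 : `|x0'| < z' -> 0 < f2 * (z' - x0') /\ 0 < f2 * (z' + x0').
    by rewrite ltr_norml => /andP[h1 h2]; split; rewrite pmulr_rgt0 //; lra.
  have [c11 c12] := c1 w2; have [c21 c22] := c2 w1.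
  have P : 0 < (f2 * (z' - x0') + f1 * (z - x0)) * (f2 * (z' + x0') + f1 * (z + x0)).
    by rewrite mulr_gt0 // addr_gt0.
  have H0 : 0 < kappa^-1 - r1 ^+ 2 by rewrite -H; have := dotxx_ge0 Y; nra.
  by rewrite -(mulfV k0) -mulrBr mulr_gt0.
exists r1; split=> //.
pose s1 := flin kappa r1.
have s12 : s1 ^+ 2 = 1 - kappa * r1 ^+ 2 by rewrite sqr_sqrtr // ltW.
have s1p : s1 != 0 by rewrite gt_eqF // sqrtr_gt0.
pose A0 : 'rV[R]_N := axial (s1 * e1 0) (s1 * e2 0).
have A00 : bf A0 A0 = bf A A.
  rewrite AA axial_form; transitivity (s1 ^+ 2 * (- e1 0 * e1 0 + eps * e2 0 * e2 0)); first by ring.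
  by rewrite ee s12; field.
have A0n : bf A0 A0 != 0.
  rewrite A00 AA; apply/eqP => E.
  have : s1 ^+ 2 = 0 by rewrite s12 -[1](mulfV k0) -mulrBr E mulr0.
  by apply/eqP; rewrite expf_neq0.
have [L2 [iL2 A0L _ fixL2]] := witt Bsym A00 A0n.
have KL (u : 'rV[R]_n) : (u *m space_mx) *m L2 = u *m space_mx.
  apply: fixL2; rewrite (bf_sym Bsym); first exact: axial_space.
  by rewrite /A bfDl bfZl null_apex_space lK mulr0 addr0.
exists (L2 *m (L1 *m L0)); first by apply: isometryM => //; exact: isometryM.
have emb0 (p : 'rV[R]_(1 + n)) (y : 'rV[R]_n) : tcoord p = 0 -> Defs.radius p = r1 -> ycoord p = r1 *: y ->
    emb p *m L2 = A + r1 *: (y *m space_mx).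
  move=> tp rp yp.
  have -> : emb p = A0 + r1 *: (y *m space_mx).
    rewrite /quadric_emb tp rp yp mul_space_mx; apply: eventP; rewrite !coordE !(tcoord_event, ycoord_event) ?mulr0 ?addr0 //.
    by apply: eventP; rewrite !coordE !(tcoord_event, ycoord_event) ?mulr0 ?addr0 // add0r.
  by rewrite mulmxDl A0L -scalemxAl KL.
apply/seteqP; split=> [Z [p [x sx <-] <-]|Z [X [p [tp rp] <-] <-]].
  have [y sy E] := fwd x sx; rewrite (moved _ _ sx E).
  have ry : Defs.radius (event 0 (r1 *: y)) = r1.
    by rewrite radius_event euclZ (sy : eucl y = 1) mulr1 gtr0_norm.
  exists (emb (event 0 (r1 *: y))); first by exists (event 0 (r1 *: y)) => //; split; rewrite ?tcoord_event.
  by rewrite mulmxA (emb0 _ y) // ?tcoord_event ?ycoord_event.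
have y0 : ycoord p != 0 by rewrite -radius_eq0 rp gt_eqF.
have sy := sphere_normalize y0; have [x sx E] := bwd _ sy.
exists (F x); first by exists x.
rewrite /= (moved _ _ sx E) [RHS]mulmxA (emb0 p ((eucl (ycoord p))^-1 *: ycoord p)) //.
by rewrite -[eucl _]/(Defs.radius p) rp scalerA mulfV ?scale1r ?gt_eqF.
Qed.

End QuadricSphere.

Section FlatSphere.
Context {R : realType} {n : nat}.
Hypothesis n0 : (0 < n)%N.
Local Notation N := (1 + n)%N.
Local Notation B := (block_mx (-1)%:M 0 0 1%:M : 'M[R]_N).
Local Notation bf a b := ((a *m B *m b^T) 0 0).

Definition flat_space_mx : 'M[R]_(n, N) := row_mx 0 1%:M.

Lemma mul_flat_space_mx (u : 'rV[R]_n) : u *m flat_space_mx = event 0 u.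
Proof.
rewrite /flat_space_mx mul_mx_row mulmx0 mulmx1 /event.
by congr row_mx; apply/matrixP => i j; rewrite !mxE mul0rn.
Qed.

Lemma flat_formE (X Y : 'rV[R]_N) : bf X Y = - tcoord X * tcoord Y + dot (ycoord X) (ycoord Y).
Proof.
rewrite -[in LHS](event_coord X) -[in LHS](event_coord Y) /event.
rewrite mul_row_block !mulmx0 addr0 add0r tr_row_mx mul_row_col mxE; congr (_ + _); last by rewrite mulmx1 dot_mx.
by rewrite -scalar_mxM tr_scalar_mx -scalar_mxM [LHS]mxE eqxx mulr1n; ring.
Qed.

Lemma flat_form_sym : B^T = B.
Proof. by rewrite !tr_block_mx !trmx0 !tr_scalar_mx. Qed.

Lemma flat_form_unit : B \in unitmx.
Proof.
suff : B *m B = 1%:M by case/mulmx1_unit.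
rewrite mulmx_block !mulmx0 !mul0mx !addr0 !add0r mulmx1.
by rewrite -!scalar_mxM mulrNN mulr1 -!scalar_mx_block.
Qed.

Lemma flat_space_space (u v : 'rV[R]_n) : bf (u *m flat_space_mx) (v *m flat_space_mx) = dot u v.
Proof.
by rewrite !mul_flat_space_mx flat_formE !(tcoord_event, ycoord_event) mulr0 add0r.
Qed.

Lemma flat_time_space (s : R) (u : 'rV[R]_n) : bf (event s 0) (u *m flat_space_mx) = 0.
Proof.
by rewrite mul_flat_space_mx flat_formE !(tcoord_event, ycoord_event) mulr0 dot0l addr0.
Qed.

Lemma flat_time_time (s : R) : s * s = 1 -> bf (event s 0) (event s 0) = -1.
Proof. by move=> ss; rewrite flat_formE !(tcoord_event, ycoord_event) dot0l mulNr ss addr0. Qed.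

Variables (s : R) (F : 'rV[R]_n -> 'rV[R]_N) (phi : 'rV[R]_N -> 'rV[R]_N) (V : 'rV[R]_N)
  (a : R) (be : 'rV[R]_n) (rho : 'rV[R]_n -> R).
Hypothesis ss : s * s = 1.
Hypothesis rho0 : forall x, sphere x -> 0 < rho x.
Hypothesis rhoE : forall x, sphere x -> rho x * (a + dot x be) = 1.
Hypothesis FE : forall x, sphere x -> F x = phi (V + rho x *: (event s 0 + x *m flat_space_mx)).

(** The slice t = 0, r = r1 lies on the light cone with vertex at time - s r1. The time translation
    moves this vertex to the origin, where the linear isometry acts, and [V] then moves it to its
    place. *)
Lemma flat_sphere : exists r1, 0 < r1 /\ exists2 L : 'M[R]_N, isometry_mx B L &
  F @` @sphere R n = (fun X => phi ((X + event (s * r1) 0) *m L + V)) @` slice 0 r1.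
Proof.
have [a0 abe] : 0 < a /\ dot be be < a ^+ 2.
  apply: affine_positive n0 _ => x sx.
  by rewrite -(pmulr_rgt0 _ (rho0 sx)) rhoE.
have [L1 [iL1 _] [fwd bwd]] := conic_isometry flat_form_sym flat_form_unit (flat_time_time ss)
  (flat_time_space s) flat_space_space a0 abe rhoE.
move: fwd bwd; set r1 := (Num.sqrt _)^-1 => fwd bwd.
have r1p : 0 < r1 by rewrite invr_gt0 sqrtr_gt0 subr_gt0.
exists r1; split=> //; exists L1 => //.
have sumE (p : 'rV[R]_N) (y : 'rV[R]_n) : tcoord p = 0 -> ycoord p = r1 *: y ->
    p + event (s * r1) 0 = r1 *: (event s 0 + y *m flat_space_mx).
  move=> tp yp; rewrite mul_flat_space_mx; apply: eventP; rewrite !coordE !(tcoord_event, ycoord_event) ?tp ?yp.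
    by ring.
  by rewrite addr0 add0r.
apply/seteqP; split=> [Z [x sx <-]|Z [p [tp rp] <-]].
  have [y sy E] := fwd x sx; rewrite FE // E.
  exists (event 0 (r1 *: y)); last by rewrite (sumE _ y) ?tcoord_event ?ycoord_event // addrC.
  by split; rewrite ?tcoord_event // radius_event euclZ (sy : eucl y = 1) mulr1 gtr0_norm.
have y0 : ycoord p != 0 by rewrite -radius_eq0 rp gt_eqF.
have sy := sphere_normalize y0; have [x sx E] := bwd _ sy.
exists x => //; rewrite FE // E (sumE p ((eucl (ycoord p))^-1 *: ycoord p)) //; first by rewrite addrC.
by rewrite -[eucl _]/(Defs.radius p) rp scalerA mulfV ?scale1r ?gt_eqF.
Qed.

End FlatSphere.

(** * The space forms *)

Section OneVariable.
Context {R : realType}.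

Lemma constant_on_interval (J : set R) (h : R -> R) : is_interval J ->
  (forall r, J r -> is_derive r (1 : R) h 0) -> forall r r', J r -> J r' -> h r = h r'.
Proof.
move=> iJ dh.
have main r r' : J r -> J r' -> r <= r' -> h r = h r'.
  move=> Jr Jr' le; have Jt (t : R) : 0 <= t <= 1 -> J (t *: (r' - r) + r).
    move=> /andP[t0 t1]; apply: (iJ r r') => //; rewrite /GRing.scale /=; apply/andP; split; nra.
  have [t t01|t t01] := @mvt_dir _ _ h r (r' - r).
    have [d _] := is_deriveZr (r' - r) (dh _ (Jt t t01)).
    by rewrite [_ *: 1]mulr1 in d.
  have [_] := is_deriveZr (r' - r) (dh _ (Jt t t01)); rewrite [_ *: 1]mulr1 subrK => -> /eqP.
  by rewrite mulr0 subr_eq0 => /eqP.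
move=> r r' Jr Jr'; have [le|le] := leP r r'; first exact: main.
by rewrite (main r' r) // ltW.
Qed.

Lemma is_derive_flin (kappa r : R) : 0 < 1 - kappa * r ^+ 2 ->
  is_derive r (1 : R) (flin kappa) (- kappa * r / flin kappa r).
Proof.
move=> N0; have d1 := is_derive_add (is_derive_const (1 : R) r (1 : R))
    (is_derive_opp (is_derive_mul (is_derive_const kappa r (1 : R)) (is_derive_pow 2 (is_derive_id r (1 : R))))).
apply: is_derive_eq (is_derive_comp1 d1 (is_derive1_sqrt N0)) _.
rewrite /= -/(flin kappa r) expr1; have : flin kappa r != 0 by rewrite gt_eqF // sqrtr_gt0.
by move: (flin kappa r) => s s0; field.
Qed.

End OneVariable.

(** * The homogeneous weight attached to a radius function *)

Section ConeWeight.
Context {R : realType} {n : nat}.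
Local Notation O := (@punctured R n).
Let oO := @open_punctured R n.
Variable rho : 'rV[R]_n -> R.
Hypothesis hrho : Ck O 3 (hext rho).
Hypothesis rho0 : forall x, sphere x -> 0 < rho x.

Definition cone_weight (y : 'rV[R]_n) : R := eucl y * (hext rho y)^-1.

Lemma hext_gt0 y : O y -> 0 < hext rho y.
Proof. by move=> Oy; apply: rho0; exact: sphere_normalize. Qed.

Lemma Ck_cone_weight : Ck O 3 cone_weight.
Proof.
apply: (CkM oO (Ck_eucl 3)); apply: (CkV oO) => // y Oy.
by rewrite gt_eqF // hext_gt0.
Qed.

Lemma cone_weight_gt0 y : O y -> 0 < cone_weight y.
Proof. by move=> Oy; rewrite mulr_gt0 ?eucl_gt0 // invr_gt0 hext_gt0. Qed.

Lemma hextZ (T : Type) (G : 'rV[R]_n -> T) c y : 0 < c -> hext G (c *: y) = hext G y.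
Proof.
move=> c0; rewrite /hext euclZ gtr0_norm //; congr G.
have [->|y0] := eqVneq y 0; first by rewrite !scaler0.
by rewrite scalerA; congr (_ *: _); field; rewrite eucl_neq0 // gt_eqF.
Qed.

Lemma cone_weightZ c y : 0 < c -> O y -> cone_weight (c *: y) = c * cone_weight y.
Proof. by move=> c0 Oy; rewrite /cone_weight hextZ // euclZ gtr0_norm // mulrA. Qed.

Lemma cone_weight_radial y : O y -> radial cone_weight y = hext rho y.
Proof.
move=> Oy; rewrite /radial /cone_weight invfM invrK mulrA mulfV ?mul1r //.
exact: eucl_neq0.
Qed.

Lemma cone_weight_position y i : position cone_weight i y = hext rho y * ((eucl y)^-1 *: y) 0 i.
Proof. by rewrite /position /cone_weight invfM invrK mxE; ring. Qed.

Lemma cone_weight_sphere x : sphere x -> cone_weight x = (rho x)^-1.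
Proof. by move=> sx; rewrite /cone_weight (sx : eucl x = 1) /hext (sx : eucl x = 1) invr1 scale1r mul1r. Qed.

Lemma cone_weight_point N (c l : 'rV[R]_N) (K : 'M[R]_(n, N)) y : O y ->
  cone_point cone_weight c l K y = c + hext rho y *: (l + ((eucl y)^-1 *: y) *m K).
Proof.
move=> Oy; rewrite /cone_point cone_weight_radial // -addrA scalerDr; congr (_ + (_ + _)).
rewrite scalemxAl; congr (_ *m K); apply/rowP => i.
by rewrite [LHS]mxE cone_weight_position [RHS]mxE.
Qed.

End ConeWeight.

(** * Null lines of the embedded static patch *)

Section NullLine.
Context {R : realType} {n : nat}.
Variables (kappa eps : R) (e1 e2 d1 d2 : R -> R).
Hypothesis de1 : forall t, is_derive t (1 : R) e1 (d1 t).
Hypothesis de2 : forall t, is_derive t (1 : R) e2 (d2 t).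
Hypothesis dd1 : forall t, is_derive t (1 : R) d1 (kappa * e1 t).
Hypothesis dd2 : forall t, is_derive t (1 : R) d2 (kappa * e2 t).
Local Notation N := (1 + (1 + n))%N.
Local Notation emb := (@quadric_emb R n kappa e1 e2).
Variables (s : R).
Hypothesis ss : s * s = 1.

Lemma quadric_emb_axial t r (x : 'rV[R]_n) : 0 <= r -> sphere x -> emb (event t (r *: x)) =
  axial (flin kappa r * e1 t) (flin kappa r * e2 t) + r *: (x *m space_mx).
Proof.
move=> r0 sx; rewrite /quadric_emb radius_event euclZ (sx : eucl x = 1) mulr1 ger0_norm //.
rewrite tcoord_event ycoord_event mul_space_mx; apply: eventP; rewrite !coordE !(tcoord_event, ycoord_event) ?mulr0 ?addr0 //.
by apply: eventP; rewrite !coordE !(tcoord_event, ycoord_event) ?mulr0 ?addr0 // add0r.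
Qed.

Lemma is_derive_tcoord (p c : 'rV[R]_(1 + n)) : is_derive p c (@tcoord R n) (tcoord c).
Proof.
have -> : @tcoord R n = (fun q => q 0 (lshift n 0)) by apply/funext => q; rewrite tcoordE.
exact: is_derive_coord.
Qed.

Section AtPoint.
Variables (t0 r0 : R) (x : 'rV[R]_n).
Hypothesis r0p : 0 < r0.
Hypothesis N0 : 0 < 1 - kappa * r0 ^+ 2.
Hypothesis sx : sphere x.
Let p := event t0 (r0 *: x).
Let c := event (flin kappa r0 ^- 2) (s *: x).
Let s0 : flin kappa r0 != 0. Proof. by rewrite gt_eqF // sqrtr_gt0. Qed.
Let rp : Defs.radius p = r0.
Proof. by rewrite radius_event euclZ (sx : eucl x = 1) mulr1 gtr0_norm. Qed.

Lemma is_derive_axial (e d : R -> R) : (forall t, is_derive t (1 : R) e (d t)) ->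
  is_derive p c (fun q => flin kappa (Defs.radius q) * e (tcoord q))
   (s * (s * d t0 / flin kappa r0 - kappa * r0 * e t0 / flin kappa r0)).
Proof.
move=> de.
have y0 : ycoord p != 0 by rewrite -radius_eq0 rp gt_eqF.
have N0' : 0 < 1 - kappa * Defs.radius p ^+ 2 by rewrite rp.
have D1 := is_derive_mul (is_derive_comp1 (is_derive_radius c y0) (is_derive_flin N0'))
  (is_derive_comp1 (is_derive_tcoord p c) (de (tcoord p))).
apply: is_derive_eq D1 _; rewrite /= rp !(tcoord_event, ycoord_event) dotZl dotZr.
have -> : dot x x = 1 by exact/sphereE.
rewrite [s * (_ - _)]mulrBr !mulrA ss; move: (flin kappa r0) s0 => f f0.
by field; rewrite f0 gt_eqF.
Qed.

Lemma derive_quadric_emb :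
  'D_c emb p = s *: (null_generator kappa e1 e2 d1 d2 s t0 r0 + x *m space_mx).
Proof.
pose G : 'rV[R]_N := s *: (null_generator kappa e1 e2 d1 d2 s t0 r0 + x *m space_mx).
have comp i : is_derive p c (fun q => emb q 0 i) (G 0 i).
  have GE : G = event (s * (s * d1 t0 / flin kappa r0 - kappa * r0 * e1 t0 / flin kappa r0))
     (event (s * (s * d2 t0 / flin kappa r0 - kappa * r0 * e2 t0 / flin kappa r0)) (s *: x)).
    rewrite /G /null_generator mul_space_mx; apply: eventP; rewrite !coordE !(tcoord_event, ycoord_event) ?addr0 //.
    by apply: eventP; rewrite !coordE !(tcoord_event, ycoord_event) ?addr0 ?add0r.
  rewrite GE; case: (@split_ordP 1 (1 + n) i) => [j ->|j ->].
    rewrite ord1 -tcoordE tcoord_event.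
    have -> : (fun q => emb q 0 (lshift (1 + n) 0)) = (fun q => flin kappa (Defs.radius q) * e1 (tcoord q)).
      by apply/funext => q; rewrite -tcoordE tcoord_event.
    exact: is_derive_axial.
  rewrite -ycoordE ycoord_event; case: (@split_ordP 1 n j) => [k ->|k ->].
    rewrite ord1 -tcoordE tcoord_event.
    have -> : (fun q => emb q 0 (rshift 1 (lshift n 0))) = (fun q => flin kappa (Defs.radius q) * e2 (tcoord q)).
      by apply/funext => q; rewrite -ycoordE ycoord_event -tcoordE tcoord_event.
    exact: is_derive_axial.
  rewrite -ycoordE ycoord_event.
  have -> : (fun q => emb q 0 (rshift 1 (rshift 1 k))) = (fun q => q 0 (rshift 1 k)).
    by apply/funext => q; rewrite -!ycoordE !ycoord_event.
  apply: is_derive_eq (is_derive_coord _ _ _) _.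
  by rewrite -ycoordE ycoord_event.
have dm : derivable emb p c.
  by apply/derivable_mxP => i j; rewrite ord1; case: (comp j).
rewrite -/G (derive_mx dm); apply/rowP => i; rewrite mxE.
by case: (comp i).
Qed.

(** The derivative of the embedding is s times the generator l + x K, so the parameter along the
    latter is the radius r0 + s lam. *)
Lemma quadric_null_line (lam : R) : emb p + lam *: 'D_c emb p =
  null_apex kappa e1 e2 d1 d2 s t0 r0
   + (r0 + s * lam) *: (null_generator kappa e1 e2 d1 d2 s t0 r0 + x *m space_mx).
Proof.
rewrite derive_quadric_emb quadric_emb_axial // ?ltW // /null_apex.
move: (axial _ _) (null_generator _ _ _ _ _ _ _ _) (x *m space_mx) => A l K.
by apply/rowP => i; rewrite !mxE; ring.
Qed.

End AtPoint.

Section Interval.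
Variables (J : set R) (rstar : R -> R) (w0 : R).
Hypothesis iJ : is_interval J.
Hypothesis NJ : forall r, J r -> 0 < 1 - kappa * r ^+ 2.
Hypothesis dstar : forall r, J r -> is_derive r (1 : R) rstar ((1 - kappa * r ^+ 2)^-1).

Let tau r := w0 + s * rstar r.

(** Along t = w0 + s r* the ambient coordinates are affine in r: the derivative [lv] of the
    coordinate has itself derivative 0, by e'' = kappa e. This identifies the cones of the static
    spacetime with ambient cones. *)
Lemma axial_line (e d : R -> R) r0 r : (forall t, is_derive t (1 : R) e (d t)) ->
  (forall t, is_derive t (1 : R) d (kappa * e t)) -> J r0 -> J r ->
  flin kappa r * e (tau r) = flin kappa r0 * e (tau r0)
   + (r - r0) * (s * d (tau r0) / flin kappa r0 - kappa * r0 * e (tau r0) / flin kappa r0).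
Proof.
move=> de ded Jr0 Jr.
pose lv r := s * d (tau r) * (flin kappa r)^-1 - kappa * r * e (tau r) * (flin kappa r)^-1.
have s0 t : J t -> flin kappa t != 0 by move=> Jt; rewrite gt_eqF // sqrtr_gt0 NJ.
have s2 t : J t -> (1 - kappa * t ^+ 2)^-1 = flin kappa t ^- 2.
  by move=> Jt; rewrite sqr_sqrtr // ltW // NJ.
have dtau t : J t -> is_derive t (1 : R) tau (s * flin kappa t ^- 2).
  move=> Jt; have := is_derive_add (is_derive_const w0 t (1 : R))
    (is_derive_mul (is_derive_const s t (1 : R)) (dstar Jt)).
  by rewrite mulr0 addr0 add0r s2.
have dlv t : J t -> is_derive t (1 : R) lv 0.
  move=> Jt; have Ds := is_derive_inv (s0 t Jt) (is_derive_flin (NJ Jt)).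
  have De := is_derive_comp1 (dtau t Jt) (de (tau t)).
  have Dd := is_derive_comp1 (dtau t Jt) (ded (tau t)).
  have D1 := is_derive_add
    (is_derive_mul (is_derive_mul (is_derive_const s t (1 : R)) Dd) Ds)
    (is_derive_opp (is_derive_mul (is_derive_mul (is_derive_mul (is_derive_const kappa t (1 : R))
       (is_derive_id t (1 : R))) De) Ds)).
  apply: is_derive_eq D1 _; rewrite /=.
  have ks : kappa * t ^+ 2 = 1 - flin kappa t ^+ 2 by rewrite sqr_sqrtr ?ltW ?NJ //; ring.
  move: (s0 t Jt) ks; move: (flin kappa t) (e (tau t)) (d (tau t)) => f E D f0 ks.
  transitivity (kappa * E / f ^+ 3 * (s * s - kappa * t ^+ 2 - f ^+ 2)); first by field.
  by rewrite ss ks; ring.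
have lvE t : J t -> lv t = lv r0 by move=> Jt; exact: (constant_on_interval iJ dlv).
pose h t := flin kappa t * e (tau t) - t * lv r0.
have dh t : J t -> is_derive t (1 : R) h 0.
  move=> Jt; have D1 := is_derive_add (is_derive_mul (is_derive_flin (NJ Jt))
     (is_derive_comp1 (dtau t Jt) (de (tau t))))
     (is_derive_opp (is_derive_mul (is_derive_id t (1 : R)) (is_derive_const (lv r0) t (1 : R)))).
  apply: is_derive_eq D1 _; rewrite /= -(lvE t Jt) /lv.
  have := s0 t Jt; move: (flin kappa t) (e (tau t)) (d (tau t)) => f E D f0.
  by field.
have := constant_on_interval iJ dh Jr Jr0; rewrite /h -/(lv r0) => H.
rewrite -[X in (r - r0) * X]/(lv r0) -[LHS](subrK (r * lv r0)) H.
by ring.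
Qed.

End Interval.
End NullLine.

(** * Anti-de Sitter and de Sitter space as instances *)

Section Models.
Context {R : realType}.

(* The curve t |-> (e1 t, e2 t) is the orbit of the static observer at r = 0. *)
Record axial_curve (kappa eps : R) (e1 e2 d1 d2 : R -> R) : Prop := AxialCurve {
  axial_eps : eps * eps = 1;
  axial_ee : forall t, - e1 t * e1 t + eps * e2 t * e2 t = kappa^-1;
  axial_ed : forall t, - e1 t * d1 t + eps * e2 t * d2 t = 0;
  axial_dd : forall t, - d1 t * d1 t + eps * d2 t * d2 t = -1;
  axial_de1 : forall t, is_derive t (1 : R) e1 (d1 t);
  axial_de2 : forall t, is_derive t (1 : R) e2 (d2 t);
  axial_dd1 : forall t, is_derive t (1 : R) d1 (kappa * e1 t);
  axial_dd2 : forall t, is_derive t (1 : R) d2 (kappa * e2 t);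
  axial_wedge : 0 < kappa -> eps = 1 /\ forall t, `|e1 t| < e2 t }.

Definition quadric_space_form (n : nat) (kappa eps : R) (e1 e2 : R -> R) : space_form R n :=
  @SpaceForm R n (1 + (1 + n)) (quadric_form eps) (quadric_emb kappa e1 e2) [set 0].

Let is_derive_dilation (k t : R) (h : R -> R) (dh : R) : is_derive (k * t) (1 : R) h dh ->
  is_derive t (1 : R) (fun t => h (k * t)) (dh * k).
Proof.
move=> D; have D0 := is_derive_mul (is_derive_const k t (1 : R)) (is_derive_id t (1 : R)).
by apply: is_derive_eq (is_derive_comp1 D0 D) _; rewrite /= mulr0 addr0 mulr1.
Qed.

Let scaled (h : R -> R) c t dh : is_derive t (1 : R) h dh -> is_derive t (1 : R) (fun t => h t * c) (dh * c).
Proof.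
move=> D; apply: is_derive_eq (is_derive_mul D (is_derive_const c t (1 : R))) _.
by rewrite mulr0 add0r mulrC.
Qed.

Lemma anti_de_sitter_quadric n (kappa : R) : kappa < 0 -> exists eps e1 e2 d1 d2,
  axial_curve kappa eps e1 e2 d1 d2 /\ anti_de_sitter n kappa = quadric_space_form n kappa eps e1 e2.
Proof.
move=> kn; rewrite /anti_de_sitter; set k := Num.sqrt _.
have k2 : kappa = - k ^+ 2 by rewrite sqr_sqrtr ?opprK // oppr_ge0 ltW.
have k0 : k != 0 by rewrite gt_eqF // sqrtr_gt0 oppr_gt0.
have cs t : cos (k * t) ^+ 2 = 1 - sin (k * t) ^+ 2 by rewrite -(cos2Dsin2 (k * t)) addrK.
exists (-1), (fun t => cos (k * t) * k^-1), (fun t => sin (k * t) * k^-1),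
  (fun t => - sin (k * t)), (fun t => cos (k * t)); split; first split.
- by rewrite mulrNN mulr1.
- move=> t; transitivity (- (cos (k * t) ^+ 2 + sin (k * t) ^+ 2) / k ^+ 2); first by field.
  by rewrite cos2Dsin2 k2; field.
- by move=> t; field.
- move=> t; transitivity (- (cos (k * t) ^+ 2 + sin (k * t) ^+ 2)); first by ring.
  by rewrite cos2Dsin2.
- move=> t; apply: is_derive_eq (scaled k^-1 (is_derive_dilation (is_derive_cos (k * t)))) _.
  by field.
- move=> t; apply: is_derive_eq (scaled k^-1 (is_derive_dilation (is_derive_sin (k * t)))) _.
  by field.
- move=> t; apply: is_derive_eq (is_derive_opp (is_derive_dilation (is_derive_sin (k * t)))) _.
  by rewrite k2; field.
- move=> t; apply: is_derive_eq (is_derive_dilation (is_derive_cos (k * t))) _.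
  by rewrite k2; field.
- by move=> kp; move: (lt_trans kp kn); rewrite ltxx.
rewrite /quadric_space_form; congr SpaceForm; apply/funext => p.
by rewrite /quadric_emb -!mulrA ![k^-1 * _]mulrC.
Qed.

Lemma de_sitter_quadric n (kappa : R) : 0 < kappa -> exists eps e1 e2 d1 d2,
  axial_curve kappa eps e1 e2 d1 d2 /\ de_sitter n kappa = quadric_space_form n kappa eps e1 e2.
Proof.
move=> kp; rewrite /de_sitter; set k := Num.sqrt _.
have k2 : kappa = k ^+ 2 by rewrite sqr_sqrtr // ltW.
have kpos : 0 < k by rewrite sqrtr_gt0.
have k0 : k != 0 by rewrite gt_eqF.
have ex t : expR (k * t) * expR (- (k * t)) = 1 by rewrite -expRD subrr expR0.
have dp t : is_derive t (1 : R) (fun t => expR (k * t)) (expR (k * t) * k).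
  exact: is_derive_dilation (is_derive_expR (k * t)).
have dm t : is_derive t (1 : R) (fun t => expR (- (k * t))) (- (expR (- (k * t)) * k)).
  have D := is_derive_dilation (k := - k) (t := t) (is_derive_expR (- k * t)).
  have -> : (fun t => expR (- (k * t))) = (fun t => expR (- k * t)) by apply/funext => u; rewrite mulNr.
  by apply: is_derive_eq D _; rewrite mulNr mulrN.
pose sh t := (expR (k * t) - expR (- (k * t))) / 2; pose ch t := (expR (k * t) + expR (- (k * t))) / 2.
have dsh t : is_derive t (1 : R) sh (k * ch t).
  apply: is_derive_eq (scaled 2^-1 (is_derive_add (dp t) (is_derive_opp (dm t)))) _.
  by rewrite /ch; move: (expR _) (expR _) => a b; field.
have dch t : is_derive t (1 : R) ch (k * sh t).
  apply: is_derive_eq (scaled 2^-1 (is_derive_add (dp t) (dm t))) _.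
  by rewrite /sh; move: (expR _) (expR _) => a b; field.
have hyp t : ch t * ch t - sh t * sh t = 1.
  by rewrite -(ex t) /sh /ch; move: (expR _) (expR _) => a b; field.
exists 1, (fun t => sh t * k^-1), (fun t => ch t * k^-1), ch, sh; split; first split.
- by rewrite mulr1.
- move=> t; transitivity ((ch t * ch t - sh t * sh t) / k ^+ 2); first by field.
  by rewrite hyp k2; field.
- by move=> t; move: (sh t) (ch t) => a b; field.
- move=> t; transitivity (- (ch t * ch t - sh t * sh t)); first by ring.
  by rewrite hyp.
- by move=> t; apply: is_derive_eq (scaled k^-1 (dsh t)) _; field.
- by move=> t; apply: is_derive_eq (scaled k^-1 (dch t)) _; field.
- by move=> t; apply: is_derive_eq (dch t) _; rewrite k2; field.
- by move=> t; apply: is_derive_eq (dsh t) _; rewrite k2; field.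
- move=> _; split=> // t; rewrite normrM (gtr0_norm (x := k^-1)) ?invr_gt0 // ltr_pM2r ?invr_gt0 //.
  have p1 := expR_gt0 (k * t); have p2 := expR_gt0 (- (k * t)).
  by rewrite ltr_norml /sh /ch; move: (expR _) (expR _) p1 p2 => a b p1 p2; apply/andP; split; lra.
rewrite /quadric_space_form; congr SpaceForm.
  by rewrite /quadric_form -scalar_mx_block.
by apply/funext => p; rewrite /quadric_emb -!mulrA ![k^-1 * _]mulrC !mulrA.
Qed.

Lemma model_quadric n (kappa : R) : kappa != 0 -> exists eps e1 e2 d1 d2,
  axial_curve kappa eps e1 e2 d1 d2 /\ model n kappa = quadric_space_form n kappa eps e1 e2.
Proof.
move=> k0; rewrite /model (negbTE k0); have [kn|kp] := ltP kappa 0.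
  exact: anti_de_sitter_quadric.
by apply: de_sitter_quadric; rewrite lt_neqAle eq_sym k0.
Qed.

(** The last clause isolates anti-de Sitter and de Sitter space, where 0 is the only translation and
    the map is linear. *)
Lemma lorentz_affine N (B : 'M[R]_N) (T : set 'rV[R]_N) phi : lorentz B T phi ->
  exists L a, [/\ isometry_mx B L, phi = (fun X => X *m L + a) & (forall b, T b -> b = 0) -> a = 0].
Proof.
elim=> [L iL|a Ta|f g _ [L [a [iL -> a0]]] _ [L' [a' [iL' -> a0']]]].
- by exists L, 0; split=> //; apply/funext => X; rewrite addr0.
- exists 1%:M, a; split; [|by apply/funext => X; rewrite mulmx1|by apply].
  by rewrite /isometry_mx trmx1 mulmx1 mul1mx.
exists (L' *m L), (a' *m L + a); split; first exact: isometryM.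
  by apply/funext => X /=; rewrite mulmxDl mulmxA addrA.
by move=> T0; rewrite a0 // a0' // mul0mx addr0.
Qed.

End Models.

Section MovedRigidity.
Context {R : realType} {n : nat}.
Hypothesis n3 : (3 <= n)%N.
Local Notation O := (@punctured R n).
Variables (rho : 'rV[R]_n -> R) (kappa c : R).
Hypothesis hrho : Ck O 3 (hext rho).
Hypothesis rho0 : forall x, sphere x -> 0 < rho x.
Local Notation W := (cone_weight rho).
Hypothesis eqn : forall x, sphere x ->
  (n%:R - 1) * (2 * W x * laplacian W x - (n%:R - 1) * (gradsq W x + kappa)) = c.

Lemma moved_rigidity : exists a be, forall x, sphere x -> rho x * (a + dot x be) = 1.
Proof.
have mE : n.-1%:R = n%:R - 1 :> R by rewrite -subn1 natrB // (leq_trans _ n3).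
have m0 : n%:R - 1 != 0 :> R by rewrite -mE pnatr_eq0 -lt0n -subn1 subn_gt0 (leq_trans _ n3).
(* The constant value of Q, from the equation divided by (n - 1)^2; the primitive of C / (2 w^2) is
   then explicit. *)
pose C := c / (n%:R - 1) ^+ 2 + kappa.
have W0 := cone_weight_gt0 rho0.
have hQ x : O x -> is_derive (W x * (eucl x)^-1) (1 : R) (fun=> C) 0 by move=> _; exact: is_derive_const.
have hPsi x : O x -> is_derive (W x * (eucl x)^-1) (1 : R) (fun w => - (C / 2) * w^-1)
    (C / (2 * (W x * (eucl x)^-1) ^+ 2)).
  move=> Ox; have : W x * (eucl x)^-1 != 0.
    by rewrite mulf_neq0 ?invr_eq0 ?eucl_neq0 // gt_eqF // W0.
  move: (W x * _) => w w0.
  have D := is_derive_mul (is_derive_const (- (C / 2)) w (1 : R)) (is_derive_inv w0 (is_derive_id w (1 : R))).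
  by apply: is_derive_eq D _; field.
have hC x : sphere x -> 2 / n.-1%:R * W x * laplacian W x - gradsq W x = C.
  move=> sx; rewrite mE /C -(eqn sx); move: (W x) (laplacian _ _) (gradsq _ _) => w D E.
  by field.
have [a [be [WE _]]] := @rigidity R n W (fun=> C) (fun=> 0) _ n3 (Ck_cone_weight hrho rho0) W0
  (fun c' x => @cone_weightZ R n rho c' x) hQ (fun _ _ => lexx 0) hPsi hC.
exists a, be => x sx; have := WE _ (punctured_sphere sx).
rewrite cone_weight_sphere // (sx : eucl x = 1) mulr1 => <-.
by rewrite mulfV // gt_eqF // rho0.
Qed.

End MovedRigidity.

(** * Spheres of symmetry *)

Section SpaceFormRegion.
Context {R : realType} {n : nat}.
Hypothesis n3 : (3 <= n)%N.
Local Notation O := (@punctured R n).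
Variables (f : R -> R) (I J : set R) (F : 'rV[R]_n -> 'rV[R]_(1 + n)) (kappa : R).
Hypothesis nJ : nondegenerate_interval J.
Hypothesis JI : J `<=` I.
Hypothesis I0 : forall r, I r -> 0 <= r.
Hypothesis fI : forall r, I r -> 0 < f r.
Hypothesis dfI : forall r, I r -> derivable f r 1.
Hypothesis hJ : forall r, J r -> f r ^+ 2 = 1 - kappa * r ^+ 2.
Hypothesis sF : smooth_sphere F.
Hypothesis FJ : forall x, sphere x -> J (Defs.radius (F x)).
Variables (s : R) (rho : 'rV[R]_n -> R).
Hypothesis ss : s * s = 1.
Hypothesis rho0 : forall x, sphere x -> 0 < rho x.

Let n0 : (0 < n)%N := leq_trans (isT : (0 < 3)%N) n3.
Let J0 r (Jr : J r) : 0 <= r := I0 (JI Jr).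
Let fJ r (Jr : J r) : 0 < f r := fI (JI Jr).
Let dfJ r (Jr : J r) : derivable f r 1 := dfI (JI Jr).
Let FJO y (Oy : O y) : J (Defs.radius (hext F y)) := FJ (sphere_normalize Oy).

Let region : in_space_form_region f I (F @` @sphere R n) kappa.
Proof. by exists J; split=> // p [x sx <-]; exact: FJ. Qed.

Let Fp x : sphere x -> 0 < 1 - kappa * Defs.radius (F x) ^+ 2.
Proof. by move=> sx; have Jx := FJ sx; rewrite -hJ // exprn_gt0 // fJ. Qed.

Section Quadric.
Hypothesis k0 : kappa != 0.
Variables (eps : R) (e1 e2 d1 d2 : R -> R).
Hypothesis AC : axial_curve kappa eps e1 e2 d1 d2.
Hypothesis hM : model n kappa = quadric_space_form n kappa eps e1 e2.
Variables (t0 r0 : R).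
Hypothesis r0p : 0 < 1 - kappa * r0 ^+ 2.
Variable L0 : 'M[R]_(1 + (1 + n)).
Hypothesis iL0 : isometry_mx (quadric_form eps) L0.
Local Notation V := (null_apex kappa e1 e2 d1 d2 s t0 r0).
Local Notation l := (null_generator kappa e1 e2 d1 d2 s t0 r0).
Hypothesis embF : forall x, sphere x ->
  quadric_emb kappa e1 e2 (F x) = (V + rho x *: (l + x *m space_mx)) *m L0.

(** Kept apart from the mean curvature equation: graphs in cones of the static spacetime reach this
    point from [static_rigidity]. *)
Lemma quadric_section_symmetric (a : R) (be : 'rV[R]_n) :
  (forall x, sphere x -> rho x * (a + dot x be) = 1) ->
  sphere_of_symmetry f I (F @` @sphere R n).
Proof.
case: (AC) => eps2 ee ed dd de1 de2 dd1 dd2 wd rhoE.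
have [r1 [pr1 [L iL E]]] := quadric_sphere n0 k0 eps2 ee ed dd wd ss r0p iL0 Fp rho0 rhoE embF.
right; exists kappa, 0, r1; rewrite hM /=.
by exists (fun X => X *m L); split=> //; exact: lorentz_linear.
Qed.

Hypothesis hrho : Ck O 3 (hext rho).
Hypothesis hH : constant_norm_mean_curvature (static_metric f) F.

Lemma quadric_cone_symmetric : sphere_of_symmetry f I (F @` @sphere R n).
Proof.
case: (AC) => eps2 ee ed dd de1 de2 dd1 dd2 wd; case: hH => c hc.
have Bsym := @quadric_form_sym R n eps.
suff eqn x : sphere x -> (n%:R - 1) * (2 * cone_weight rho x * laplacian (cone_weight rho) x
    - (n%:R - 1) * (gradsq (cone_weight rho) x + kappa)) = c.
  have [a [be rhoE]] := moved_rigidity n3 hrho rho0 eqn.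
  exact: quadric_section_symmetric rhoE.
move=> sx; rewrite -(hc x sx); symmetry.
apply: (@quadric_cone_mean_curvature _ _ kappa eps e1 e2 d1 d2 k0 ee ed dd de1 de2 dd1 dd2 F f J nJ J0 hJ fJ dfJ sF FJO
  (cone_weight rho) (V *m L0) (l *m L0) (space_mx *m L0) (Ck_cone_weight hrho rho0) (cone_weight_gt0 rho0)
  (fun c' x => @cone_weightZ R n rho c' x) _ _ _ _ x sx).
- by rewrite (isometryE _ _ iL0); exact: null_generator_form.
- by move=> u; rewrite mulmxA (isometryE _ _ iL0) axial_space.
- by move=> u v; rewrite !mulmxA (isometryE _ _ iL0) space_space.
move=> y Oy; rewrite cone_weight_point // [LHS](embF (sphere_normalize Oy)).
move: V l => v g; by rewrite mulmxDl -scalemxAl mulmxDl mulmxA.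
Qed.

End Quadric.

Section Flat.
Hypothesis k0 : kappa = 0.
Variables (V : 'rV[R]_(1 + n)) (L0 : 'M[R]_(1 + n)) (b : 'rV[R]_(1 + n)).
Local Notation B := (block_mx (-1)%:M 0 0 1%:M : 'M[R]_(1 + n)).
Hypothesis iL0 : isometry_mx B L0.
Hypothesis lorV : lorentz B (range (fun c : R => event c 0)) (fun X : 'rV[R]_(1 + n) => (X + V) *m L0 + b).
Hypothesis embF : forall x, sphere x ->
  F x = (V + rho x *: (event s 0 + x *m flat_space_mx)) *m L0 + b.

Lemma flat_section_symmetric (a : R) (be : 'rV[R]_n) :
  (forall x, sphere x -> rho x * (a + dot x be) = 1) ->
  sphere_of_symmetry f I (F @` @sphere R n).
Proof.
move=> rhoE.
have [r1 [r1p [L iL E]]] := flat_sphere (phi := fun X => X *m L0 + b) n0 ss rho0 rhoE embF.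
right; exists kappa, 0, r1; rewrite k0 /model eqxx /=.
exists (fun X => ((X + event (s * r1) 0) *m L + V) *m L0 + b); split.
- by move: region; rewrite k0.
- by rewrite /patch_radius mul0r subr0.
- apply: (@lorentz_comp _ _ _ _ (fun X => (X + V) *m L0 + b) (fun X => (X + event (s * r1) 0) *m L)) => //.
  apply: (@lorentz_comp _ _ _ _ (fun X => X *m L) (fun X => X + event (s * r1) 0)).
    exact: lorentz_linear.
  by apply: lorentz_translation; exists (s * r1).
by rewrite !image_id.
Qed.

Hypothesis hrho : Ck O 3 (hext rho).
Hypothesis hH : constant_norm_mean_curvature (static_metric f) F.

Lemma flat_cone_symmetric : sphere_of_symmetry f I (F @` @sphere R n).
Proof.
case: hH => c hc.
suff eqn x : sphere x -> (n%:R - 1) * (2 * cone_weight rho x * laplacian (cone_weight rho) x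
    - (n%:R - 1) * (gradsq (cone_weight rho) x + 0)) = c.
  have [a [be rhoE]] := moved_rigidity n3 hrho rho0 eqn.
  exact: flat_section_symmetric rhoE.
move=> sx; rewrite -(hc x sx); symmetry.
have hJ1 r : J r -> f r ^+ 2 = 1 by move=> Jr; rewrite hJ // k0 mul0r subr0.
apply: (@flat_cone_mean_curvature _ _ F f J nJ J0 hJ1 fJ dfJ sF FJO
  (cone_weight rho) (V *m L0 + b) (event s 0 *m L0) (flat_space_mx *m L0) (Ck_cone_weight hrho rho0) (cone_weight_gt0 rho0)
  (fun c' x => @cone_weightZ R n rho c' x) _ _ _ _ x sx).
- by rewrite (isometryE _ _ iL0) flat_time_time.
- by move=> u; rewrite mulmxA (isometryE _ _ iL0) flat_time_space.
- by move=> u v; rewrite !mulmxA (isometryE _ _ iL0) flat_space_space.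
move=> y Oy; rewrite cone_weight_point // [LHS](embF (sphere_normalize Oy)).
by rewrite mulmxDl -scalemxAl mulmxDl mulmxA addrAC.
Qed.

End Flat.
End SpaceFormRegion.

Lemma cone_sign_sqr {R : realType} (o : bool) : cone_sign R o * cone_sign R o = 1.
Proof. by case: o; rewrite /cone_sign ?mulrNN mulr1. Qed.

Section MovedCone.
Context {R : realType} {n : nat}.
Hypothesis n3 : (3 <= n)%N.
Variables (f : R -> R) (I : set R) (F : 'rV[R]_n -> 'rV[R]_(1 + n)).
Hypothesis I0 : forall r, I r -> 0 <= r.
Hypothesis fI : forall r, I r -> 0 < f r.
Hypothesis dfI : forall r, I r -> derivable f r 1.
Hypothesis sF : smooth_sphere F.
Hypothesis hH : constant_norm_mean_curvature (static_metric f) F.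

Lemma moved_cone_symmetric : graph_in_moved_cone f I F ->
  sphere_of_symmetry f I (F @` @sphere R n).
Proof.
have oO := @open_punctured R n.
have Crho (s r0 : R) (lam : 'rV[R]_n -> R) : smooth_sphere lam ->
    Ck (@punctured R n) 3 (hext (fun x => r0 + s * lam x)).
  move=> sl; apply: (CkD oO); first exact: Ck_cst.
  by apply: (CkZ oO); exact: (smooth_on_Ck 3 sl).
case=> kappa [t0 [r0]]; have [k0|k0] := eqVneq kappa 0.
  rewrite k0 /model eqxx /= => -[phi [og [lam]]]; set s := cone_sign R og.
  have ss : s * s = 1 := cone_sign_sqr og.
  move=> [[J [nJ JI hJ FJ]] _ lor sl h].
  have [L0 [b [iL0 phiE _]]] := lorentz_affine lor.
  (* Vertex of the light cone through the sphere t = t0, r = r0. *)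
  pose V : 'rV[R]_(1 + n) := event (t0 - s * r0) 0.
  apply: (@flat_cone_symmetric _ _ n3 f I J F 0 nJ JI I0 fI dfI hJ sF _ s (fun x => r0 + s * lam x) ss _ erefl V L0 b iL0).
  - by move=> x sx; apply: FJ; exists x.
  - by move=> x sx; case: (h x sx).
  - rewrite phiE in lor; apply: (@lorentz_comp _ _ _ _ (fun X => X *m L0 + b) (fun X => X + V)) => //.
    by apply: lorentz_translation; exists (t0 - s * r0).
  - move=> x sx; have [_ ->] := h x sx; rewrite phiE derive_id; congr (_ *m L0 + b).
    rewrite /flin mul0r subr0 sqrtr1 expr1n invr1 mul_flat_space_mx /V.
    apply: eventP; rewrite !coordE !(tcoord_event, ycoord_event).
      have -> : t0 - s * r0 + (r0 + s * lam x) * (s + 0) = t0 + (s * s) * lam x by ring.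
      by rewrite ss mul1r mulr1.
    by rewrite !add0r scalerA -scalerDl [lam x * s]mulrC.
  - exact: Crho.
  exact: hH.
have [eps [e1 [e2 [d1 [d2 [AC hM]]]]]] := model_quadric n k0.
rewrite hM /= => -[phi [og [lam]]]; set s := cone_sign R og.
have ss : s * s = 1 := cone_sign_sqr og.
move=> [[J [nJ JI hJ FJ]] [r0p N0] lor sl h].
have [L0 [b [iL0 phiE b0]]] := lorentz_affine lor.
have {}b0 : b = 0 by apply: b0 => c ->.
apply: (@quadric_cone_symmetric _ _ n3 f I J F kappa nJ JI I0 fI dfI hJ sF _ s (fun x => r0 + s * lam x) ss _
  k0 eps e1 e2 d1 d2 AC hM t0 r0 N0 L0 iL0).
- by move=> x sx; apply: FJ; exists x.
- by move=> x sx; case: (h x sx).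
- move=> x sx; have [_ ->] := h x sx; rewrite phiE b0 addr0; congr (_ *m L0).
  case: AC => _ _ _ _ de1 de2 _ _ _.
  exact: quadric_null_line.
- exact: Crho.
exact: hH.
Qed.

End MovedCone.

(** Continuity is given on [p, q] only, while a two-sided derivative is wanted at the ends too:
    composing with the projection onto [p, q] extends [h] continuously to the line, and the integral
    starts at p - 1. *)
Lemma antiderivative {R : realType} (h : R -> R) (p q : R) : p <= q ->
  (forall w, p <= w <= q -> {for w, continuous h}) ->
  exists Psi : R -> R, forall w, p <= w <= q -> is_derive w (1 : R) Psi (h w).
Proof.
move=> pq ch; pose clamp (w : R) : R := Num.max p (Num.min w q).
have clamp_in w : p <= clamp w <= q.
  by rewrite /clamp le_max lexx /= ge_max pq ge_min lexx orbT.
have clampE w : p <= w <= q -> clamp w = w.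
  by move=> /andP[pw wq]; rewrite /clamp (min_l wq) (max_r pw).
have cc : continuous clamp.
  move=> w; apply: (@continuous_max R R (fun=> p) (fun w => Num.min w q)); first exact: cst_continuous.
  by apply: (@continuous_min R R id (fun=> q)); [exact: cvg_id|exact: cst_continuous].
have cg : continuous (h \o clamp).
  by move=> w; apply: continuous_comp; [exact: cc|exact: ch].
exists (fun x => \int[lebesgue_measure]_(t in [set` `[p - 1, x]]) (h \o clamp) t)%R => w pwq.
have [||||dF FE] := @continuous_FTC1_closed R (h \o clamp) (p - 1) w (w + 1).
- by rewrite ltrDl.
- apply: continuous_compact_integrable; first exact: segment_compact.
  by apply: continuous_subspaceT => x; exact: cg.
- by case/andP: pwq => pw _; rewrite ltrBlDr (le_lt_trans pw) // ltrDl.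
- exact: cg.
split; first exact: dF.
by rewrite -derive1E FE /= clampE.
Qed.

Section UnitVectors.
Context {R : realType} {n : nat}.
Hypothesis n2 : (2 <= n)%N.

Lemma orthogonal_exists (be : 'rV[R]_n) : exists2 x, sphere x & dot x be = 0.
Proof.
have K0 : kermx be^T != 0.
  rewrite kermx_eq0 -row_leq_rank -ltnNge (leq_ltn_trans (rank_leq_col _)) //.
pose q := nz_row (kermx be^T).
have q0 : q != 0 by rewrite nz_row_eq0.
exists ((eucl q)^-1 *: q); first exact: sphere_normalize.
rewrite dotZl -dot_mx; have /sub_kermxP -> := nz_row_sub (kermx be^T).
by rewrite mxE mulr0.
Qed.

(** A multiple of [be] with the right product, completed to a unit vector by an orthogonal one. It
    makes x.be reach every value needed to cover the range of the radius. *)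
Lemma level_exists (be : 'rV[R]_n) t : t ^+ 2 < dot be be -> exists2 x, sphere x & dot x be = t.
Proof.
move=> tb; have [q sq qb] := orthogonal_exists be.
have b0 : 0 < dot be be by apply: le_lt_trans tb; exact: sqr_ge0.
have b1 : dot be be != 0 by rewrite gt_eqF.
pose c := Num.sqrt (1 - t ^+ 2 / dot be be).
have c2 : c ^+ 2 = 1 - t ^+ 2 / dot be be.
  by rewrite sqr_sqrtr // subr_ge0 ler_pdivrMr // mul1r ltW.
exists ((t / dot be be) *: be + c *: q); last by rewrite dotDl !dotZl qb; field.
apply/sphereE; rewrite dotDl !dotDr !dotZl !dotZr qb [dot be q]dotC qb.
have -> : dot q q = 1 by exact/sphereE.
by rewrite !mulr0 add0r addr0 mulr1 -expr2 c2; field.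
Qed.

End UnitVectors.

(** * Graphs in the cones of the static spacetime *)

Section StaticCone.
Context {R : realType} {n : nat}.
Hypothesis n3 : (3 <= n)%N.
Variables (f : R -> R) (I : set R) (F : 'rV[R]_n -> 'rV[R]_(1 + n)).
Hypothesis iI : is_interval I.
Hypothesis I0 : forall r, I r -> 0 <= r.
Hypothesis fI : forall r, I r -> 0 < f r.
Hypothesis dfI : forall r, I r -> derivable f r 1.
Hypothesis hf : forall r, I r -> 0 < r ->
  (f r ^+ 2 - 1) / r ^+ 2 - f r * 'D_1 f r / r <= 0.
Hypothesis sF : smooth_sphere F.
Hypothesis hH : constant_norm_mean_curvature (static_metric f) F.
Local Notation O := (@punctured R n).
Let oO := @open_punctured R n.
Variables (s w0 : R) (rstar : R -> R) (rho : 'rV[R]_n -> R).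
Hypothesis ss : s * s = 1.
Hypothesis dstar : forall r, I r -> is_derive r (1 : R) rstar (f r ^- 2).
Hypothesis rho0 : forall x, sphere x -> 0 < rho x.
Hypothesis rhoI : forall x, sphere x -> I (rho x).
Hypothesis yF : forall x, sphere x -> ycoord (F x) = rho x *: x.
Hypothesis tF : forall x, sphere x -> tcoord (F x) = w0 + s * rstar (rho x).
Local Notation W := (cone_weight rho).

(** The radius is the inner product of [ycoord (F x)] with x, hence inherits its smoothness from
    [F]. *)
Let hrho : Ck O 3 (hext rho).
Proof.
apply: (@Ck_eq _ _ _ oO _ (fun y => \sum_i ycoord (hext F y) 0 i * (y 0 i * (eucl y)^-1))).
  move=> y Oy; have sy := sphere_normalize Oy.
  rewrite [ycoord (hext F y)](yF sy); set z := _ *: y.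
  transitivity (\sum_i rho z * (z 0 i * z 0 i)).
    by apply: eq_bigr => i _; rewrite !mxE; ring.
  rewrite -mulr_sumr -[X in _ * X]/(dot z z).
  by have /sphereE -> := sy; rewrite mulr1.
apply: (Ck_sum oO) => i _; apply: (CkM oO); first exact: Ck_ycoord.
apply: (CkM oO); first exact: Ck_coord.
by apply: (CkV oO) (Ck_eucl 3) => y Oy; exact: eucl_neq0.
Qed.

(* r^2 times the derivative of (f^2 - 1) / r^2. *)
Definition mass_slope (r : R) : R := 2 * f r * 'D_1 f r - 2 * (f r ^+ 2 - 1) / r.

Lemma static_rigidity : exists a be, (forall x, sphere x -> rho x * (a + dot x be) = 1) /\
  (forall x, sphere x -> mass_slope (rho x) * (dot be be - dot x be ^+ 2) = 0).
Proof.
have mE : n.-1%:R = n%:R - 1 :> R by rewrite -subn1 natrB // (leq_trans _ n3).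
have m0 : n%:R - 1 != 0 :> R by rewrite -mE pnatr_eq0 -lt0n -subn1 subn_gt0 (leq_trans _ n3).
case: hH => c hc.
have hW := Ck_cone_weight hrho rho0.
have W0 := cone_weight_gt0 rho0.
have homW c' x := @cone_weightZ R n rho c' x.
pose C := c / (n%:R - 1) ^+ 2.
pose Q (w : R) := C - (f w^-1 ^+ 2 - 1) * w ^+ 2.
pose dQ (w : R) := 2 * f w^-1 * 'D_1 f w^-1 - 2 * w * (f w^-1 ^+ 2 - 1).
have WV x : sphere x -> (W x)^-1 = rho x by move=> sx; rewrite cone_weight_sphere // invrK.
have wdE x : O x -> W x * (eucl x)^-1 = W ((eucl x)^-1 *: x).
  by move=> Ox; rewrite homW ?invr_gt0 ?eucl_gt0 // mulrC.
(* The compact range of [W]. Reciprocals of its points lie between two attained radii, hence in [I],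
   and [antiderivative] provides [Psi] there. *)
have [p [q [pq p0 pqI Wpq]]] : exists p q, [/\ p <= q, 0 < p, forall w, p <= w <= q -> I w^-1 &
    forall x, sphere x -> p <= W x <= q].
  have cW : {within @sphere R n, continuous W}.
    apply: continuous_in_subspaceT => x; rewrite inE => sx.
    exact: Ck_continuous hW (punctured_sphere sx).
  have [x0 sx0] := @sphere_exists R n (leq_trans (isT : (0 < 3)%N) n3).
  have ne : @sphere R n !=set0 by exists x0.
  have [x1 /set_mem s1 h1] := compact_EVT_min ne (@sphere_compact R n) cW.
  have [x2 /set_mem s2 h2] := compact_EVT_max ne (@sphere_compact R n) cW.
  have p1 := W0 _ (punctured_sphere s1).
  exists (W x1), (W x2); split=> //.
  - by apply: h1; rewrite inE.
  - move=> w /andP[l1 l2]; have wp : 0 < w := lt_le_trans p1 l1.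
    have i1 := rhoI s1; have i2 := rhoI s2; rewrite -WV // in i1; rewrite -WV // in i2.
    by apply: (iI i2 i1); rewrite !lef_pV2 ?posrE // ?l1 ?l2 // W0 //; exact: punctured_sphere.
  by move=> x sx; rewrite h1 ?h2 // inE.
have pos w : p <= w <= q -> 0 < w by move=> /andP[pw _]; exact: lt_le_trans pw.
have dQw w : p <= w <= q -> is_derive w (1 : R) Q (dQ w).
  move=> wi; have w0' : w != 0 by rewrite gt_eqF // pos.
  have Df := is_derive_comp1 (is_derive_inv w0' (is_derive_id w (1 : R))) (derivableP (dfI (pqI w wi))).
  have D := is_derive_add (is_derive_const C w (1 : R)) (is_derive_opp (is_derive_mul
    (is_derive_add (is_derive_pow 2 Df) (is_derive_const (-1) w (1 : R))) (is_derive_pow 2 (is_derive_id w (1 : R))))).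
  apply: is_derive_eq D _; rewrite /dQ /= !expr1.
  by move: (f w^-1) ('D_1 f w^-1) => g g'; field.
have [Psi hPsi] : exists Psi : R -> R, forall w, p <= w <= q -> is_derive w (1 : R) Psi (Q w / (2 * w ^+ 2)).
  apply: (antiderivative (h := fun w => Q w / (2 * w ^+ 2)) pq) => w wi.
  have w2 : 2 * w ^+ 2 != 0 by rewrite mulf_neq0 ?pnatr_eq0 // expf_neq0 // gt_eqF // pos.
  have D2 := is_derive_mul (is_derive_const (2 : R) w (1 : R)) (is_derive_pow 2 (is_derive_id w (1 : R))).
  have D := is_derive_mul (dQw w wi) (is_derive_inv (f := fun w : R => 2 * w ^+ 2) w2 D2).
  by have [/derivable1_diffP/differentiable_continuous cD _] := D.
have wdI x : O x -> p <= W x * (eucl x)^-1 <= q.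
  by move=> Ox; rewrite wdE //; apply: Wpq; exact: sphere_normalize.
have dQ0 x : O x -> 0 <= dQ (W x * (eucl x)^-1).
  move=> Ox; have := wdI x Ox; move: (_ * _) => w wi.
  have wp := pos w wi; have r0 : 0 < w^-1 by rewrite invr_gt0.
  have := hf (pqI w wi) r0; rewrite /dQ !invrK exprVn invrK.
  move: (f w^-1) ('D_1 f w^-1) => g g' H.
  (* [dQ w] is - 2 / w times the expression that the assumption on [f] makes nonpositive at r = 1 /
     w. *)
  have : 0 <= 2 * w^-1 * (- ((g ^+ 2 - 1) * w ^+ 2 - g * g' * w)) by apply: mulr_ge0; [rewrite mulr_ge0 // ltW|rewrite oppr_ge0].
  have -> : 2 * w^-1 * (- ((g ^+ 2 - 1) * w ^+ 2 - g * g' * w)) = 2 * g * g' - 2 * w * (g ^+ 2 - 1).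
    by field; rewrite gt_eqF.
  by [].
have eqn x : sphere x -> 2 / n.-1%:R * W x * laplacian W x - gradsq W x = Q (W x).
  move=> sx.
  have hY y i : O y -> ycoord (hext F y) 0 i = position W i y.
    by move=> Oy; rewrite [ycoord _](yF (sphere_normalize Oy)) cone_weight_position mxE.
  have hT y : O y -> tcoord (hext F y) = w0 + s * rstar (radial W y).
    by move=> Oy; rewrite [LHS](tF (sphere_normalize Oy)) cone_weight_radial.
  have hIr y : O y -> I (radial W y).
    by move=> Oy; rewrite cone_weight_radial //; apply: rhoI; exact: sphere_normalize.
  have := @static_cone_mean_curvature _ _ I f F s w0 rstar W ss (fun r Ir => lt0r_neq0 (fI Ir)) dfI sF
    dstar hW W0 homW hIr hY hT x sx.
  rewrite hc // mE /Q /C => ->; move: (W x) (laplacian _ _) (gradsq _ _) (f _) => w D E g.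
  by field.
have [a [be [WE dQE]]] := @rigidity R n W Q dQ Psi n3 hW W0 homW (fun x Ox => dQw _ (wdI x Ox)) dQ0
  (fun x Ox => hPsi _ (wdI x Ox)) eqn.
exists a, be; split=> x sx.
  have := WE _ (punctured_sphere sx); rewrite cone_weight_sphere // (sx : eucl x = 1) mulr1 => <-.
  by rewrite mulfV // gt_eqF // rho0.
rewrite -(dQE x sx) /dQ WV // /mass_slope cone_weight_sphere //.
by congr ((_ - _) * _); rewrite -!mulrA; congr (_ * _); rewrite mulrC.
Qed.

Lemma static_cone_symmetric : sphere_of_symmetry f I (F @` @sphere R n).
Proof.
have [a [be [rhoE slope]]] := static_rigidity.
have n0 : (0 < n)%N := leq_trans (isT : (0 < 3)%N) n3.
have [a0 abe] : 0 < a /\ dot be be < a ^+ 2.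
  apply: affine_positive n0 _ => x sx.
  by rewrite -(pmulr_rgt0 _ (rho0 sx)) rhoE.
have radF x : sphere x -> Defs.radius (F x) = rho x.
  by move=> sx; rewrite /Defs.radius yF // euclZ (sx : eucl x = 1) mulr1 gtr0_norm // rho0.
have Fev x : sphere x -> F x = event (w0 + s * rstar (rho x)) (rho x *: x).
  by move=> sx; apply: eventP; rewrite ?tcoord_event ?ycoord_event ?tF ?yF.
have [b0|b0] := eqVneq be 0.
  have rhoa x : sphere x -> rho x = a^-1.
    move=> sx; have := rhoE x sx; rewrite b0 dot0r addr0 => H.
    by rewrite -[LHS](mulfK (lt0r_neq0 a0)) H mul1r.
  have [x0 sx0] := @sphere_exists R n n0.
  left; exists (w0 + s * rstar a^-1), a^-1; split; last 1 first.
  - apply/seteqP; split=> [p [x sx <-]|p [tp rp]].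
      by split; rewrite ?tF ?radF ?rhoa.
    have y0 : ycoord p != 0 by rewrite -radius_eq0 rp invr_eq0 gt_eqF.
    have sy := sphere_normalize y0; exists ((eucl (ycoord p))^-1 *: ycoord p) => //.
    rewrite Fev // rhoa //; apply: eventP; rewrite ?tcoord_event ?ycoord_event ?tp //.
    by rewrite -[eucl _]/(Defs.radius p) rp scalerA mulfV ?scale1r // invr_eq0 gt_eqF.
  - by rewrite -(rhoa x0) //; exact: rhoI.
  - by rewrite invr_gt0.
set e := eucl be; have e0 : 0 < e := eucl_gt0 b0.
have e2 : e ^+ 2 = dot be be := eucl_sqr be.
have ea : e < a by rewrite -(@ltr_pXn2r _ 2) ?nnegrE ?ltW // e2.
(* The interval swept by 1 / (a + x.be), as x.be ranges from -|be| to |be|. *)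
pose J : set R := [set r | (a + e)^-1 <= r <= (a - e)^-1].
have ae : 0 < a + e by lra.
have ae' : 0 < a - e by lra.
have s1 := sphere_normalize b0.
have s2 : sphere (- ((eucl be)^-1 *: be)).
  by apply/sphereE; rewrite dotNl dotNr opprK; exact/sphereE.
have rhoV x : sphere x -> rho x = (a + dot x be)^-1.
  move=> sx; have H := rhoE x sx; have p0 : a + dot x be != 0.
    by apply/eqP => E; move: H; rewrite E mulr0 => /eqP; rewrite eq_sym oner_eq0.
  by rewrite -[LHS](mulfK p0) H mul1r.
have I1 : I (a + e)^-1.
  have := rhoI s1; rewrite rhoV // dotZl -e2 -/e expr2 mulKf ?gt_eqF //.
have I2 : I (a - e)^-1.
  have := rhoI s2; rewrite rhoV // dotNl dotZl -e2 -/e expr2 mulKf ?gt_eqF //.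
have JI : J `<=` I by move=> r Jr; exact: (iI I1 I2).
have nJ : nondegenerate_interval J.
  split; first by move=> x y /andP[x1 _] /andP[_ y2] z /andP[xz zy]; rewrite /J /= (le_trans x1) ?(le_trans zy).
  exists (a + e)^-1, (a - e)^-1; rewrite /J /= !lexx.
  have le : (a + e)^-1 < (a - e)^-1 by rewrite ltf_pV2 ?posrE //; lra.
  by rewrite (ltW le).
have Jrho x : sphere x -> J (rho x).
  move=> sx; have cs := cauchy_schwarz x be.
  have xx : dot x x = 1 by exact/sphereE.
  rewrite xx mul1r -e2 in cs.
  have : `|dot x be| <= e by have := ler_wsqrtr cs; rewrite !sqrtr_sqr (gtr0_norm e0).
  rewrite ler_norml => /andP[h1 h2]; rewrite /J /= rhoV // !lef_pV2 ?posrE //; lra.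
have Jp r : J r -> 0 < r by move=> /andP[r1 _]; apply: lt_le_trans r1; rewrite invr_gt0.
pose g (r : R) := (f r ^+ 2 - 1) * r ^- 2.
have dg r : J r -> is_derive r (1 : R) g (mass_slope r * r ^- 2).
  move=> Jr; have r0 : r != 0 by rewrite gt_eqF // Jp.
  have D := is_derive_mul (is_derive_add (is_derive_pow 2 (derivableP (dfI (JI _ Jr)))) (is_derive_const (-1) r (1 : R)))
    (is_derive_pow 2 (is_derive_inv r0 (is_derive_id r (1 : R)))).
  have -> : g = fun r => (f r ^+ 2 + -1) * r^-1 ^+ 2 by apply/funext => z; rewrite /g exprVn.
  apply: is_derive_eq D _; rewrite /mass_slope /= !expr1; move: (f r) ('D_1 f r) => h h'.
  by field.
(* Only interior radii: at the ends x is parallel to [be] and the factor |be|^2 - (x.be)^2 vanishes.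
   The mean value theorem below evaluates the slope at interior points. *)
have slope0 r : (a + e)^-1 < r < (a - e)^-1 -> mass_slope r = 0.
  move=> /andP[r1 r2]; have rp : 0 < r by apply: lt_trans r1; rewrite invr_gt0.
  have q1 : r^-1 < a + e by rewrite -[a + e]invrK ltf_pV2 ?posrE ?invr_gt0.
  have q2 : a - e < r^-1 by rewrite -[a - e]invrK ltf_pV2 ?posrE ?invr_gt0.
  have te : (r^-1 - a) ^+ 2 < dot be be.
    have -> : (r^-1 - a) ^+ 2 = e ^+ 2 - (a + e - r^-1) * (r^-1 - (a - e)) by ring.
    by rewrite -e2 ltrBlDr ltrDl mulr_gt0 // subr_gt0.
  have [x sx xt] := level_exists (ltnW n3) te.
  have := slope x sx; rewrite rhoV // xt addrC subrK invrK => /eqP.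
  by rewrite mulf_eq0 => /orP[/eqP //|]; rewrite subr_eq0 (gt_eqF te).
have gcst r r' : J r -> J r' -> g r = g r'.
  have main u v : J u -> J v -> u < v -> g u = g v.
    move=> Ju Jv uv; have Jw w : u <= w <= v -> J w.
      by move: Ju Jv => /andP[u1 _] /andP[_ v2] /andP[uw wv]; rewrite /J /= (le_trans u1) ?(le_trans wv).
    have [w||w] := @MVT R g (fun w => mass_slope w * w ^- 2) u v uv.
    - by rewrite in_itv /= => /andP[uw wv]; apply: dg; apply: Jw; rewrite !ltW.
    - apply: continuous_in_subspaceT => w; rewrite inE /= in_itv /= => wi.
      by have [/derivable1_diffP/differentiable_continuous cD _] := dg _ (Jw _ wi).
    rewrite in_itv /= => /andP[uw wv] /eqP.
    have -> : mass_slope w = 0.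
      apply: slope0; move: Ju Jv => /andP[u1 _] /andP[_ v2].
      by rewrite (le_lt_trans u1 uw) (lt_le_trans wv v2).
    by rewrite !mul0r subr_eq0 => /eqP.
  move=> Jr Jr'; case: (ltgtP r r') => [lt|lt|-> //]; first exact: main.
  by rewrite (main r' r).
pose r0 := rho ((eucl be)^-1 *: be); have J0 : J r0 := Jrho _ s1.
pose kappa := - g r0.
have hJ r : J r -> f r ^+ 2 = 1 - kappa * r ^+ 2.
  move=> Jr; rewrite /kappa (gcst r0 r) // /g; have r0' : r != 0 by rewrite gt_eqF // Jp.
  by field.
have NJ r : J r -> 0 < 1 - kappa * r ^+ 2 by move=> Jr; rewrite -hJ // exprn_gt0 // fI //; exact: JI.
have FJ x : sphere x -> J (Defs.radius (F x)) by move=> sx; rewrite radF //; exact: Jrho.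
have dJ r : J r -> is_derive r (1 : R) rstar ((1 - kappa * r ^+ 2)^-1).
  by move=> Jr; rewrite -hJ //; exact: dstar (JI _ Jr).
have iso1 N (B : 'M[R]_N) : isometry_mx B 1%:M by rewrite /isometry_mx trmx1 mulmx1 mul1mx.
have iJ : is_interval J by case: nJ.
have [k0|k0] := eqVneq kappa 0.
  (* When kappa = 0 one has f = 1 on J, so r* - r is constant there and the cone is a light cone of
     Minkowski space. *)
  have rs r : J r -> rstar r - r = rstar r0 - r0.
    move=> Jr; apply: (constant_on_interval iJ (h := fun r => rstar r - r)) => // z Jz.
    have D := is_derive_add (dJ z Jz) (is_derive_opp (is_derive_id z (1 : R))).
    by apply: is_derive_eq D _; rewrite k0 mul0r subr0 invr1 subrr.
  pose V : 'rV[R]_(1 + n) := event (w0 + s * (rstar r0 - r0)) 0.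
  apply: (@flat_section_symmetric _ _ n3 f I J F kappa nJ JI hJ FJ s rho ss rho0 k0 V 1%:M 0 _ _ a be rhoE).
  - have -> : (fun X : 'rV[R]_(1 + n) => (X + V) *m 1%:M + 0) = (fun X => X + V).
      by apply/funext => X; rewrite mulmx1 addr0.
    by apply: lorentz_translation; exists (w0 + s * (rstar r0 - r0)).
  move=> x sx; rewrite mulmx1 addr0 Fev // mul_flat_space_mx /V -(rs _ (Jrho x sx)).
  apply: eventP; rewrite !coordE !(tcoord_event, ycoord_event); last by rewrite !add0r.
  by rewrite addr0; ring.
have [eps [e1 [e2' [d1 [d2 [AC hM]]]]]] := model_quadric n k0.
apply: (@quadric_section_symmetric _ _ n3 f I J F kappa nJ JI fI hJ FJ s rho ss rho0 k0 eps e1 e2' d1 d2 AC hM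
  (w0 + s * rstar r0) r0 (NJ _ J0) 1%:M (iso1 _ _) _ a be rhoE).
move=> x sx; rewrite mulmx1 Fev //; case: AC => _ _ _ _ de1 de2 dd1 dd2 _.
have Jx := Jrho x sx.
rewrite quadric_emb_axial // ?ltW ?rho0 //.
(* Over J the cone t = w0 + s r* is the model cone of the sphere of radius [r0] at time w0 + s
   r*(r0), with the radius as parameter. *)
rewrite (axial_line ss w0 iJ NJ dJ de1 dd1 J0 Jx) (axial_line ss w0 iJ NJ dJ de2 dd2 J0 Jx).
rewrite -axial_lin /null_apex -/(null_generator kappa e1 e2' d1 d2 s (w0 + s * rstar r0) r0).
move: (axial _ _) (null_generator _ _ _ _ _ _ _ _) (x *m space_mx) => A l K.
by apply/rowP => i; rewrite !mxE; ring.
Qed.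

End StaticCone.

Theorem theorem1p5 (R : realType) (n : nat) (hn : (3 <= n)%N)
    (I : set R) (hI : nondegenerate_interval I)
    (hI0 : forall r, I r -> 0 <= r)
    (f : R -> R) (hfpos : forall r, I r -> 0 < f r)
    (hfsmooth : exists U : set R, open U /\ I `<=` U /\ smooth_on U f)
    (hf : forall r, I r -> 0 < r ->
       (f r ^+ 2 - 1) / r ^+ 2 - f r * derive1 f r / r <= 0)
    (F : 'rV[R]_n -> 'rV[R]_(1 + n))
    (hFV : forall x, sphere x -> spacetime I (F x))
    (hFsmooth : smooth_sphere F)
    (hspace : spacelike (static_metric f) F)
    (hcone : in_standard_null_cone f I F)
    (hH : constant_norm_mean_curvature (static_metric f) F) :
  sphere_of_symmetry f I (F @` @sphere R n).
Proof.
case: hfsmooth => U [_ [IU sU]].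
have dfI r : I r -> derivable f r 1 by move=> Ir; have [_] := sU [::] r (IU r Ir); exact.
case: hcone => [[out [rstar [w0 [v [rho [dstar _ h]]]]]]|hm].
  have hf' r : I r -> 0 < r -> (f r ^+ 2 - 1) / r ^+ 2 - f r * 'D_1 f r / r <= 0.
    by move=> Ir r0; rewrite -derive1E; exact: hf.
  apply: (static_cone_symmetric hn (proj1 hI) hfpos dfI hf' hFsmooth hH
    (cone_sign_sqr out) dstar (rho := rho) (w0 := w0)) => x sx; have [rx Ir yx tx _] := h x sx => //.
  by rewrite -tx subrK.
exact: (moved_cone_symmetric hn hI0 hfpos dfI hFsmooth hH hm).
Qed.
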